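(* For every integer $n\ge 1$ and every $x\in\mathbb{R}$, $x\neq0$, $$\left.\frac{\partial \mathrm{M}_{\kappa,\mu}(x)}{\partial\kappa}\right|_{\kappa=n,\,\mu=1/2}=\frac{2}{n}\sinh\left(\frac{x}{2}\right)+\frac{x\,e^{-x/2}}{n}\left\{\left[\ln|x|+\gamma-H_n-\mathrm{Ei}(x)\right]L_{n-1}^{(1)}(x)+\sum_{\ell=1}^{n-1}\left(\frac{n+\ell}{n-\ell}-e^{x}\,\mathrm{Re}\left[{}_2F_1\!\left(\left.\begin{array}{c}1,\ell\\ \ell+n\end{array}\right|2\right)\right]\right)\frac{L_{\ell-1}^{(1)}(x)}{\ell}\right\}.$$
   Context: The Whittaker function is $\mathrm{M}_{\kappa,\mu}(x)=x^{\mu+1/2}e^{-x/2}\,{}_1F_1\!\left(\tfrac12+\mu-\kappa;\,1+2\mu;\,x\right)$, $2\mu\neq-1,-2,\ldots$. Here $\gamma$ is Euler's constant, $H_n=\sum_{k=1}^n\frac1k$, $\mathrm{Ei}$ is the exponential integral (Cauchy principal value for $x>0$), so that $\mathrm{Ei}(x)=\gamma+\ln|x|+\sum_{k\ge1}\frac{x^k}{k\,k!}$ for real $x\ne0$, and $L_n^{(\alpha)}(x)=\sum_{m=0}^{n}\frac{\Gamma(n+\alpha+1)}{\Gamma(m+\alpha+1)}\frac{(-x)^m}{m!\,(n-m)!}$ are the Laguerre polynomials. The value ${}_2F_1(1,\ell;\ell+n;2)$ is that of the analytic continuation of the Gauss hypergeometric function to the branch cut $[1,\infty)$, i.e. the limit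 at $z=2$ from the upper or from the lower half-plane; its real part does not depend on the side. *)

(* Defs.v *)
From Stdlib Require Export Reals Factorial ClassicalEpsilon.
From Coquelicot Require Export Coquelicot.
Open Scope R_scope.

(* [iota P] is Coquelicot's definite description in a complete space: it is
   the unique element satisfying P whenever there is exactly one. *)
Definition C_iota (P : C -> Prop) : C :=
  @iota (CompleteNormedModule.CompleteSpace C_AbsRing C_CompleteNormedModule) P.

Fixpoint pochhammer (a : C) (k : nat) : C :=
  match k with
  | O => RtoC 1
  | S j => (pochhammer a j * (a + RtoC (INR j)))%C
  end.

Definition hyp1F1_coeff (a b : C) (k : nat) : C :=
  (pochhammer a k / (pochhammer b k * RtoC (INR (fact k))))%C.

Definition hyp1F1 (a b z : C) : C :=
  C_iota (fun s : C => @is_pseries C_AbsRing C_NormedModule (hyp1F1_coeff a b) z s).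

(* Principal branch of x ^ s for real x <> 0:
   exp (s * (ln |x| + i * arg x)) with arg x = PI when x < 0. *)
Definition Cexp (z : C) : C :=
  (exp (Re z) * cos (Im z), exp (Re z) * sin (Im z)).

Definition Rcpow (x : R) (s : C) : C :=
  Cexp (s * (ln (Rabs x), if Rlt_dec x 0 then PI else 0))%C.

(* M_{kappa,mu}(x), for complex parameters with 2 mu not in {-1, -2, ...}
   and real x <> 0. *)
Definition whittakerM (kappa mu : C) (x : R) : C :=
  (Rcpow x (mu + RtoC (1 / 2)) * RtoC (exp (- x / 2)) *
   hyp1F1 (RtoC (1 / 2) + mu - kappa) (RtoC 1 + RtoC 2 * mu) (RtoC x))%C.

Definition hyp2F1_coeff (a b c : C) (k : nat) : C :=
  (pochhammer a k * pochhammer b k /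
   (pochhammer c k * RtoC (INR (fact k))))%C.

Definition analytic_at (f : C -> C) (z : C) : Prop :=
  exists (r : posreal) (a : nat -> C), forall w : C,
    Cmod (w - z)%C < r ->
    @is_pseries C_AbsRing C_NormedModule a (w - z)%C (f w).

Definition in_cut_plane (z : C) : Prop := ~ (Im z = 0 /\ 1 <= Re z).

Definition is_hyp2F1_continuation (a b c : C) (F : C -> C) : Prop :=
  (forall z : C, Cmod z < 1 ->
     @is_pseries C_AbsRing C_NormedModule (hyp2F1_coeff a b c) z (F z)) /\
  (forall z : C, in_cut_plane z -> analytic_at F z).

(* The analytic continuation of the Gauss series to the plane cut along
   [1, +oo); the values on the cut itself are irrelevant. *)
Definition hyp2F1 (a b c : C) : C -> C :=
  epsilon (inhabits (fun _ : C => RtoC 0)) (is_hyp2F1_continuation a b c).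

Inductive cut_side := upper | lower.

Definition half_plane (s : cut_side) (z : C) : Prop :=
  match s with
  | upper => 0 < Im z
  | lower => Im z < 0
  end.

Definition hyp2F1_cut (s : cut_side) (a b c : C) (x : R) : C :=
  C_iota (fun l : C =>
    filterlim (hyp2F1 a b c) (within (half_plane s) (locally (RtoC x)))
      (locally l)).

Definition harmonic (n : nat) : R := sum_n_m (fun k => / INR k) 1 n.

Definition euler_gamma : R :=
  real (Lim_seq (fun n => harmonic n - ln (INR n))).

(* Ei x is the integral of exp t / t over (-oo, x], taken as a Cauchy
   principal value at t = 0 when x > 0. *)
Definition Ei_to (y : R) : R :=
  RInt_gen (fun t => exp t / t) (Rbar_locally m_infty) (at_point y).

Definition Ei (x : R) : R :=
  if Rlt_dec x 0 then Ei_to x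
  else
    iota (fun l : R =>
      filterlim (fun eps => Ei_to (- eps) + RInt (fun t => exp t / t) eps x)
        (at_right 0) (locally l)).

(* L_n^(alpha) for alpha a natural number, so that
   Gamma (k + alpha + 1) = (k + alpha)!. *)
Definition laguerre (n alpha : nat) (x : R) : R :=
  sum_n_m (fun m =>
    INR (fact (n + alpha)) / INR (fact (m + alpha)) *
    ((- x) ^ m / (INR (fact m) * INR (fact (n - m))))) 0 n.

(* Main.v *)
(** With y = 1F1(1 - kappa; 2; x) one has M_{kappa,1/2}(x) = x e^{-x/2} y, and the derivative S of y
    in kappa at kappa = n solves the inhomogeneous Kummer equation
    x S'' + (2 - x) S' + (n - 1) S = - L_{n-1}^{(1)} / n with S(0) = 0, which has only one power series
    solution. The bracket on the right-hand side becomes, after ln|x| + gamma - Ei(x) = - sum x^k / (k k!),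
    an entire function; that it solves the same equation reduces, through the contiguity relations of the
    Laguerre polynomials, to the recurrence (l + n) (R_l - 1) = 2 l R_{l+1}, R_n = 0, for
    R_l = Re 2F1(1, l; l + n; 2), and its vanishing at 0 to sum_{l < n} R_l = n (H_n - 1).
    The recurrence is the contiguity relation 2F1(1, l; l + n; z) = 1 + l / (l + n) z 2F1(1, l + 1; l + 1 + n; z),
    and R_n = 0 since 2F1(1, n; 2n; z) is obtained from - log(1 - z) / z, purely imaginary at z = 2,
    by a recurrence in n which preserves this property. *)
Require Import Defs.
From Stdlib Require Import Lra Lia Psatz.

(** * Complex power series *)

(** Several symbols of the statement are total descriptions: [hyp2F1] is an epsilon choice,
    [hyp1F1], [hyp2F1_cut] and, for x > 0, [Ei] are iotas, [euler_gamma] is read off a [Lim_seq].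
    Each has to be pinned down by existence (and, except for the sequence, uniqueness) before it can
    be computed; this accounts for most of the preliminary analysis. For [hyp2F1] it takes an
    identity theorem on the cut plane and an explicit continuation, built from the integral of 1/(1
    - z t) over [0, 1], whose analyticity is visible without choosing a branch of the logarithm.
    Euler's constant is the number that makes gamma + ln|t| + [Ein] t tend to 0 at minus infinity;
    it is tied to H_m by comparing (1 - t/m)^m with e^{-t}. The factor (n + l)/(n - l) and the
    number R_l have a common origin. The Kummer operator sends the sum with weights (n + l)/((n - l)
    l) to Z, the sum of (n + l)/l L_{l-1}^{(1)} over l < n, and sends e^x times the sum with weights
    R_l / l to e^x Z. Their difference leaves (1 - e^x) Z, which cancels the terms created by (e^x -
    1)/x and by the product of L_{n-1}^{(1)} with the regular part of Ei. *)

Notation is_Cpseries := (@is_pseries C_AbsRing C_NormedModule).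

Fixpoint Csum (a : nat -> C) (n : nat) : C :=
  match n with
  | O => a O
  | S m => (Csum a m + a (S m))%C
  end.

Lemma Csum_eq (a : nat -> C) (n : nat) :
  @sum_n (NormedModule.AbelianMonoid C_AbsRing C_NormedModule) a n = Csum a n.
Proof.
  induction n as [|n IH]; simpl.
  - apply sum_O.
  - rewrite sum_Sn, IH; reflexivity.
Qed.

Lemma Csum_ext (a b : nat -> C) (n : nat) :
  (forall k, (k <= n)%nat -> a k = b k) -> Csum a n = Csum b n.
Proof.
  induction n as [|n IH]; simpl; intros H.
  - apply H; lia.
  - rewrite IH by (intros; apply H; lia). rewrite H by lia; reflexivity.
Qed.

Lemma pow_n_Cpow (z : C) (k : nat) : @pow_n C_Ring z k = (z ^ k)%C.
Proof.
  induction k as [|k IH].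
  - reflexivity.
  - change (@pow_n C_Ring z (S k)) with (z * @pow_n C_Ring z k)%C.
    now rewrite IH, Cpow_S.
Qed.

(** The neighbourhoods of C are boxes of the product structure, while all estimates below are in
    [Cmod]; the two agree through the norm balls of the complex normed module. *)
Lemma is_Cseries_iff (a : nat -> C) (l : C) :
  @is_series C_AbsRing C_NormedModule a l <->
  forall eps : R, 0 < eps -> exists N, forall n, (N <= n)%nat -> Cmod (Csum a n - l) < eps.
Proof.
  unfold is_series. rewrite (filterlim_locally_ball_norm (K := C_AbsRing) (U := C_NormedModule)).
  unfold ball_norm, eventually. split.
  - intros H eps Heps. destruct (H (mkposreal eps Heps)) as [N HN].
    exists N; intros n Hn. specialize (HN n Hn). rewrite Csum_eq in HN. exact HN.
  - intros H eps. destruct (H eps (cond_pos eps)) as [N HN].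
    exists N; intros n Hn. specialize (HN n Hn). rewrite Csum_eq. exact HN.
Qed.

Lemma is_Cpseries_iff (a : nat -> C) (z l : C) :
  is_Cpseries a z l <->
  forall eps : R, 0 < eps -> exists N, forall n, (N <= n)%nat ->
    Cmod (Csum (fun k => a k * z ^ k)%C n - l) < eps.
Proof.
  unfold is_pseries. rewrite is_Cseries_iff.
  assert (E : forall n, Csum (fun k => @scal C_AbsRing C_NormedModule (pow_n (K := C_AbsRing) z k) (a k)) n
     = Csum (fun k => a k * z ^ k)%C n).
  { intro n. apply Csum_ext; intros k _.
    change (@pow_n C_Ring z k * a k = a k * z ^ k)%C. rewrite pow_n_Cpow; ring. }
  split; intros H eps Heps; destruct (H eps Heps) as [N HN]; exists N; intros n Hn;
    [rewrite <- E|rewrite E]; auto.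
Qed.

(** Convergence with a geometric error. The choice A = q = 0 covers series whose partial sums are
    already equal to the limit. *)
Lemma is_Cpseries_bound (a : nat -> C) (z l : C) (A q : R) :
  0 <= q < 1 ->
  (forall n, Cmod (Csum (fun k => a k * z ^ k)%C n - l) <= A * q ^ n) ->
  is_Cpseries a z l.
Proof.
  intros Hq H. apply is_Cpseries_iff. intros eps Heps.
  assert (HA : 0 < Rabs A + 1) by (pose proof (Rabs_pos A); lra).
  assert (Hq' : Rabs q < 1) by (rewrite Rabs_pos_eq; lra).
  destruct (pow_lt_1_zero q Hq' (eps / (Rabs A + 1))) as [N HN].
  { apply Rdiv_lt_0_compat; lra. }
  exists N; intros n Hn. specialize (HN n Hn). specialize (H n).
  assert (0 <= q ^ n) by (apply pow_le; lra).
  rewrite Rabs_pos_eq in HN by assumption.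
  apply (Rmult_lt_compat_l (Rabs A + 1)) in HN; [|assumption].
  replace ((Rabs A + 1) * (eps / (Rabs A + 1))) with eps in HN by (field; lra).
  pose proof (Rle_abs A). nra.
Qed.

Lemma is_Cpseries_unique (a : nat -> C) (z l1 l2 : C) :
  is_Cpseries a z l1 -> is_Cpseries a z l2 -> l1 = l2.
Proof.
  rewrite !is_Cpseries_iff. intros H1 H2.
  apply Ceq_minus, Cmod_eq_0. apply Rle_antisym; [|apply Cmod_ge_0].
  apply le_epsilon; intros eps Heps.
  destruct (H1 (eps / 2)) as [N1 HN1]; [lra|]. destruct (H2 (eps / 2)) as [N2 HN2]; [lra|].
  specialize (HN1 (N1 + N2)%nat ltac:(lia)). specialize (HN2 (N1 + N2)%nat ltac:(lia)).
  set (S := Csum _ _) in *.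
  replace (l1 - l2)%C with ((S - l2) - (S - l1))%C by ring.
  unfold Cminus at 1. eapply Rle_trans; [apply Cmod_triangle|]. rewrite Cmod_opp. lra.
Qed.

Lemma Cpseries_terms_bounded (a : nat -> C) (z l : C) :
  is_Cpseries a z l -> exists A, 0 < A /\ forall k, Cmod (a k) * Cmod z ^ k <= A.
Proof.
  rewrite is_Cpseries_iff. intros H. destruct (H 1 Rlt_0_1) as [N HN].
  assert (B : exists A, 0 < A /\ forall k, (k <= N)%nat -> Cmod (a k) * Cmod z ^ k <= A).
  { clear HN. induction N as [|N [A [HA IH]]].
    - exists (Cmod (a O) + 1). split; [pose proof (Cmod_ge_0 (a O)); lra|].
      intros k Hk. replace k with O by lia. simpl. lra.
    - exists (A + Cmod (a (S N)) * Cmod z ^ S N).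
      assert (0 <= Cmod (a (S N)) * Cmod z ^ S N).
      { apply Rmult_le_pos; [apply Cmod_ge_0|apply pow_le, Cmod_ge_0]. }
      split; [lra|]. intros k Hk. destruct (Nat.eq_dec k (S N)) as [->|Hne]; [lra|].
      specialize (IH k ltac:(lia)). lra. }
  (* Beyond N each term is the difference of two partial sums within 1 of the limit, hence at most
     2. *)
  destruct B as [A [HA B]]. exists (A + 2). split; [lra|]. intros k.
  destruct (Nat.le_gt_cases k N) as [Hk|Hk]; [specialize (B k Hk); lra|].
  destruct k as [|k]; [lia|].
  pose proof (HN k ltac:(lia)) as H1. pose proof (HN (S k) ltac:(lia)) as H2. simpl Csum in H2.
  rewrite <- Cmod_pow, <- Cmod_mult.
  set (s := Csum _ k) in *.
  replace (a (S k) * z ^ S k)%C with ((s + a (S k) * (z * z ^ k) - l) - (s - l))%C by (simpl; ring).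
  unfold Cminus at 1. eapply Rle_trans; [apply Cmod_triangle|]. rewrite Cmod_opp.
  simpl in H2. lra.
Qed.

Lemma Csum_geom_bound (a : nat -> C) (w : C) (A u : R) :
  0 < u -> 0 <= A -> 2 * Cmod w <= u ->
  (forall k, Cmod (a k) * u ^ k <= A) ->
  forall n, Cmod (Csum (fun k => a k * w ^ k)%C n - a O) <= 2 * A * (Cmod w / u).
Proof.
  intros Hu HA Hw H.
  assert (Hq : 0 <= Cmod w / u <= / 2).
  { pose proof (Cmod_ge_0 w). split.
    - apply Rmult_le_pos; [lra|]. left; apply Rinv_0_lt_compat; lra.
    - apply Rle_div_l; lra. }
  set (q := Cmod w / u) in *.
  assert (T : forall k, Cmod (a k * w ^ k) <= A * q ^ k).
  { intro k. rewrite Cmod_mult, Cmod_pow. replace (Cmod w) with (q * u) by (unfold q; field; lra).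
    rewrite Rpow_mult_distr. specialize (H k). assert (0 <= q ^ k) by (apply pow_le; lra).
    nra. }
  (* The geometric tail in telescoping form: q^(n+1) <= 2 (q^(n+1) - q^(n+2)) because q <= 1/2. *)
  assert (G : forall n, Cmod (Csum (fun k => a k * w ^ k)%C n - a O) <= 2 * A * (q - q ^ S n)).
  { induction n as [|n IH]; cbn [Csum].
    - replace (a O * w ^ 0 - a O)%C with (RtoC 0) by (simpl; ring). rewrite Cmod_0. simpl. lra.
    - specialize (T (S n)). set (s := Csum _ n) in *.
      replace (s + a (S n) * w ^ S n - a O)%C with ((s - a O) + a (S n) * w ^ S n)%C by ring.
      eapply Rle_trans; [apply Cmod_triangle|].
      assert (A * q ^ S n <= 2 * A * (q ^ S n - q ^ S (S n))).
      { simpl. assert (0 <= q * q ^ n) by (apply Rmult_le_pos; [lra|apply pow_le; lra]).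
        assert (0 <= A * (q * q ^ n)) by nra. nra. }
      simpl in *. lra. }
  intro n. specialize (G n). assert (0 <= q ^ S n) by (apply pow_le; lra). nra.
Qed.

(** * Analytic functions on the cut plane *)

Lemma is_Cpseries_ext (a b : nat -> C) (z l : C) :
  (forall k, a k = b k) -> is_Cpseries a z l -> is_Cpseries b z l.
Proof. exact (@is_pseries_ext C_AbsRing C_NormedModule a b z l). Qed.

Lemma is_Cpseries_plus (a b : nat -> C) (z la lb : C) :
  is_Cpseries a z la -> is_Cpseries b z lb ->
  is_Cpseries (fun k => a k + b k)%C z (la + lb)%C.
Proof. exact (@is_pseries_plus C_AbsRing C_NormedModule a b z la lb). Qed.

Lemma is_Cpseries_scal (c : C) (a : nat -> C) (z l : C) :
  is_Cpseries a z l -> is_Cpseries (fun k => c * a k)%C z (c * l)%C.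
Proof.
  intros H. apply (@is_pseries_scal C_AbsRing C_NormedModule c a z l); [|exact H].
  apply Cmult_comm.
Qed.

Lemma is_Cpseries_incr (a : nat -> C) (z l : C) :
  is_Cpseries a z l ->
  is_Cpseries (fun k => match k with O => RtoC 0 | S j => a j end) z (z * l)%C.
Proof.
  intros H. apply (@is_pseries_incr_1 C_AbsRing C_NormedModule a z l) in H.
  eapply is_Cpseries_ext; [|exact H]. intros [|k]; reflexivity.
Qed.

Lemma is_Cpseries_const (c z : C) :
  is_Cpseries (fun k => match k with O => c | S _ => RtoC 0 end) z c.
Proof.
  apply (is_Cpseries_bound _ _ _ 0 0); [lra|]. intro n.
  replace (Csum _ n) with c.
  - replace (c - c)%C with (RtoC 0) by ring. rewrite Cmod_0. lra.
  - induction n as [|n IH]; cbn [Csum]; [simpl; ring|]. rewrite <- IH. ring.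
Qed.

Lemma analytic_at_ext (f g : C -> C) (z0 : C) (r : R) :
  0 < r -> (forall w, Cmod (w - z0) < r -> f w = g w) ->
  analytic_at f z0 -> analytic_at g z0.
Proof.
  intros Hr H [r' [a Ha]].
  exists (mkposreal _ (Rmin_stable_in_posreal (mkposreal r Hr) r')), a.
  simpl. intros w Hw. rewrite <- H.
  - apply Ha. eapply Rlt_le_trans; [exact Hw|apply Rmin_r].
  - eapply Rlt_le_trans; [exact Hw|apply Rmin_l].
Qed.

Lemma analytic_at_const (c z0 : C) : analytic_at (fun _ => c) z0.
Proof.
  exists (mkposreal 1 Rlt_0_1), (fun k => match k with O => c | S _ => RtoC 0 end).
  intros w _. apply is_Cpseries_const.
Qed.

Lemma analytic_at_plus (f g : C -> C) (z0 : C) :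
  analytic_at f z0 -> analytic_at g z0 -> analytic_at (fun z => f z + g z)%C z0.
Proof.
  intros [r [a Ha]] [r' [b Hb]].
  exists (mkposreal _ (Rmin_stable_in_posreal r r')), (fun k => a k + b k)%C.
  simpl. intros w Hw. apply is_Cpseries_plus.
  - apply Ha. eapply Rlt_le_trans; [exact Hw|apply Rmin_l].
  - apply Hb. eapply Rlt_le_trans; [exact Hw|apply Rmin_r].
Qed.

Lemma analytic_at_scal (c : C) (f : C -> C) (z0 : C) :
  analytic_at f z0 -> analytic_at (fun z => c * f z)%C z0.
Proof.
  intros [r [a Ha]]. exists r, (fun k => c * a k)%C.
  intros w Hw. apply is_Cpseries_scal; auto.
Qed.

Lemma analytic_at_mul_id (f : C -> C) (z0 : C) :
  analytic_at f z0 -> analytic_at (fun z => z * f z)%C z0.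
Proof.
  intros [r [a Ha]].
  exists r, (fun k => z0 * a k + match k with O => RtoC 0 | S j => a j end)%C.
  intros w Hw. replace (w * f w)%C with (z0 * f w + (w - z0) * f w)%C by ring.
  apply is_Cpseries_plus; [apply is_Cpseries_scal|apply is_Cpseries_incr]; auto.
Qed.

(** Taylor coefficients b_k of f(z)/z about z0: with z = z0 + v, comparing coefficients gives a_k =
    z0 b_k + b_{k-1}. *)
Fixpoint quot_coeff (a : nat -> C) (z0 : C) (k : nat) : C :=
  match k with
  | O => (a O / z0)%C
  | S j => ((a k - quot_coeff a z0 j) / z0)%C
  end.

(** The coefficients are forced by [quot_coeff]; what needs an argument is that their series
    converges, and to the quotient. A bound on b_k u^k on a small circle does both, since
    multiplying a partial sum by w leaves a single remainder term. *)
Lemma analytic_at_div_id (f : C -> C) (z0 : C) :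
  z0 <> RtoC 0 -> analytic_at f z0 -> analytic_at (fun z => f z / z)%C z0.
Proof.
  intros Hz [r [a Ha]].
  assert (Hz0 : 0 < Cmod z0) by (apply Cmod_gt_0; exact Hz).
  (* Half of the minimum: u < r keeps the circle inside the disc of f, and 2 u <= |z0| closes the
     induction for the bound. *)
  set (u := Rmin r (Cmod z0) / 2).
  assert (Hm : 0 < Rmin r (Cmod z0)) by (apply Rmin_glb_lt; [apply cond_pos|lra]).
  assert (Hu : 0 < u) by (unfold u; lra).
  assert (Hur : u < r) by (unfold u; pose proof (Rmin_l r (Cmod z0)); lra).
  assert (Huz : 2 * u <= Cmod z0) by (unfold u; pose proof (Rmin_r r (Cmod z0)); lra).
  destruct (Cpseries_terms_bounded a (RtoC u) (f (z0 + RtoC u)%C)) as [A [HA B]].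
  { replace (RtoC u) with ((z0 + RtoC u) - z0)%C at 1 by ring.
    apply Ha. replace ((z0 + RtoC u) - z0)%C with (RtoC u) by ring.
    rewrite Cmod_R, Rabs_pos_eq; lra. }
  rewrite Cmod_R, Rabs_pos_eq in B by lra.
  (* From |b_{k+1}| u^{k+1} <= (A + u |b_k| u^k) / |z0|: the bound 2 A / |z0| reproduces itself as
     soon as 2 u <= |z0|. *)
  assert (D : forall k, Cmod (quot_coeff a z0 k) * u ^ k <= 2 * A / Cmod z0).
  { assert (Hi : 0 < / Cmod z0) by (apply Rinv_0_lt_compat; lra).
    induction k as [|k IH].
    - cbn [quot_coeff]. rewrite Cmod_div by assumption. specialize (B O). simpl in *.
      unfold Rdiv. nra.
    - cbn [quot_coeff]. rewrite Cmod_div by assumption.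
      pose proof (Cmod_triangle (a (S k)) (- quot_coeff a z0 k)) as T.
      rewrite Cmod_opp in T. fold (Cminus (a (S k)) (quot_coeff a z0 k)) in T.
      specialize (B (S k)).
      assert (0 < u ^ S k) by (apply pow_lt; lra).
      assert (Cmod (a (S k) - quot_coeff a z0 k)%C * u ^ S k <= A + u * (2 * A / Cmod z0)).
      { simpl in *. nra. }
      assert (u * (2 * A / Cmod z0) <= A).
      { replace A with (Cmod z0 * (A / Cmod z0)) at 2 by (field; lra).
        assert (0 < A / Cmod z0) by (apply Rdiv_lt_0_compat; lra). nra. }
      unfold Rdiv. nra. }
  exists (mkposreal u Hu), (quot_coeff a z0). simpl. intros w Hw.
  set (v := (w - z0)%C) in *.
  assert (Hw0 : w <> RtoC 0).
  { intros ->. unfold v in Hw. replace (0 - z0)%C with (- z0)%C in Hw by ring.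
    rewrite Cmod_opp in Hw. lra. }
  assert (I : forall n, (w * Csum (fun k => quot_coeff a z0 k * v ^ k) n =
                Csum (fun k => a k * v ^ k) n + quot_coeff a z0 n * v ^ S n)%C).
  { induction n as [|n IH]; cbn [Csum].
    - unfold v. simpl. field; assumption.
    - rewrite Cmult_plus_distr_l, IH. cbn [quot_coeff]. rewrite !Cpow_S.
      replace w with (z0 + v)%C by (unfold v; ring). field; assumption. }
  assert (Hc : is_Cpseries a v (f w)) by (apply Ha; fold v; lra).
  rewrite is_Cpseries_iff in Hc. apply is_Cpseries_iff. intros eps Heps.
  assert (Hcw : 0 < Cmod w) by (apply Cmod_gt_0; exact Hw0).
  destruct (Hc (eps * Cmod w / 2)) as [N1 HN1].
  { apply Rmult_lt_0_compat; [apply Rmult_lt_0_compat; lra|lra]. }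
  assert (Hq : 0 <= Cmod v / u < 1).
  { split; [apply Rmult_le_pos; [apply Cmod_ge_0|left; apply Rinv_0_lt_compat; lra]|].
    apply Rlt_div_l; lra. }
  set (K := 2 * A / Cmod z0 * u).
  assert (HK : 0 < K).
  { unfold K. apply Rmult_lt_0_compat; [|lra]. apply Rdiv_lt_0_compat; lra. }
  destruct (pow_lt_1_zero (Cmod v / u)) with (y := eps * Cmod w / 2 / K) as [N2 HN2].
  { rewrite Rabs_pos_eq; lra. }
  { apply Rdiv_lt_0_compat; nra. }
  exists (N1 + N2)%nat. intros n Hn.
  specialize (HN1 n ltac:(lia)). specialize (HN2 (S n) ltac:(lia)).
  rewrite Rabs_pos_eq in HN2 by (apply pow_le; lra).
  set (s := Csum (fun k => quot_coeff a z0 k * v ^ k)%C n) in *.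
  assert (E : (w * (s - f w / w) = (Csum (fun k => a k * v ^ k) n - f w)
       + quot_coeff a z0 n * v ^ S n)%C).
  { replace (w * (s - f w / w))%C with (w * s - f w)%C by (field; assumption).
    unfold s; rewrite I. ring. }
  apply (f_equal Cmod) in E. rewrite Cmod_mult in E.
  assert (Cmod (quot_coeff a z0 n * v ^ S n) < eps * Cmod w / 2).
  { rewrite Cmod_mult, Cmod_pow.
    replace (Cmod v) with (Cmod v / u * u) by (field; lra).
    rewrite Rpow_mult_distr.
    assert (0 <= (Cmod v / u) ^ S n) by (apply pow_le; lra).
    apply Rle_lt_trans with (K * (Cmod v / u) ^ S n).
    - unfold K. specialize (D n). replace (u ^ S n) with (u ^ n * u) by (simpl; ring).
      assert (Cmod (quot_coeff a z0 n) * u ^ n * u <= 2 * A / Cmod z0 * u) by nra. nra.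
    - apply (Rmult_lt_compat_l K) in HN2; [|assumption].
      replace (K * (eps * Cmod w / 2 / K)) with (eps * Cmod w / 2) in HN2 by (field; lra).
      exact HN2. }
  pose proof (Cmod_triangle (Csum (fun k => a k * v ^ k)%C n - f w) (quot_coeff a z0 n * v ^ S n)).
  nra.
Qed.

(* Divide by the first nonvanishing monomial and let [w] tend to the centre. *)
Lemma Cpseries_zero_coeffs (d : nat -> C) (H : C -> C) (r : R) :
  0 < r ->
  (forall w, Cmod w < r -> is_Cpseries d w (H w)) ->
  (forall e, 0 < e -> exists w, w <> RtoC 0 /\ Cmod w < e /\ H w = RtoC 0) ->
  forall k, d k = RtoC 0.
Proof.
  intros Hr Hd Hz.
  assert (St : forall m, (forall j, (j < m)%nat -> d j = RtoC 0) -> d m = RtoC 0).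
  { intros m Hm.
    set (u := r / 2).
    destruct (Cpseries_terms_bounded d (RtoC u) (H (RtoC u))) as [A [HA B]].
    { apply Hd. rewrite Cmod_R. unfold u. rewrite Rabs_pos_eq; lra. }
    assert (Hu : 0 < u) by (unfold u; lra).
    rewrite Cmod_R, Rabs_pos_eq in B by lra.
    set (d' := fun k => d (m + k)%nat).
    set (A' := A / u ^ m).
    assert (Hum : 0 < u ^ m) by (apply pow_lt; lra).
    assert (HA' : 0 < A') by (apply Rdiv_lt_0_compat; lra).
    assert (B' : forall k, Cmod (d' k) * u ^ k <= A').
    { intro k. unfold A', d'. apply (proj1 (Rle_div_r (Cmod (d (m + k)%nat) * u ^ k) A (u ^ m) Hum)). specialize (B (m + k)%nat).
      rewrite pow_add in B. nra. }
    assert (Sh : forall w n, Csum (fun k => d k * w ^ k)%C (m + n) =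
        (w ^ m * Csum (fun k => d' k * w ^ k) n)%C).
    { intros w n. unfold d'. clear - Hm.
      assert (Z : forall j, (j < m)%nat -> Csum (fun k => d k * w ^ k)%C j = RtoC 0).
      { induction j as [|j IH]; intros Hj; cbn [Csum].
        - rewrite Hm by lia. ring.
        - rewrite IH, (Hm (S j)) by lia. ring. }
      induction n as [|n IH]; cbn [Csum].
      - rewrite Nat.add_0_r. destruct m as [|m]; cbn [Csum]; [simpl; ring|].
        rewrite Z by lia. ring.
      - rewrite Nat.add_succ_r. cbn [Csum]. rewrite IH.
        replace (S (m + n)) with (m + S n)%nat by lia. rewrite (Cpow_add_r w m (S n)). ring. }
    apply Cmod_eq_0, Rle_antisym; [|apply Cmod_ge_0].
    apply le_epsilon; intros eps Heps.
    (* The first bound on w is what [Csum_geom_bound] requires; the second makes its error 2 A' |w|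
       / u smaller than eps / 2. *)
    destruct (Hz (Rmin (u / 2) (eps * u / (4 * A')))) as [w [Hw0 [Hw1 Hw2]]].
    { apply Rmin_glb_lt; [lra|]. apply Rdiv_lt_0_compat; nra. }
    assert (W1 : Cmod w < u / 2) by (eapply Rlt_le_trans; [exact Hw1|apply Rmin_l]).
    assert (W2 : Cmod w < eps * u / (4 * A')) by (eapply Rlt_le_trans; [exact Hw1|apply Rmin_r]).
    assert (Hw : 0 < Cmod w) by (apply Cmod_gt_0; exact Hw0).
    assert (Hwm : 0 < Cmod w ^ m) by (apply pow_lt; lra).
    assert (P : is_Cpseries d w (RtoC 0)) by (rewrite <- Hw2; apply Hd; unfold u in *; lra).
    rewrite is_Cpseries_iff in P.
    destruct (P (eps / 2 * Cmod w ^ m)) as [N HN]; [nra|].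
    specialize (HN (m + N)%nat ltac:(lia)). rewrite Sh in HN.
    pose proof (Csum_geom_bound d' w A' u Hu ltac:(lra) ltac:(lra) B' N) as G.
    set (s := Csum _ N) in *.
    replace (w ^ m * s - 0)%C with (w ^ m * s)%C in HN by ring.
    rewrite Cmod_mult, Cmod_pow in HN.
    assert (Cmod s < eps / 2) by nra.
    assert (2 * A' * (Cmod w / u) < eps / 2).
    { apply (Rmult_lt_compat_l (2 * A' / u)) in W2; [|apply Rdiv_lt_0_compat; lra].
      replace (2 * A' / u * (eps * u / (4 * A'))) with (eps / 2) in W2 by (field; lra).
      unfold Rdiv in *. nra. }
    unfold d' in G. rewrite Nat.add_0_r in G.
    replace (d m) with (s - (s - d m))%C by ring. unfold Cminus at 1.
    eapply Rle_trans; [apply Cmod_triangle|]. rewrite Cmod_opp. lra. }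
  apply (well_founded_induction PeanoNat.Nat.lt_wf_0). exact St.
Qed.

(** * Zeros of analytic functions and uniqueness of the continuation *)

Lemma analytic_at_minus (f g : C -> C) (z0 : C) :
  analytic_at f z0 -> analytic_at g z0 -> analytic_at (fun z => f z - g z)%C z0.
Proof.
  intros Hf Hg.
  apply (analytic_at_ext (fun z => f z + (- (1)) * g z)%C _ _ 1 Rlt_0_1);
    [intros; ring|]. apply analytic_at_plus; [|apply analytic_at_scal]; assumption.
Qed.

(** After recentring at z0, [Cpseries_zero_coeffs] annihilates every Taylor coefficient, so the
    function vanishes on the whole disc of its expansion. *)
Lemma analytic_zero_ball (h : C -> C) (z0 : C) :
  analytic_at h z0 ->
  (forall e, 0 < e -> exists w, w <> z0 /\ Cmod (w - z0) < e /\ h w = RtoC 0) ->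
  exists r, 0 < r /\ forall w, Cmod (w - z0) < r -> h w = RtoC 0.
Proof.
  intros [r [d Hd]] Hz. exists r. split; [apply cond_pos|].
  assert (D : forall k, d k = RtoC 0).
  { apply (Cpseries_zero_coeffs d (fun w => h (z0 + w)%C) r); [apply cond_pos| |].
    - intros w Hw. replace w with ((z0 + w) - z0)%C at 1 by ring.
      apply Hd. now replace ((z0 + w) - z0)%C with w by ring.
    - intros e He. destruct (Hz e He) as [w [H1 [H2 H3]]]. exists (w - z0)%C.
      split; [|split; [assumption|]].
      + intros E. apply H1. now apply Ceq_minus.
      + replace (z0 + (w - z0))%C with w by ring. assumption. }
  intros w Hw. apply (is_Cpseries_unique d (w - z0)%C); [apply Hd; assumption|].
  apply (is_Cpseries_ext (fun k => match k with O => RtoC 0 | S _ => RtoC 0 end)).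
  - intros [|k]; rewrite D; reflexivity.
  - apply is_Cpseries_const.
Qed.

(* The cut plane is star-shaped about 0, so the coincidence propagates along [t * z], 0 <= t <= 1. *)
Lemma continuation_unique (a b c : C) (F G : C -> C) :
  is_hyp2F1_continuation a b c F -> is_hyp2F1_continuation a b c G ->
  forall z, in_cut_plane z -> F z = G z.
Proof.
  intros [F1 F2] [G1 G2] z Hz.
  set (h := fun z => (F z - G z)%C).
  assert (Hd : forall w, Cmod w < 1 -> h w = RtoC 0).
  { intros w Hw. unfold h. rewrite (is_Cpseries_unique _ _ _ _ (F1 w Hw) (G1 w Hw)). ring. }
  assert (Ha : forall w, in_cut_plane w -> analytic_at h w)
    by (intros; apply analytic_at_minus; auto).
  assert (Hs : forall t, 0 <= t <= 1 -> in_cut_plane (t * z)%C).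
  { intros t Ht [H1 H2]. rewrite im_scal_l in H1. rewrite re_scal_l in H2. apply Hz.
    destruct (Req_dec t 0) as [->|Hne]; [lra|]. split; nra. }
  destruct (Ceq_dec z 0) as [->|Hz0].
  { apply Ceq_minus. apply (Hd 0%C). rewrite Cmod_0. lra. }
  assert (Hm : 0 < Cmod z) by (apply Cmod_gt_0; exact Hz0).
  (* Connectedness argument along the segment from 0 to z: tau is the supremum of the t up to which
     h vanishes. *)
  set (T := fun t => 0 <= t <= 1 /\ forall u, 0 <= u <= t -> h (u * z)%C = RtoC 0).
  assert (T0 : T 0).
  { split; [lra|]. intros u Hu. apply Hd. rewrite Cmod_mult, Cmod_R, Rabs_pos_eq by lra. nra. }
  destruct (completeness T) as [tau [Hub Hlub]].
  { exists 1. intros t [Ht _]. lra. }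
  { exists 0. exact T0. }
  assert (Ht1 : tau <= 1) by (apply Hlub; intros t [Ht _]; lra).
  assert (Htp : 0 < tau).
  { set (e := Rmin 1 (/ (2 * Cmod z))).
    assert (He : 0 < e) by (apply Rmin_glb_lt; [lra|apply Rinv_0_lt_compat; lra]).
    apply Rlt_le_trans with e; [assumption|]. apply Hub. split.
    - split; [lra|apply Rmin_l].
    - intros u Hu. apply Hd. rewrite Cmod_mult, Cmod_R, Rabs_pos_eq by lra.
      apply Rle_lt_trans with (/ (2 * Cmod z) * Cmod z).
      + apply Rmult_le_compat_r; [lra|]. apply Rle_trans with e; [lra|apply Rmin_r].
      + replace (/ (2 * Cmod z) * Cmod z) with (/ 2) by (field; lra). lra. }
  assert (Tlt : forall u, 0 <= u < tau -> h (u * z)%C = RtoC 0).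
  { intros u Hu. apply NNPP. intros Hn.
    assert (tau <= u); [|lra]. apply Hlub. intros t [Ht1' Ht2].
    destruct (Rle_lt_dec t u) as [|Hlt]; [assumption|].
    exfalso. apply Hn, Ht2. lra. }
  destruct (analytic_zero_ball h (tau * z)%C (Ha _ (Hs tau ltac:(lra)))) as [r [Hr Hb]].
  (* The points (tau - dl) z, where h is already known to vanish, accumulate at tau z; tau > 0
     leaves room for them. *)
  { intros e He. set (dl := Rmin (tau / 2) (e / (2 * Cmod z))).
    assert (Hdl : 0 < dl) by (apply Rmin_glb_lt; [lra|apply Rdiv_lt_0_compat; lra]).
    assert (Hdt : dl <= tau / 2) by apply Rmin_l.
    assert (Hde : dl * Cmod z < e).
    { apply Rle_lt_trans with (e / (2 * Cmod z) * Cmod z).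
      - apply Rmult_le_compat_r; [lra|apply Rmin_r].
      - replace (e / (2 * Cmod z) * Cmod z) with (e / 2) by (field; lra). lra. }
    exists (RtoC (tau - dl) * z)%C.
    assert (E : (RtoC (tau - dl) * z - tau * z = RtoC (- dl) * z)%C)
      by (rewrite RtoC_minus, RtoC_opp; ring).
    assert (E2 : Cmod (RtoC (tau - dl) * z - tau * z) = dl * Cmod z).
    { rewrite E, Cmod_mult, Cmod_R, Rabs_Ropp, Rabs_pos_eq; lra. }
    split; [|split].
    - intros Heq. rewrite Heq in E2. replace (tau * z - tau * z)%C with (RtoC 0) in E2 by ring.
      rewrite Cmod_0 in E2. nra.
    - lra.
    - apply Tlt. lra. }
  (* The zero ball around tau z would carry T past tau; since t1 <= tau, the minimum must be
     attained at 1. *)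
  set (t1 := Rmin 1 (tau + r / (2 * Cmod z))).
  assert (Hq : 0 < r / (2 * Cmod z)) by (apply Rdiv_lt_0_compat; lra).
  assert (HT1 : T t1).
  { split.
    - split; [|apply Rmin_l]. apply Rmin_glb; lra.
    - intros u Hu. destruct (Rlt_le_dec u tau) as [|Hge]; [apply Tlt; lra|].
      apply Hb. replace (u * z - tau * z)%C with (RtoC (u - tau) * z)%C
        by (rewrite RtoC_minus; ring).
      rewrite Cmod_mult, Cmod_R, Rabs_pos_eq by lra.
      apply Rle_lt_trans with (r / (2 * Cmod z) * Cmod z).
      + apply Rmult_le_compat_r; [lra|]. pose proof (Rmin_r 1 (tau + r / (2 * Cmod z))).
        unfold t1 in Hu. lra.
      + replace (r / (2 * Cmod z) * Cmod z) with (r / 2) by (field; lra). lra. }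
  assert (t1 <= tau) by (apply Hub; assumption).
  assert (Et : t1 = 1).
  { unfold t1 in *. revert H. unfold Rmin. destruct (Rle_dec _ _); lra. }
  destruct HT1 as [_ HT1]. rewrite Et in HT1.
  specialize (HT1 1 ltac:(lra)). rewrite Cmult_1_l in HT1. now apply Ceq_minus.
Qed.

(** * The Cauchy-type integral of dt / (1 - z t) *)

Definition CInt (f : R -> C) : C :=
  (RInt (fun t => Re (f t)) 0 1, RInt (fun t => Im (f t)) 0 1).

Definition Ccont (f : R -> C) : Prop :=
  forall t, 0 <= t <= 1 ->
    continuous (fun u => Re (f u)) t /\ continuous (fun u => Im (f u)) t.

Lemma Ccont_ex (f : R -> C) :
  Ccont f -> ex_RInt (fun t => Re (f t)) 0 1 /\ ex_RInt (fun t => Im (f t)) 0 1.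
Proof.
  intros H; split; apply (ex_RInt_continuous (V := R_CompleteNormedModule)); intros t Ht;
    rewrite Rmin_left, Rmax_right in Ht by lra; apply H; lra.
Qed.

Lemma Ccont_const (c : C) : Ccont (fun _ => c).
Proof. intros t _; split; apply continuous_const. Qed.

Lemma Ccont_id : Ccont (fun t => RtoC t).
Proof. intros t _; split; [apply continuous_id|apply continuous_const]. Qed.

Lemma Ccont_plus (f g : R -> C) : Ccont f -> Ccont g -> Ccont (fun t => f t + g t)%C.
Proof.
  intros Hf Hg t Ht. destruct (Hf t Ht), (Hg t Ht).
  split; [apply (continuous_plus (fun u => Re (f u)) (fun u => Re (g u)))
         |apply (continuous_plus (fun u => Im (f u)) (fun u => Im (g u)))]; assumption.
Qed.

Lemma Ccont_mult (f g : R -> C) : Ccont f -> Ccont g -> Ccont (fun t => f t * g t)%C.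
Proof.
  intros Hf Hg t Ht. destruct (Hf t Ht), (Hg t Ht). split.
  - apply (continuous_minus (fun u => Re (f u) * Re (g u)) (fun u => Im (f u) * Im (g u)));
      apply (continuous_mult (K := R_AbsRing)); assumption.
  - apply (continuous_plus (fun u => Re (f u) * Im (g u)) (fun u => Im (f u) * Re (g u)));
      apply (continuous_mult (K := R_AbsRing)); assumption.
Qed.

Lemma Ccont_inv (f : R -> C) :
  Ccont f -> (forall t, 0 <= t <= 1 -> f t <> RtoC 0) -> Ccont (fun t => / f t)%C.
Proof.
  intros Hf Hn t Ht. destruct (Hf t Ht) as [H1 H2].
  assert (Hd : Re (f t) ^ 2 + Im (f t) ^ 2 <> 0).
  { intros E. apply (Hn t Ht). apply Cmod_eq_0.
    pose proof (Cmod2_alt (f t)) as Q. rewrite E in Q.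
    pose proof (Cmod_ge_0 (f t)). simpl in Q. nra. }
  assert (Hc : continuous (fun u => / (Re (f u) ^ 2 + Im (f u) ^ 2)) t).
  { apply continuous_Rinv_comp; [|exact Hd]. simpl.
    apply (continuous_plus (fun u => Re (f u) * (Re (f u) * 1)) (fun u => Im (f u) * (Im (f u) * 1)));
      apply (continuous_mult (K := R_AbsRing)); try assumption;
      apply (continuous_mult (K := R_AbsRing)); try assumption; apply continuous_const. }
  split.
  - apply (continuous_mult (K := R_AbsRing)); assumption.
  - apply (continuous_mult (K := R_AbsRing)); [|assumption].
    apply (continuous_opp (fun u => Im (f u))); assumption.
Qed.

Lemma Ccont_pow (f : R -> C) (n : nat) : Ccont f -> Ccont (fun t => f t ^ n)%C.
Proof.
  intros Hf. induction n as [|n IH]; cbn [Cpow].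
  - apply Ccont_const.
  - apply Ccont_mult; assumption.
Qed.

Lemma CInt_ext (f g : R -> C) :
  (forall t, 0 <= t <= 1 -> f t = g t) -> CInt f = CInt g.
Proof.
  intros H. unfold CInt. f_equal; apply RInt_ext; intros t Ht;
    rewrite Rmin_left, Rmax_right in Ht by lra; rewrite H by lra; reflexivity.
Qed.

Lemma CInt_plus (f g : R -> C) :
  Ccont f -> Ccont g -> CInt (fun t => f t + g t)%C = (CInt f + CInt g)%C.
Proof.
  intros Hf Hg. destruct (Ccont_ex f Hf), (Ccont_ex g Hg).
  apply injective_projections.
  - apply (RInt_plus (fun t => Re (f t)) (fun t => Re (g t))); assumption.
  - apply (RInt_plus (fun t => Im (f t)) (fun t => Im (g t))); assumption.
Qed.

Lemma CInt_scal (c : C) (f : R -> C) :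
  Ccont f -> CInt (fun t => c * f t)%C = (c * CInt f)%C.
Proof.
  intros Hf. destruct (Ccont_ex f Hf) as [H1 H2]. destruct c as [a b].
  apply injective_projections; unfold CInt, Cmult; cbn [fst snd Re Im].
  - apply (is_RInt_unique (V := R_CompleteNormedModule)).
    apply (is_RInt_minus (V := R_NormedModule) (fun t => a * Re (f t)) (fun t => b * Im (f t)));
      apply (is_RInt_scal (V := R_NormedModule));
      apply (RInt_correct (V := R_CompleteNormedModule)); assumption.
  - apply (is_RInt_unique (V := R_CompleteNormedModule)).
    apply (is_RInt_plus (V := R_NormedModule) (fun t => a * Im (f t)) (fun t => b * Re (f t)));
      apply (is_RInt_scal (V := R_NormedModule));
      apply (RInt_correct (V := R_CompleteNormedModule)); assumption.
Qed.

(** The norm inequality is applied to the pair as one vector-valued integral; bounding the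
    components separately would lose a constant factor. *)
Lemma Cmod_CInt_le (f : R -> C) (M : R) :
  Ccont f -> (forall t, 0 <= t <= 1 -> Cmod (f t) <= M) -> Cmod (CInt f) <= M.
Proof.
  intros Hf HM. destruct (Ccont_ex f Hf) as [H1 H2].
  rewrite Cmod_norm.
  replace M with (scal (1 - 0) M) by (unfold scal; simpl; unfold mult; simpl; ring).
  apply (norm_RInt_le (V := C_R_NormedModule) f (fun _ => M) 0 1 (CInt f)); [lra| | |].
  - intros t Ht. rewrite <- Cmod_norm. auto.
  - apply (is_RInt_fct_extend_pair f); [apply (RInt_correct (V := R_CompleteNormedModule)); assumption
    | apply (RInt_correct (V := R_CompleteNormedModule)); assumption].
  - apply (is_RInt_const (V := R_NormedModule)).
Qed.

(** On the cut plane this is -log(1 - z)/z (1 at z = 0), that is 2F1(1, 1; 2; z). *)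
Definition cauchy_int (z : C) : C := CInt (fun t => / (1 - z * t))%C.

(** The k-th Taylor coefficient of [cauchy_int] at z, by differentiation of the kernel under the
    integral sign. *)
Definition cauchy_coeff (z : C) (k : nat) : C :=
  CInt (fun t => RtoC t ^ k * (/ (1 - z * t)) ^ S k)%C.

Lemma Ccont_kernel (z : C) :
  (forall t, 0 <= t <= 1 -> (1 - z * RtoC t)%C <> RtoC 0) ->
  Ccont (fun t => / (1 - z * t))%C.
Proof.
  intros H. apply Ccont_inv; [|exact H].
  apply Ccont_plus; [apply Ccont_const|].
  intros t Ht. split.
  - apply (continuous_opp (fun u => Re (z * RtoC u)%C)).
    now apply (Ccont_mult (fun _ => z) RtoC (Ccont_const z) Ccont_id).
  - apply (continuous_opp (fun u => Im (z * RtoC u)%C)).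
    now apply (Ccont_mult (fun _ => z) RtoC (Ccont_const z) Ccont_id).
Qed.

(** The kernel 1/(1 - w t) is a geometric series in (w - z0) t / (1 - z0 t), whose modulus is at
    most |w - z0| / d < 1 uniformly in t; hence no theorem on termwise integration is called for,
    only a bound on one remainder. *)
Lemma cauchy_int_series (z0 w : C) (d : R) :
  (forall t, 0 <= t <= 1 -> d <= Cmod (1 - z0 * RtoC t)) ->
  Cmod (w - z0) < d ->
  is_Cpseries (cauchy_coeff z0) (w - z0)%C (cauchy_int w).
Proof.
  intros Hd Hw. set (v := (w - z0)%C) in *.
  assert (Hd0 : 0 < d) by (pose proof (Cmod_ge_0 v); lra).
  assert (N0 : forall t, 0 <= t <= 1 -> (1 - z0 * RtoC t)%C <> RtoC 0).
  { intros t Ht. apply Cmod_gt_0. specialize (Hd t Ht). lra. }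
  assert (L : forall t, 0 <= t <= 1 -> d - Cmod v <= Cmod (1 - w * RtoC t)).
  { intros t Ht. specialize (Hd t Ht).
    replace (1 - z0 * t)%C with ((1 - w * t) + v * t)%C in Hd by (unfold v; ring).
    pose proof (Cmod_triangle (1 - w * t) (v * t)) as T. rewrite (Cmod_mult v), Cmod_R, Rabs_pos_eq in T by lra.
    pose proof (Cmod_ge_0 v). nra. }
  assert (Nw : forall t, 0 <= t <= 1 -> (1 - w * RtoC t)%C <> RtoC 0).
  { intros t Ht. apply Cmod_gt_0. specialize (L t Ht). lra. }
  pose proof (Ccont_kernel z0 N0) as C0. pose proof (Ccont_kernel w Nw) as Cw.
  assert (Ck : forall k, Ccont (fun t => t ^ k * (/ (1 - z0 * t)) ^ S k)%C).
  { intro k. apply Ccont_mult; apply Ccont_pow; [apply Ccont_id|assumption]. }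
  set (g := fun n t => (v ^ S n * (RtoC t ^ S n * (/ (1 - z0 * t)) ^ S n * / (1 - w * t)))%C).
  assert (Cg : forall n, Ccont (fun t => t ^ S n * (/ (1 - z0 * t)) ^ S n * / (1 - w * t))%C).
  { intro n. apply Ccont_mult; [|assumption].
    apply Ccont_mult; apply Ccont_pow; [apply Ccont_id|assumption]. }
  (* The remainder of the geometric expansion of the kernel, integrated. *)
  assert (E : forall n, (cauchy_int w = Csum (fun k => cauchy_coeff z0 k * v ^ k) n + CInt (g n))%C).
  { intro n. unfold g. rewrite CInt_scal by apply Cg.
    induction n as [|n IH]; cbn [Csum].
    - unfold cauchy_int, cauchy_coeff.
      rewrite (Cmult_comm _ (v ^ 0)).
      rewrite <- !CInt_scal by auto.
      rewrite <- CInt_plus.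
      + apply CInt_ext. intros t Ht. simpl. unfold v. field. auto.
      + apply Ccont_mult; [apply Ccont_const|auto].
      + apply Ccont_mult; [apply Ccont_const|auto].
    - rewrite IH, <- Cplus_assoc. f_equal. unfold cauchy_coeff.
      rewrite (Cmult_comm _ (v ^ S n)).
      rewrite <- !CInt_scal by auto.
      rewrite <- CInt_plus.
      + apply CInt_ext. intros t Ht.
        rewrite (Cpow_S v (S n)), (Cpow_S t (S n)), (Cpow_S (/ (1 - z0 * t)) (S n)).
        unfold v at 3. field. auto.
      + apply Ccont_mult; [apply Ccont_const|auto].
      + apply Ccont_mult; [apply Ccont_const|auto]. }
  assert (Hq : 0 <= Cmod v / d < 1).
  { split; [apply Rmult_le_pos; [apply Cmod_ge_0|left; apply Rinv_0_lt_compat; lra]|].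
    apply Rlt_div_l; lra. }
  (* The remainder is the (n+1)-st power of the ratio times 1/(1 - w t), and the last factor is at
     most 1/(d - |v|) by [L]. *)
  apply (is_Cpseries_bound _ _ _ (/ (d - Cmod v)) (Cmod v / d) Hq).
  intro n. rewrite (E n).
  replace (_ - _)%C with (- CInt (g n))%C by ring. rewrite Cmod_opp.
  apply Cmod_CInt_le.
  - apply Ccont_mult; [apply Ccont_const|apply Cg].
  - intros t Ht. unfold g. rewrite !Cmod_mult, !Cmod_pow, !Cmod_inv by auto.
    rewrite Cmod_R, Rabs_pos_eq by lra. specialize (Hd t Ht). specialize (L t Ht).
    assert (Q : Cmod v ^ S n * (t ^ S n * (/ Cmod (1 - z0 * t)) ^ S n) <= (Cmod v / d) ^ S n).
    { rewrite <- !Rpow_mult_distr. apply pow_incr. pose proof (Cmod_ge_0 v).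
      assert (0 < / Cmod (1 - z0 * t) <= / d).
      { split; [apply Rinv_0_lt_compat; lra|apply Rinv_le_contravar; lra]. }
      assert (0 <= t * / Cmod (1 - z0 * t) <= / d) by nra.
      unfold Rdiv. split; nra. }
    assert (Q2 : (Cmod v / d) ^ S n <= (Cmod v / d) ^ n).
    { simpl. assert (0 <= (Cmod v / d) ^ n) by (apply pow_le; lra). nra. }
    assert (0 < / Cmod (1 - w * t) <= / (d - Cmod v)).
    { split; [apply Rinv_0_lt_compat; lra|apply Rinv_le_contravar; lra]. }
    assert (0 <= (Cmod v / d) ^ n) by (apply pow_le; lra).
    rewrite <- !Rmult_assoc in *. rewrite (Rmult_comm (/ (d - Cmod v))).
    apply Rle_trans with ((Cmod v / d) ^ n * / Cmod (1 - w * t)).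
    + apply Rmult_le_compat_r; lra.
    + apply Rmult_le_compat_l; lra.
Qed.

(** A zero of 1 - z t with t in [0, 1] would mean z = 1/t >= 1, a point of the cut; compactness of
    [0, 1] then gives a positive minimum of the squared modulus. *)
Lemma cut_plane_distance (z : C) :
  in_cut_plane z -> exists d, 0 < d /\ forall t, 0 <= t <= 1 -> d <= Cmod (1 - z * RtoC t).
Proof.
  intros Hz.
  assert (N0 : forall t, 0 <= t <= 1 -> 0 < Cmod (1 - z * RtoC t)).
  { intros t Ht. apply Cmod_gt_0. intros E. apply Hz.
    assert (E1 : (z * t = 1)%C) by (symmetry; apply Ceq_minus; exact E).
    pose proof (f_equal Re E1) as E2. pose proof (f_equal Im E1) as E3.
    rewrite re_scal_r, re_RtoC in E2. rewrite im_scal_r, im_RtoC in E3.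
    assert (t <> 0) by (intros ->; lra). split; nra. }
  assert (Hc : forall t, 0 <= t <= 1 ->
     continuity_pt (fun t => Re (1 - z * RtoC t) ^ 2 + Im (1 - z * RtoC t) ^ 2) t).
  { intros t _. unfold Re, Im; simpl. reg. }
  destruct (continuity_ab_min _ 0 1 ltac:(lra) Hc) as [m [Hm1 Hm2]].
  exists (Cmod (1 - z * m)). split; [apply N0; lra|].
  intros t Ht. specialize (Hm1 t Ht). rewrite <- !Cmod2_alt in Hm1.
  pose proof (Cmod_ge_0 (1 - z * t)). pose proof (N0 m ltac:(lra)).
  apply Rnot_lt_le. intros Hlt. nra.
Qed.

Lemma cauchy_int_analytic (z : C) : in_cut_plane z -> analytic_at cauchy_int z.
Proof.
  intros Hz. destruct (cut_plane_distance z Hz) as [d [Hd H]].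
  exists (mkposreal d Hd), (cauchy_coeff z). intros w Hw. apply (cauchy_int_series z w d); assumption.
Qed.

Lemma cauchy_coeff_0 (k : nat) : cauchy_coeff 0 k = RtoC (/ INR (S k)).
Proof.
  unfold cauchy_coeff.
  rewrite (CInt_ext _ (fun t => RtoC (t ^ k))).
  - apply injective_projections; unfold CInt, RtoC; simpl fst; simpl snd.
    + assert (H : is_RInt (fun t => t ^ k) 0 1 (1 ^ S k / INR (S k) - 0 ^ S k / INR (S k))).
      { apply (is_RInt_derive (V := R_CompleteNormedModule) (fun t => t ^ S k / INR (S k))).
        - intros t _. auto_derive; [trivial|]. assert (Hk : INR (S k) <> 0) by (apply not_0_INR; lia).
          change (match k with O => 1 | S _ => INR k + 1 end) with (INR (S k)). simpl pred.
          field. exact Hk.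
        - intros t _. apply (ex_derive_continuous (K := R_AbsRing) (V := R_NormedModule)).
          auto_derive; trivial. }
      apply (is_RInt_unique (V := R_CompleteNormedModule)) in H. unfold Re; cbn [fst]. rewrite H, pow1, pow_i by lia.
      unfold Rdiv. rewrite Rmult_1_l, Rmult_0_l. apply Rminus_0_r.
    + unfold Im; cbn [snd]. rewrite RInt_const. unfold scal; simpl; unfold mult; simpl; ring.
  - intros t _. replace (1 - 0 * t)%C with (RtoC 1) by ring.
    rewrite <- RtoC_inv by lra. rewrite Rinv_1, Cpow_1_l, RtoC_pow. ring.
Qed.

Lemma pochhammer_neq0 (m k : nat) : (0 < m)%nat -> pochhammer (RtoC (INR m)) k <> RtoC 0.
Proof.
  intros Hm. induction k as [|k IH]; cbn [pochhammer].
  - apply C1_nz.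
  - apply Cmult_neq_0; [assumption|]. rewrite <- RtoC_plus, <- plus_INR. intros E.
    apply RtoC_inj in E. apply not_0_INR in E; [trivial|lia].
Qed.

Lemma pochhammer_one (k : nat) : pochhammer (RtoC 1) k = RtoC (INR (fact k)).
Proof.
  induction k as [|k IH]; cbn [pochhammer]; [simpl; reflexivity|].
  rewrite IH, fact_simpl, mult_INR, RtoC_mult, S_INR, RtoC_plus. ring.
Qed.

Lemma INR_fact_C_neq0 (k : nat) : RtoC (INR (fact k)) <> RtoC 0.
Proof. intros E. apply RtoC_inj in E. exact (INR_fact_neq_0 k E). Qed.

Lemma INR_S_C_neq0 (k : nat) : RtoC (INR (S k)) <> RtoC 0.
Proof. intros E. apply RtoC_inj in E. apply (not_0_INR (S k)); [lia|exact E]. Qed.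

Lemma hyp2F1_coeff_one (b c : C) (k : nat) :
  hyp2F1_coeff 1 b c k = (pochhammer b k / pochhammer c k)%C \/ pochhammer c k = RtoC 0.
Proof.
  destruct (Ceq_dec (pochhammer c k) 0) as [E|E]; [right; assumption|left].
  unfold hyp2F1_coeff. rewrite pochhammer_one. field. split; [assumption|apply INR_fact_C_neq0].
Qed.

(** Both series have coefficients 1/(k+1) = k!/(k+1)!. Expanding at 0, where the kernel is 1, allows
    d = 1 and thus covers the whole unit disc. *)
Lemma cauchy_int_continuation : is_hyp2F1_continuation 1 1 2 cauchy_int.
Proof.
  split; [|exact cauchy_int_analytic].
  intros z Hz.
  replace z with (z - 0)%C at 1 by ring.
  apply (is_Cpseries_ext (cauchy_coeff 0)).
  - intro k. rewrite cauchy_coeff_0.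
    assert (E : pochhammer 2 k = RtoC (INR (fact (S k)))).
    { induction k as [|k IH]; cbn [pochhammer]; [reflexivity|].
      rewrite IH, (fact_simpl (S k)), mult_INR, !RtoC_mult, (S_INR (S k)), (S_INR k), !RtoC_plus. ring. }
    destruct (hyp2F1_coeff_one 1 2 k) as [->|E2].
    + rewrite E, pochhammer_one, fact_simpl, mult_INR, RtoC_mult, RtoC_inv
        by (apply not_0_INR; lia).
      field. split; [apply INR_fact_C_neq0|apply INR_S_C_neq0].
    + exfalso. rewrite E in E2. exact (INR_fact_C_neq0 _ E2).
  - apply (cauchy_int_series 0 z 1).
    + intros t Ht. replace (1 - 0 * t)%C with (RtoC 1) by ring. rewrite Cmod_1. lra.
    + replace (z - 0)%C with z by ring. assumption.
Qed.

(** * Limits at the cut *)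

Definition cut_filter (s : cut_side) : (C -> Prop) -> Prop :=
  within (half_plane s) (locally (RtoC 2)).

Definition Rlimc (s : cut_side) (f : C -> R) (l : R) : Prop :=
  filterlim f (cut_filter s) (locally l).

Definition Climc (s : cut_side) (f : C -> C) (l : C) : Prop :=
  filterlim f (cut_filter s) (locally l).

#[global] Instance cut_filter_filter (s : cut_side) : Filter (cut_filter s).
Proof. apply within_filter, locally_filter. Qed.

#[global] Instance cut_filter_proper (s : cut_side) : ProperFilter (cut_filter s).
Proof.
  split; [|apply cut_filter_filter].
  intros P [e He].
  (* Every neighbourhood of 2 meets the chosen half-plane, here at 2 + i e/2 or 2 - i e/2;
     properness is what makes limits at the cut unique. *)
  exists (2, match s with upper => e / 2 | lower => - (e / 2) end).
  pose proof (cond_pos e) as Hp. apply He.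
  - split; simpl.
    + apply ball_center.
    + unfold ball; simpl; unfold AbsRing_ball, abs, minus, plus, opp; simpl.
      apply Rabs_def1; destruct s; lra.
  - destruct s; simpl; lra.
Qed.

Lemma Climc_iff (s : cut_side) (f : C -> C) (l : C) :
  Climc s f l <-> Rlimc s (fun z => Re (f z)) (Re l) /\ Rlimc s (fun z => Im (f z)) (Im l).
Proof.
  unfold Climc, Rlimc. rewrite !filterlim_locally. split.
  - intros H. split; intros e; generalize (H e); apply filter_imp; intros z [H1 H2]; assumption.
  - intros [H1 H2] e. generalize (filter_and _ _ (H1 e) (H2 e)).
    apply filter_imp. intros z [Ha Hb]; split; assumption.
Qed.

Lemma Rlimc_plus s f g lf lg :
  Rlimc s f lf -> Rlimc s g lg -> Rlimc s (fun z => f z + g z) (lf + lg).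
Proof.
  intros Hf Hg. apply (filterlim_comp_2 _ _ (fun x y => x + y) Hf Hg).
  apply (filterlim_plus (K := R_AbsRing) (V := R_NormedModule)).
Qed.

Lemma Rlimc_mult s f g lf lg :
  Rlimc s f lf -> Rlimc s g lg -> Rlimc s (fun z => f z * g z) (lf * lg).
Proof.
  intros Hf Hg. apply (filterlim_comp_2 _ _ (fun x y => x * y) Hf Hg).
  apply (filterlim_mult (K := R_AbsRing)).
Qed.

Lemma Rlimc_const s c : Rlimc s (fun _ => c) c.
Proof. apply filterlim_const. Qed.

Lemma Rlimc_opp s f l : Rlimc s f l -> Rlimc s (fun z => - f z) (- l).
Proof.
  intros H. replace (- l) with (-1 * l) by ring.
  apply (filterlim_ext (fun z => -1 * f z)); [intros; ring|].
  apply (Rlimc_mult s (fun _ => -1)); [apply Rlimc_const|assumption].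
Qed.

Lemma Rlimc_comp s (f : C -> R) (g : R -> R) l :
  Rlimc s f l -> continuous g l -> Rlimc s (fun z => g (f z)) (g l).
Proof. intros Hf Hg. exact (filterlim_comp _ _ _ f g _ _ _ Hf Hg). Qed.

Lemma Rlimc_inv s f l : l <> 0 -> Rlimc s f l -> Rlimc s (fun z => / f z) (/ l).
Proof. intros Hl H. apply (Rlimc_comp s f Rinv); [assumption|]. now apply continuous_Rinv. Qed.

Lemma Climc_id s : Climc s (fun z => z) 2.
Proof. unfold Climc, cut_filter. apply filterlim_filter_le_1 with (2 := filterlim_id _ _).
  intros P HP. apply filter_imp with (2 := HP). intros; assumption. Qed.

Lemma Climc_const s c : Climc s (fun _ => c) c.
Proof. apply filterlim_const. Qed.

Lemma Climc_plus s f g lf lg :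
  Climc s f lf -> Climc s g lg -> Climc s (fun z => f z + g z)%C (lf + lg)%C.
Proof.
  rewrite !Climc_iff. intros [H1 H2] [H3 H4].
  split; [apply (Rlimc_plus s _ _ _ _ H1 H3)|apply (Rlimc_plus s _ _ _ _ H2 H4)].
Qed.

Lemma Climc_mult s f g lf lg :
  Climc s f lf -> Climc s g lg -> Climc s (fun z => f z * g z)%C (lf * lg)%C.
Proof.
  rewrite !Climc_iff. intros [H1 H2] [H3 H4]. split.
  - apply (Rlimc_plus s (fun z => Re (f z) * Re (g z)) (fun z => - (Im (f z) * Im (g z)))).
    + apply Rlimc_mult; assumption.
    + apply Rlimc_opp, Rlimc_mult; assumption.
  - apply (Rlimc_plus s (fun z => Re (f z) * Im (g z)) (fun z => Im (f z) * Re (g z)));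
      apply Rlimc_mult; assumption.
Qed.

Lemma Climc_inv_id s : Climc s (fun z => / z)%C (/ 2)%C.
Proof.
  pose proof (proj1 (Climc_iff s _ _) (Climc_id s)) as [H1 H2].
  assert (H3 : Rlimc s (fun z => / (fst z ^ 2 + snd z ^ 2)) (/ (fst (RtoC 2) ^ 2 + snd (RtoC 2) ^ 2))).
  { apply (Rlimc_inv s (fun z => fst z ^ 2 + snd z ^ 2)); [simpl; lra|].
    apply Rlimc_plus; simpl; apply Rlimc_mult; try assumption;
      apply Rlimc_mult; try assumption; apply Rlimc_const. }
  apply Climc_iff. split.
  - apply (Rlimc_mult s (fun z => Re z)); assumption.
  - apply (Rlimc_mult s (fun z => - Im z)); [apply Rlimc_opp|]; assumption.
Qed.

Lemma Climc_ext s f g l :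
  (forall z, half_plane s z -> f z = g z) -> Climc s f l -> Climc s g l.
Proof. intros H. apply filterlim_within_ext; assumption. Qed.

Lemma cut_filter_half_plane s : cut_filter s (half_plane s).
Proof. unfold cut_filter, within. apply filter_forall. intros; assumption. Qed.

Lemma half_plane_cut s z : half_plane s z -> in_cut_plane z.
Proof. intros H [H1 _]. destruct s; simpl in H; lra. Qed.

Lemma half_plane_neq0 s z : half_plane s z -> z <> RtoC 0.
Proof. intros H ->. destruct s; simpl in H; lra. Qed.

(** An antiderivative of 1/(a + i b - t) is -ln((a - t)^2 + b^2)/2 + i atan((a - t)/b), smooth on
    the whole line because b is nonzero. *)
Lemma CInt_resolvent (a b : R) :
  b <> 0 ->
  CInt (fun t => / ((a, b) - t))%C =
  ((ln (a ^ 2 + b ^ 2) - ln ((a - 1) ^ 2 + b ^ 2)) / 2, atan ((a - 1) / b) - atan (a / b)).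
Proof.
  intros Hb.
  assert (P : forall t, 0 < (a - t) ^ 2 + b ^ 2) by (intros t; pose proof (pow2_ge_0 (a - t)); pose proof (pow2_gt_0 b Hb); lra).
  apply injective_projections; unfold CInt; cbn [fst snd].
  - apply (is_RInt_unique (V := R_CompleteNormedModule)).
    replace ((ln (a ^ 2 + b ^ 2) - ln ((a - 1) ^ 2 + b ^ 2)) / 2) with
      (minus (- ln ((a - 1) ^ 2 + b ^ 2) / 2) (- ln ((a - 0) ^ 2 + b ^ 2) / 2)).
    2:{ unfold minus, plus, opp; simpl. rewrite Rminus_0_r. field. }
    apply (is_RInt_derive (V := R_CompleteNormedModule) (fun t => - ln ((a - t) ^ 2 + b ^ 2) / 2)).
    + intros t _. specialize (P t). auto_derive; [simpl in *; lra|]. unfold Re; simpl.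
      field. simpl in P. intros E; nra.
    + intros t _. specialize (P t). apply (ex_derive_continuous (K := R_AbsRing) (V := R_NormedModule)).
      unfold Re; simpl. auto_derive. simpl in P. intros E. nra.
  - apply (is_RInt_unique (V := R_CompleteNormedModule)).
    replace (atan ((a - 1) / b) - atan (a / b)) with
      (minus (atan ((a - 1) / b)) (atan ((a - 0) / b))).
    2:{ unfold minus, plus, opp; simpl. rewrite Rminus_0_r. reflexivity. }
    apply (is_RInt_derive (V := R_CompleteNormedModule) (fun t => atan ((a - t) / b))).
    + intros t _. specialize (P t). auto_derive; [trivial|]. unfold Im; simpl.
      field. simpl in P. repeat split; try assumption; intros E; nra.
    + intros t _. specialize (P t). apply (ex_derive_continuous (K := R_AbsRing) (V := R_NormedModule)).
      unfold Im; simpl. auto_derive. simpl in P. intros E. nra.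
Qed.

Definition side_sign (s : cut_side) : R := match s with upper => 1 | lower => -1 end.

(* Both arguments of atan below tend to infinity at the cut; [atan_inv] moves them to 0. *)
Lemma CInt_resolvent_side (s : cut_side) (a b : R) :
  0 < a < 1 -> side_sign s * b < 0 ->
  CInt (fun t => / ((a, b) - t))%C =
  ((ln (a ^ 2 + b ^ 2) - ln ((a - 1) ^ 2 + b ^ 2)) / 2,
   side_sign s * PI + (atan (b / a) - atan (b / (a - 1)))).
Proof.
  intros Ha Hb. assert (Hb0 : b <> 0) by (intros ->; lra).
  rewrite CInt_resolvent by assumption. f_equal.
  assert (I : forall x, 0 < x -> atan x = PI / 2 - atan (/ x)).
  { intros x Hx. rewrite <- (Rinv_inv x) at 1. apply atan_inv, Rinv_0_lt_compat, Hx. }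
  assert (J : forall x, x < 0 -> atan x = - (PI / 2) - atan (/ x)).
  { intros x Hx. replace x with (- - x) at 1 by ring. rewrite atan_opp, I by lra.
    rewrite Rinv_opp, atan_opp. ring. }
  assert (E1 : / ((a - 1) / b) = b / (a - 1)) by (field; split; [lra|assumption]).
  assert (E2 : / (a / b) = b / a) by (field; split; [lra|assumption]).
  destruct s; simpl in *.
  - assert (/ b < 0) by (apply Rinv_lt_0_compat; lra).
    rewrite (I ((a - 1) / b)), (J (a / b)), E1, E2 by (unfold Rdiv; nra). field.
  - assert (0 < / b) by (apply Rinv_0_lt_compat; lra).
    rewrite (J ((a - 1) / b)), (I (a / b)), E1, E2 by (unfold Rdiv; nra). field.
Qed.

(** In the variable 1/z the point 2 of the cut becomes 1/2, the midpoint of the segment of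
    integration. *)
Lemma cauchy_int_resolvent (z : C) :
  in_cut_plane z -> z <> RtoC 0 ->
  cauchy_int z = (/ z * CInt (fun t => / (/ z - t)))%C.
Proof.
  intros Hc Hz. destruct (cut_plane_distance z Hc) as [d [Hd H]].
  assert (N : forall t, 0 <= t <= 1 -> (1 - z * RtoC t)%C <> RtoC 0).
  { intros t Ht. apply Cmod_gt_0. specialize (H t Ht). lra. }
  assert (E : forall t, 0 <= t <= 1 -> (/ (/ z - t) = z * / (1 - z * t))%C).
  { intros t Ht. field. split; [apply N; assumption|].
    assumption. }
  rewrite (CInt_ext _ (fun t => z * / (1 - z * t))%C E).
  rewrite CInt_scal by (apply Ccont_kernel; assumption).
  unfold cauchy_int. field. assumption.
Qed.

(** This is -log(1 - z)/z at 2, with the argument of 1 - z tending to -PI from above the cut and to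
    PI from below. *)
Lemma cauchy_int_limit (s : cut_side) : Climc s cauchy_int (0, side_sign s * PI / 2).
Proof.
  pose proof (Climc_inv_id s) as Hi.
  pose proof (proj1 (Climc_iff s _ _) Hi) as [H1 H2].
  assert (E2 : Re (/ 2)%C = / 2) by (rewrite <- RtoC_inv by lra; reflexivity).
  assert (E3 : Im (/ 2)%C = 0) by (rewrite <- RtoC_inv by lra; reflexivity).
  rewrite E2 in H1. rewrite E3 in H2.
  (* The form of the integral in which both arctangents have arguments tending to 0, so that it
     extends continuously to 1/z = 1/2 from one side. *)
  set (K := fun z : C => let a := Re (/ z)%C in let b := Im (/ z)%C in
     ((ln (a ^ 2 + b ^ 2) - ln ((a - 1) ^ 2 + b ^ 2)) / 2,
       side_sign s * PI + (atan (b / a) - atan (b / (a - 1)))) : C).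
  assert (HK : Climc s K (0, side_sign s * PI)).
  { apply Climc_iff. split.
    - replace (Re (0, side_sign s * PI)) with
        ((ln ((/ 2) ^ 2 + 0 ^ 2) - ln ((/ 2 - 1) ^ 2 + 0 ^ 2)) / 2).
      (* The point 1/2 is equidistant from 0 and 1, so the logarithms cancel: this is why the limit
         is purely imaginary. *)
      2:{ unfold Re; cbn [fst]. replace ((/ 2 - 1) ^ 2 + 0 ^ 2) with ((/ 2) ^ 2 + 0 ^ 2) by field. lra. }
      unfold K, Re at 1; cbn [fst]. unfold Rdiv, Rminus.
      apply Rlimc_mult; [|apply Rlimc_const].
      assert (Q : forall c, (/ 2 + c) ^ 2 + 0 ^ 2 > 0 ->
         Rlimc s (fun z => ln ((Re (/ z)%C + c) ^ 2 + Im (/ z)%C ^ 2)) (ln ((/ 2 + c) ^ 2 + 0 ^ 2))).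
      { intros c Hc. apply (Rlimc_comp s (fun z => (Re (/ z)%C + c) ^ 2 + Im (/ z)%C ^ 2) ln).
        - apply Rlimc_plus; simpl; repeat apply Rlimc_mult; try apply Rlimc_const; try assumption;
            apply Rlimc_plus; try apply Rlimc_const; assumption.
        - apply continuous_ln; assumption. }
      apply Rlimc_plus.
      + specialize (Q 0 ltac:(nra)). rewrite Rplus_0_r in Q.
        apply (filterlim_ext (fun z => ln ((Re (/ z)%C + 0) ^ 2 + Im (/ z)%C ^ 2))); [|exact Q].
        intros z. now rewrite Rplus_0_r.
      + apply Rlimc_opp. apply (Q (-1)). nra.
    - replace (Im (0, side_sign s * PI)) with
        (side_sign s * PI + (atan (0 / (/ 2)) - atan (0 / (/ 2 - 1)))).
      2:{ unfold Im; cbn [snd]. unfold Rdiv. rewrite !Rmult_0_l, atan_0. ring. }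
      unfold K, Im at 1; cbn [snd]. unfold Rminus.
      apply Rlimc_plus; [apply Rlimc_const|]. apply Rlimc_plus; [|apply Rlimc_opp];
        apply (Rlimc_comp s _ atan); try apply continuous_atan; apply Rlimc_mult; try assumption;
        apply Rlimc_inv; try lra; try assumption.
      apply Rlimc_plus; [assumption|apply Rlimc_const]. }
  replace (0, side_sign s * PI / 2) with (Cmult (/ RtoC 2)%C (0, side_sign s * PI)).
  2:{ rewrite <- RtoC_inv by lra. apply injective_projections; simpl; field. }
  apply (filterlim_ext_loc (fun z => / z * K z)%C); [|apply Climc_mult; assumption].
  assert (Hn : cut_filter s (fun z => Rabs (Re (/ z)%C - / 2) < / 2)).
  { apply (proj1 (filterlim_locally (fun z => Re (/ z)%C) (/ 2)) H1 (mkposreal (/ 2) ltac:(lra))). }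
  generalize (filter_and _ _ Hn (cut_filter_half_plane s)). apply filter_imp.
  intros z [Hz1 Hz2]. apply Rabs_def2 in Hz1.
  rewrite cauchy_int_resolvent; [|apply (half_plane_cut s); assumption|apply (half_plane_neq0 s); assumption].
  f_equal. symmetry.
  apply (CInt_resolvent_side s (Re (/ z)%C) (Im (/ z)%C)); [lra|].
  (* Inversion exchanges the half-planes: Im (1/z) = - Im z / |z|^2 has the sign opposite to the
     side. *)
  assert (Hp : 0 < fst z ^ 2 + snd z ^ 2).
  { destruct s; simpl in Hz2; unfold Im in Hz2; nra. }
  apply Rinv_0_lt_compat in Hp.
  unfold Im; simpl. destruct s; simpl in *; unfold Im in Hz2; unfold Rdiv; nra.
Qed.

(** * The values Re 2F1(1, l; l + n; 2) *)

(* [cut_value l j] is the real part of 2F1(1, l; l + n; 2) for n = l + j. *)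
Fixpoint cut_value (l j : nat) : R :=
  match j with
  | O => 0
  | S i => INR (l + (l + i)) / (2 * INR (l + i)) * (cut_value l i + 1)
  end.

(** The definition of [cut_value] raises n at fixed l, the direction used for the sum over l; here n
    is fixed and l rises. Both sides obey the same step when j increases, which allows induction on
    j. *)
Lemma cut_value_rec (l j : nat) : (1 <= l)%nat ->
  INR (l + (l + S j)) * (cut_value l (S j) - 1) = 2 * INR l * cut_value (S l) j.
Proof.
  intros Hl. assert (0 < INR l) by (apply lt_0_INR; lia).
  induction j as [|j IH].
  - cbn [cut_value]. rewrite !plus_INR, !S_INR. simpl. field. lra.
  - assert (0 <= INR j) by apply pos_INR.
    cbn [cut_value] in *. rewrite !plus_INR, !S_INR in *.
    set (u := cut_value l j) in *. set (v := cut_value (S l) j) in *.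
    apply (f_equal (fun y => (INR l + (INR l + (INR j + 1 + 1))) / (2 * (INR l + (INR j + 1)))
       * y)) in IH.
    match type of IH with ?a = ?b =>
      match goal with |- ?c = ?d => cut (c - a = d - b); [lra|] end end.
    field. lra.
Qed.

Lemma pochhammer_shift (a : C) (k : nat) :
  pochhammer a (S k) = (a * pochhammer (a + 1) k)%C.
Proof.
  induction k as [|k IH].
  - simpl. ring.
  - cbn [pochhammer] in *. rewrite IH, S_INR, RtoC_plus. ring.
Qed.

Lemma hyp2F1_coeff_one_nat (b m k : nat) : (0 < m)%nat ->
  hyp2F1_coeff 1 (RtoC (INR b)) (RtoC (INR m)) k =
  (pochhammer (RtoC (INR b)) k / pochhammer (RtoC (INR m)) k)%C.
Proof.
  intros Hm. destruct (hyp2F1_coeff_one (RtoC (INR b)) (RtoC (INR m)) k) as [E|E]; [exact E|].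
  exfalso. exact (pochhammer_neq0 m k Hm E).
Qed.

Lemma RtoC_INR_S (n : nat) : RtoC (INR (S n)) = (RtoC (INR n) + 1)%C.
Proof. rewrite S_INR, RtoC_plus. reflexivity. Qed.

Lemma RtoC_INR_plus (n m : nat) : RtoC (INR (n + m)) = (RtoC (INR n) + RtoC (INR m))%C.
Proof. rewrite plus_INR, RtoC_plus. reflexivity. Qed.

Lemma RtoC_INR_neq0 (n : nat) : (0 < n)%nat -> RtoC (INR n) <> RtoC 0.
Proof. intros Hn. destruct n; [lia|]. apply INR_S_C_neq0. Qed.

Lemma hyp2F1_coeff_diag_0 (n : nat) : (1 <= n)%nat ->
  hyp2F1_coeff 1 (INR n) (INR (n + n)) 0 = RtoC 1.
Proof. intros Hn. rewrite hyp2F1_coeff_one_nat by lia. simpl. field. Qed.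

(** The algebra of the next lemma, with x, y, p, q standing for n, k, (n+1)_k and (2n+2)_k. *)
Lemma coeff_diag_identity (x y p q : C) :
  x <> RtoC 0 -> (x + x)%C <> RtoC 0 -> (x + x + 1)%C <> RtoC 0 -> (x + x + (y + 1))%C <> RtoC 0 ->
  q <> RtoC 0 ->
  (x * (p / q) =
   2 * (x + x + 1) *
   (x * p / ((x + x) * ((x + x + 1) * q) / (x + x + (y + 1))) -
    x * p * (x + (y + 1)) / ((x + x) * ((x + x + 1) * q))))%C.
Proof. intros H1 H2 H3 H4 H5. field. repeat split; assumption. Qed.

(** The coefficient of z^(k+2) in the relation that expresses z^2 2F1(1, n+1; 2n+2; z) through 2 (z
    - 1) 2F1(1, n; 2n; z) + 2 - z, multiplied by n. *)
Lemma hyp2F1_coeff_diag_rec (n k : nat) : (1 <= n)%nat ->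
  (RtoC (INR n) * hyp2F1_coeff 1 (INR (S n)) (INR (S n + S n)) k =
   2 * RtoC (INR (S (n + n))) *
     (hyp2F1_coeff 1 (INR n) (INR (n + n)) (S k) - hyp2F1_coeff 1 (INR n) (INR (n + n)) (S (S k))))%C.
Proof.
  intros Hn. rewrite !hyp2F1_coeff_one_nat by lia.
  pose proof (RtoC_INR_neq0 n Hn) as N1.
  pose proof (pochhammer_neq0 (S (S (n + n))) k ltac:(lia)) as N2.
  pose proof (INR_S_C_neq0 (n + n)) as N3. pose proof (INR_S_C_neq0 (S (n + n))) as N4.
  pose proof (pochhammer_neq0 (n + n) (S k) ltac:(lia)) as N5.
  pose proof (pochhammer_neq0 (n + n) (S (S k)) ltac:(lia)) as N6.
  replace (S n + S n)%nat with (S (S (n + n))) by lia.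
  assert (N7 : (RtoC (INR (n + n)) + RtoC (INR (S k)))%C <> RtoC 0).
  { rewrite <- RtoC_INR_plus. apply RtoC_INR_neq0. lia. }
  assert (E1 : forall j, pochhammer (RtoC (INR (n + n))) (S (S j)) =
     (RtoC (INR (n + n)) * (RtoC (INR (S (n + n))) * pochhammer (RtoC (INR (S (S (n + n))))) j))%C).
  { intro j. rewrite !pochhammer_shift, !RtoC_INR_S. reflexivity. }
  assert (E2 : pochhammer (RtoC (INR n)) (S k) = (RtoC (INR n) * pochhammer (RtoC (INR (S n))) k)%C)
    by (rewrite pochhammer_shift, RtoC_INR_S; reflexivity).
  cbn [pochhammer] in E2, N5, N6, E1 |- *.
  pose proof (E1 k) as E3.
  set (q := pochhammer (RtoC (INR (n + n))) k) in *.
  set (p := pochhammer (RtoC (INR n)) k) in *.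
  set (Q := pochhammer (RtoC (INR (S (S (n + n))))) k) in *.
  set (P := pochhammer (RtoC (INR (S n))) k) in *.
  assert (N8 : q <> RtoC 0) by (intros E; apply N5; rewrite E; ring).
  assert (N9 : (RtoC (INR (n + n)) + RtoC (INR k))%C <> RtoC 0)
    by (intros E; apply N5; rewrite E; ring).
  assert (N10 : RtoC (INR (n + n)) <> RtoC 0) by (apply RtoC_INR_neq0; lia).
  rewrite E2, E3.
  replace (q * (RtoC (INR (n + n)) + RtoC (INR k)))%C with
   (RtoC (INR (n + n)) * (RtoC (INR (S (n + n))) * Q) / (RtoC (INR (n + n)) + RtoC (INR (S k))))%C
   by (rewrite <- E3; field; assumption).
  rewrite (RtoC_INR_S (n + n)) in *. rewrite (RtoC_INR_S k) in *. rewrite (RtoC_INR_plus n n) in *.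
  apply coeff_diag_identity; try assumption.
Qed.

(** The imaginary part depends on the side and is left free: only its existence is carried through
    the recurrences. *)
Definition has_cut_limits (F : C -> C) (re : R) : Prop :=
  forall s, exists im, Climc s F (re, im).

(** At z = 2 the inhomogeneous term 2 - z vanishes and the factor 2 (z - 1)/z^2 is real, so a purely
    imaginary limit stays purely imaginary. *)
Lemma diagonal_continuation (n : nat) : (1 <= n)%nat ->
  exists F, is_hyp2F1_continuation 1 (RtoC (INR n)) (RtoC (INR (n + n))) F /\ has_cut_limits F 0.
Proof.
  induction n as [|n IH]; [lia|]. intros _.
  destruct (Nat.eq_dec n 0) as [->|Hn].
  { exists cauchy_int. split.
    - replace (INR (1 + 1)) with 2 by (simpl; ring). apply cauchy_int_continuation.
    - intros s. eexists. apply cauchy_int_limit. }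
  destruct IH as [F [[F1 F2] F3]]; [lia|].
  set (al := (2 * RtoC (INR (S (n + n))) / RtoC (INR n))%C).
  pose proof (RtoC_INR_neq0 n ltac:(lia)) as Nn.
  (* (2n+1)/n * (2 (z - 1) F_n + 2 - z) = z^2 F_(n+1) for F_n = 2F1(1, n; 2n; z) *)
  set (N := fun z => (al * (z * F z + (- (1)) * F z) + al / 2 * (2 + (- (1)) * z))%C).
  (* The quotient has a removable singularity at 0; its value there is the constant coefficient 1 of
     the new series. *)
  set (G := fun z => if Ceq_dec z 0 then RtoC 1 else (N z / z / z)%C).
  set (f := hyp2F1_coeff 1 (RtoC (INR n)) (RtoC (INR (n + n)))) in *.
  set (f' := hyp2F1_coeff 1 (RtoC (INR (S n))) (RtoC (INR (S n + S n)))).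
  assert (f0 : f O = RtoC 1) by (apply hyp2F1_coeff_diag_0; lia).
  assert (f1 : f 1%nat = (/ 2)%C).
  { unfold f. rewrite hyp2F1_coeff_one_nat by lia. simpl. rewrite RtoC_INR_plus. field.
    rewrite <- RtoC_INR_plus. apply RtoC_INR_neq0. lia. }
  assert (frec : forall k, f' k = (al * (f (S k) - f (S (S k))))%C).
  { intro k. unfold f', f, al. pose proof (hyp2F1_coeff_diag_rec n k ltac:(lia)) as E.
    apply (f_equal (fun y => (y / RtoC (INR n))%C)) in E.
    transitivity (RtoC (INR n) * hyp2F1_coeff 1 (INR (S n)) (INR (S n + S n)) k / RtoC (INR n))%C.
    - field. assumption.
    - rewrite E. field. assumption. }
  assert (f'0 : f' O = RtoC 1) by (apply hyp2F1_coeff_diag_0; lia).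
  assert (Gs : forall z, Cmod z < 1 -> is_Cpseries f' z (G z)).
  { intros z Hz. unfold G. destruct (Ceq_dec z 0) as [->|Hz0].
    - apply (is_Cpseries_bound _ _ _ 0 0); [lra|]. intro k.
      replace (Csum _ k) with (RtoC 1).
      + replace (1 - 1)%C with (RtoC 0) by ring. rewrite Cmod_0. lra.
      + induction k as [|k IHk]; cbn [Csum]; [rewrite f'0; simpl; ring|].
        rewrite <- IHk, Cpow_S. ring.
    (* Division by z^2 is possible because the two lowest coefficients of N vanish: -1 + 1 = 0, and
       1 - 1/2 - 1/2 = 0 from the first two coefficients of f. *)
    - assert (HN : is_Cpseries (fun k => match k with O => RtoC 0 | S O => RtoC 0 | S (S j) => f' j end) z (N z)).
      { pose proof (F1 z Hz) as Hf.
        pose proof (is_Cpseries_incr _ _ _ Hf) as Hi.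
        pose proof (is_Cpseries_scal (- (1))%C _ _ _ Hf) as Hm.
        pose proof (is_Cpseries_scal al _ _ _ (is_Cpseries_plus _ _ _ _ _ Hi Hm)) as HA.
        pose proof (is_Cpseries_incr _ _ _ (is_Cpseries_const 1 z)) as Hz1.
        pose proof (is_Cpseries_scal (- (1))%C _ _ _ Hz1) as Hz2.
        pose proof (is_Cpseries_scal (al / 2)%C _ _ _
           (is_Cpseries_plus _ _ _ _ _ (is_Cpseries_const 2 z) Hz2)) as HB.
        pose proof (is_Cpseries_plus _ _ _ _ _ HA HB) as HC.
        replace (N z) with (al * (z * F z + - (1) * F z) + al / 2 * (2 + - (1) * (z * 1)))%C
          by (unfold N; ring).
        eapply is_Cpseries_ext; [|exact HC].
        intros [|[|k]]; cbv beta iota.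
        - rewrite f0. field.
        - rewrite f0, f1. field.
        - rewrite frec. ring. }
      assert (Hd : forall a l, is_Cpseries a z l -> a O = RtoC 0 ->
                 is_Cpseries (fun k => a (S k)) z (l / z)%C).
      { intros a l Ha Ha0.
        pose proof (@is_pseries_decr_1 C_AbsRing C_NormedModule a z (/ z)%C l) as D.
        assert (E : @mult C_AbsRing (/ z)%C z = one) by (apply Cinv_l; assumption).
        specialize (D E Ha). rewrite Ha0 in D.
        replace (l / z)%C with (/ z * (l + - 0))%C by (field; assumption). exact D. }
      apply Hd in HN; [|reflexivity]. apply Hd in HN; [|reflexivity].
      exact HN. }
  exists G. split; [split|].
  - exact Gs.
  - intros z Hz. destruct (Ceq_dec z 0) as [->|Hz0].
    + exists (mkposreal 1 Rlt_0_1), f'. simpl. intros w Hw.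
      replace (w - 0)%C with w in * by ring. apply Gs. assumption.
    + apply (analytic_at_ext (fun z => N z / z / z)%C _ _ (Cmod z)).
      * apply Cmod_gt_0; assumption.
      * intros w Hw. unfold G. destruct (Ceq_dec w 0) as [->|]; [|reflexivity].
        replace (0 - z)%C with (- z)%C in Hw by ring. rewrite Cmod_opp in Hw. lra.
      * apply (analytic_at_div_id (fun z => N z / z)%C); [assumption|].
        apply analytic_at_div_id; [assumption|].
        apply analytic_at_plus; apply analytic_at_scal; apply analytic_at_plus.
        -- apply analytic_at_mul_id; auto.
        -- apply analytic_at_scal; auto.
        -- apply analytic_at_const.
        -- apply (analytic_at_ext (fun z => - (1) * (z * 1))%C _ _ 1 Rlt_0_1);
             [intros; ring|]. apply analytic_at_scal, analytic_at_mul_id, analytic_at_const.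
  - intros s. destruct (F3 s) as [im Him].
    pose proof (Climc_id s) as Hi. pose proof (Climc_inv_id s) as Hv.
    assert (HN : Climc s N (al * (2 * (0, im) + - (1) * (0, im)) + al / 2 * (2 + - (1) * 2))%C).
    { unfold N. apply Climc_plus.
      - apply Climc_mult; [apply Climc_const|]. apply Climc_plus.
        + apply Climc_mult; [exact Hi|exact Him].
        + apply Climc_mult; [apply Climc_const|exact Him].
      - apply Climc_mult; [apply Climc_const|]. apply Climc_plus; [apply Climc_const|].
        apply Climc_mult; [apply Climc_const|exact Hi]. }
    pose proof (Climc_mult s _ _ _ _ (Climc_mult s _ _ _ _ HN Hv) Hv) as HL.
    exists (INR (S (n + n)) / INR n * im / 2).
    apply (Climc_ext s (fun z => N z * / z * / z)%C).
    + intros z Hz. unfold G. destruct (Ceq_dec z 0) as [E|]; [|reflexivity].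
      exfalso. exact (half_plane_neq0 s z Hz E).
    + match type of HL with Climc _ _ ?l => replace (0, INR (S (n + n)) / INR n * im / 2) with l end.
      * exact HL.
      * assert (INR n <> 0) by (apply not_0_INR; lia).
        assert (Ea : al = RtoC (2 * INR (S (n + n)) / INR n)).
        { unfold al. rewrite RtoC_div, RtoC_mult by assumption. reflexivity. }
        rewrite Ea. set (a := 2 * INR (S (n + n)) / INR n).
        replace (INR (S (n + n)) / INR n * im / 2) with (a / 4 * im) by (unfold a; field; assumption).
        replace ((RtoC a / 2) * (2 + - (1) * 2))%C with (RtoC 0) by field.
        rewrite <- RtoC_inv by lra.
        apply injective_projections; simpl; field.
Qed.

(** Induction on n - l, from the diagonal downwards. The step from l + 1 to l at fixed n only
    multiplies by z and adds 1, so analyticity and limits pass through without any division. *)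
Lemma offdiagonal_continuation (j l : nat) : (1 <= l)%nat ->
  exists F, is_hyp2F1_continuation 1 (RtoC (INR l)) (RtoC (INR (l + (l + j)))) F /\
            has_cut_limits F (cut_value l j).
Proof.
  revert l. induction j as [|j IH]; intros l Hl.
  - rewrite Nat.add_0_r. apply diagonal_continuation; assumption.
  - destruct (IH (S l) ltac:(lia)) as [F [[F1 F2] F3]].
    set (m := (l + (l + S j))%nat).
    replace (S l + (S l + j))%nat with (S m) in F1 by (unfold m; lia).
    assert (Hm : INR m <> 0) by (apply not_0_INR; unfold m; lia).
    pose proof (RtoC_INR_neq0 m ltac:(unfold m; lia)) as Nm.
    exists (fun z => 1 + RtoC (INR l / INR m) * (z * F z))%C. split; [split|].
    + intros z Hz.
      eapply is_Cpseries_ext;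
        [|apply (is_Cpseries_plus _ _ _ _ _ (is_Cpseries_const 1 z)
             (is_Cpseries_scal (RtoC (INR l / INR m)) _ _ _ (is_Cpseries_incr _ _ _ (F1 z Hz))))].
      intros [|k]; cbv beta iota; rewrite !hyp2F1_coeff_one_nat by (unfold m; lia).
      * simpl. field.
      * rewrite !pochhammer_shift, !RtoC_INR_S, RtoC_div by assumption.
        pose proof (pochhammer_neq0 (S m) k ltac:(lia)) as N. rewrite RtoC_INR_S in N.
        field. split; assumption.
    + intros z Hz. apply analytic_at_plus; [apply analytic_at_const|].
      apply analytic_at_scal, analytic_at_mul_id; auto.
    + intros s. destruct (F3 s) as [im Him].
      exists (INR l / INR m * 2 * im).
      replace (cut_value l (S j), INR l / INR m * 2 * im) with
        (1 + RtoC (INR l / INR m) * (2 * (cut_value (S l) j, im)))%C.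
      * apply Climc_plus; [apply Climc_const|]. apply Climc_mult; [apply Climc_const|].
        apply Climc_mult; [apply Climc_id|exact Him].
      * pose proof (cut_value_rec l j Hl) as E. fold m in E.
        assert (E2 : cut_value l (S j) = 1 + INR l / INR m * 2 * cut_value (S l) j).
        { apply Rmult_eq_reg_l with (INR m); [|assumption].
          replace (INR m * (1 + INR l / INR m * 2 * cut_value (S l) j)) with
             (INR m + 2 * INR l * cut_value (S l) j) by (field; assumption). lra. }
        rewrite E2. apply injective_projections; simpl; ring.
Qed.

Lemma hyp2F1_cut_re (s : cut_side) (l n : nat) : (1 <= l <= n)%nat ->
  Re (hyp2F1_cut s (RtoC 1) (RtoC (INR l)) (RtoC (INR (l + n))) 2) = cut_value l (n - l).
Proof.
  intros Hl. destruct (offdiagonal_continuation (n - l) l ltac:(lia)) as [F [HF HL]].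
  replace (l + (l + (n - l)))%nat with (l + n)%nat in HF by lia.
  assert (HE : is_hyp2F1_continuation 1 (RtoC (INR l)) (RtoC (INR (l + n)))
           (hyp2F1 1 (RtoC (INR l)) (RtoC (INR (l + n))))).
  (* Since a continuation exists, the epsilon choice is one; uniqueness then identifies it with F on
     the cut plane, hence on both half-planes. *)
  { unfold hyp2F1. apply epsilon_spec. exists F. exact HF. }
  destruct (HL s) as [im Him].
  assert (E : hyp2F1_cut s (RtoC 1) (RtoC (INR l)) (RtoC (INR (l + n))) 2 = (cut_value l (n - l), im)).
  { unfold hyp2F1_cut, C_iota.
    apply (@iota_filterlim_locally C_AbsRing C_CompleteNormedModule _ (cut_filter s)
       (Proper_StrongProper _ (cut_filter_proper s))).
    apply (Climc_ext s F); [|exact Him].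
    intros z Hz. apply (continuation_unique _ _ _ _ _ HF HE), (half_plane_cut s), Hz. }
  rewrite E. reflexivity.
Qed.

(** * Euler's constant and the exponential integral *)

Definition expm1_coeff (k : nat) : R := / INR (fact (S k)).

Definition expm1_div (x : R) : R := PSeries expm1_coeff x.

(** The sum of x^k / (k k!) over k >= 1, the regular part of Ei; the classical entire function Ein
    is minus this one at the opposite argument. *)
Definition Ein (x : R) : R := PSeries (PS_Int expm1_coeff) x.

Lemma CV_radius_exp : CV_radius (fun k => / INR (fact k)) = p_infty.
Proof.
  apply CV_radius_infinite_DAlembert.
  - intro n. apply Rinv_neq_0_compat, INR_fact_neq_0.
  - apply (is_lim_seq_ext (fun n => / INR (S n))).
    + intro n. assert (0 < INR (S n)) by (apply lt_0_INR; lia).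
      pose proof (INR_fact_lt_0 n). rewrite fact_simpl, mult_INR.
      rewrite <- (Rabs_pos_eq (/ INR (S n))) by (left; apply Rinv_0_lt_compat; lra).
      f_equal. field. lra.
    + apply (is_lim_seq_incr_1 (fun n => / INR n)). apply (is_lim_seq_inv INR p_infty).
      * apply is_lim_seq_INR.
      * discriminate.
Qed.

Lemma CV_radius_expm1 : CV_radius expm1_coeff = p_infty.
Proof.
  transitivity (CV_radius (PS_decr_1 (fun k => / INR (fact k)))); [reflexivity|].
  rewrite CV_radius_decr_1. apply CV_radius_exp.
Qed.

Lemma expm1_div_spec (x : R) : x * expm1_div x = exp x - 1.
Proof.
  pose proof (is_pseries_unique _ _ _ (is_exp_Reals x)) as E.
  rewrite PSeries_decr_1 in E.
  - replace (/ INR (fact 0)) with 1 in E by (simpl; field).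
    change (PSeries (PS_decr_1 (fun k => / INR (fact k))) x) with (expm1_div x) in E. lra.
  - eexists. apply is_exp_Reals.
Qed.

Lemma expm1_div_0 : expm1_div 0 = 1.
Proof. unfold expm1_div. rewrite PSeries_0. unfold expm1_coeff. simpl. field. Qed.

Lemma is_derive_Ein (x : R) : is_derive Ein x (expm1_div x).
Proof.
  unfold Ein. replace (expm1_div x) with (PSeries (PS_derive (PS_Int expm1_coeff)) x).
  - apply is_derive_PSeries. rewrite CV_radius_Int, CV_radius_expm1. exact I.
  - apply PSeries_ext. intro n. unfold PS_derive, PS_Int. field. apply (not_0_INR (S n)). lia.
Qed.

Lemma Ein_0 : Ein 0 = 0.
Proof. unfold Ein. rewrite PSeries_0. reflexivity. Qed.

Lemma nondecreasing_of_derive (f df : R -> R) (a b : R) :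
  a <= b -> (forall x, a < x < b -> is_derive f x (df x)) ->
  (forall x, a <= x <= b -> continuity_pt f x) ->
  (forall x, a <= x <= b -> 0 <= df x) -> f a <= f b.
Proof.
  intros Hab Hd Hc Hp.
  destruct (MVT_gen f a b df) as [c [H1 H2]]; rewrite ?Rmin_left, ?Rmax_right in * by assumption; auto.
  specialize (Hp c H1). nra.
Qed.

Lemma derive_continuity_pt (f : R -> R) (x l : R) : is_derive f x l -> continuity_pt f x.
Proof.
  intros H. apply derivable_continuous_pt. exists l. now apply is_derive_Reals.
Qed.

Lemma bernoulli_le1 (y : R) (m : nat) : 0 <= y <= 1 -> 1 - INR m * y <= (1 - y) ^ m.
Proof.
  intros Hy. induction m as [|m IH]; [simpl; lra|].
  rewrite S_INR. pose proof (pos_INR m). cbn [pow].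
  apply Rle_trans with ((1 - y) * (1 - INR m * y)); [nra|].
  apply Rmult_le_compat_l; lra.
Qed.

Lemma exp_pow_INR (y : R) (m : nat) : exp y ^ m = exp (INR m * y).
Proof.
  induction m as [|m IH]; [simpl; rewrite Rmult_0_l, exp_0; reflexivity|].
  rewrite S_INR. cbn [pow]. rewrite IH, <- exp_plus. f_equal. ring.
Qed.

(** The upper bound is 1 - y <= e^{-y} with y = t/m. For the lower one, (1 + y)^m <= e^t gives (1 -
    y)^m >= e^{-t} (1 - y^2)^m, and Bernoulli's inequality finishes. *)
Lemma pow_exp_bounds (m : nat) (t : R) : (1 <= m)%nat -> 0 <= t <= INR m ->
  exp (- t) * (1 - t ^ 2 / INR m) <= (1 - t / INR m) ^ m <= exp (- t).
Proof.
  intros Hm Ht. assert (Hp : 0 < INR m) by (apply lt_0_INR; lia).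
  assert (Hy : 0 <= t / INR m <= 1).
  { split; [apply Rmult_le_pos; [lra|left; apply Rinv_0_lt_compat; lra]|].
    apply Rle_div_l; lra. }
  set (y := t / INR m) in *. assert (Et : t = INR m * y) by (unfold y; field; lra).
  split.
  - apply Rle_trans with (exp (- t) * ((1 - y) ^ m * (1 + y) ^ m)).
    + apply Rmult_le_compat_l; [left; apply exp_pos|]. rewrite <- Rpow_mult_distr.
      replace ((1 - y) * (1 + y)) with (1 - y ^ 2) by ring.
      replace (1 - t ^ 2 / INR m) with (1 - INR m * y ^ 2) by (rewrite Et; field; lra).
      apply bernoulli_le1. nra.
    + assert (H : (1 + y) ^ m <= exp t).
      { rewrite Et, <- exp_pow_INR. apply pow_incr. split; [lra|apply exp_ineq1_le]. }
      assert (0 <= (1 - y) ^ m) by (apply pow_le; lra).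
      pose proof (exp_pos (- t)). assert (E : exp (- t) * exp t = 1)
        by (rewrite <- exp_plus, Rplus_opp_l; apply exp_0).
      replace ((1 - y) ^ m) with ((1 - y) ^ m * (exp (- t) * exp t)) at 2 by (rewrite E; ring).
      assert (0 <= exp (- t) * (1 - y) ^ m) by (apply Rmult_le_pos; lra).
      nra.
  - rewrite Et. replace (- (INR m * y)) with (INR m * - y) by ring.
    rewrite <- exp_pow_INR. apply pow_incr. split; [lra|].
    pose proof (exp_ineq1_le (- y)). lra.
Qed.

(* Integrates [(1 - (1 - t / m) ^ q) / t] from 0; its value at t = q = m is the harmonic number. *)
Fixpoint harmonic_poly (m : R) (q : nat) (t : R) : R :=
  match q with
  | O => 0
  | S p => harmonic_poly m p t + (1 - (1 - t / m) ^ S p) / INR (S p)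
  end.

Lemma is_derive_harmonic_poly (m : R) (q : nat) (t : R) : m <> 0 -> t <> 0 ->
  is_derive (harmonic_poly m q) t ((1 - (1 - t / m) ^ q) / t).
Proof.
  intros Hm Ht. induction q as [|q IH].
  - simpl. replace ((1 - 1) / t) with 0 by (field; assumption). apply (is_derive_const (V := R_NormedModule)).
  - replace ((1 - (1 - t / m) ^ S q) / t) with
      ((1 - (1 - t / m) ^ q) / t + (1 - t / m) ^ q / m) by (simpl; field; split; assumption).
    apply (is_derive_plus (V := R_NormedModule) (harmonic_poly m q)
       (fun t => (1 - (1 - t / m) ^ S q) / INR (S q))); [exact IH|].
    assert (Hq : INR (S q) <> 0) by (apply not_0_INR; lia).
    auto_derive; [trivial|].
    change (match q with O => 1 | S _ => INR q + 1 end) with (INR (S q)). simpl pred.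
    unfold Rdiv, Rminus. field. split; assumption.
Qed.

Lemma harmonic_poly_continuity (m : R) (q : nat) (t : R) : continuity_pt (harmonic_poly m q) t.
Proof.
  induction q as [|q IH]; [apply continuity_pt_const; intros ? ?; reflexivity|].
  refine (continuity_pt_plus (harmonic_poly m q)
    (fun u => (1 - (1 - u / m) ^ S q) / INR (S q)) t IH _).
  eapply derive_continuity_pt, Derive_correct. auto_derive. trivial.
Qed.

Lemma harmonic_S (n : nat) : harmonic (S n) = harmonic n + / INR (S n).
Proof. unfold harmonic. rewrite sum_n_Sm by lia. reflexivity. Qed.

Lemma harmonic_0 : harmonic 0 = 0.
Proof. unfold harmonic. rewrite sum_n_m_zero by lia. reflexivity. Qed.

Lemma harmonic_poly_full (m : R) (q : nat) : m <> 0 -> harmonic_poly m q m = harmonic q.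
Proof.
  intros Hm. induction q as [|q IH]; [now rewrite harmonic_0|].
  rewrite harmonic_S. cbn [harmonic_poly]. rewrite IH.
  replace (1 - m / m) with 0 by (field; assumption). rewrite pow_i by lia.
  unfold Rdiv. ring.
Qed.

Lemma harmonic_poly_0 (m : R) (q : nat) : harmonic_poly m q 0 = 0.
Proof.
  induction q as [|q IH]; [reflexivity|]. cbn [harmonic_poly]. rewrite IH.
  replace (1 - 0 / m) with 1 by (unfold Rdiv; ring). rewrite pow1. unfold Rdiv. ring.
Qed.

Lemma is_derive_Ein_opp (t : R) : t <> 0 ->
  is_derive (fun t => Ein (- t)) t (- ((1 - exp (- t)) / t)).
Proof.
  intros Ht.
  replace (- ((1 - exp (- t)) / t)) with (scal (- 1) (expm1_div (- t))).
  - apply (is_derive_comp (V := R_NormedModule) Ein Ropp); [apply is_derive_Ein|].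
    apply (is_derive_opp (V := R_NormedModule) (fun t => t)). apply (is_derive_id (K := R_AbsRing)).
  - pose proof (expm1_div_spec (- t)) as E. unfold scal; simpl; unfold mult; simpl.
    replace (1 - exp (- t)) with (t * expm1_div (- t)) by lra. field. assumption.
Qed.

Lemma Ein_continuity (x : R) : continuity_pt Ein x.
Proof. eapply derive_continuity_pt, is_derive_Ein. Qed.

Lemma Ein_opp_continuity (x : R) : continuity_pt (fun t => Ein (- t)) x.
Proof.
  apply (continuity_pt_comp Ropp Ein); [|apply Ein_continuity].
  apply (continuity_pt_opp (fun t => t)), derivable_continuous_pt, derivable_pt_id.
Qed.

(** The left side is the integral over [0, m] of (e^{-t} - (1 - t/m)^m)/t, which lies between 0 and
    the integral of t e^{-t}/m, itself at most 1/m. Monotonicity replaces integration, so the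
    derivatives are needed only in the open interval. *)
Lemma harmonic_Ein (m : nat) : (1 <= m)%nat ->
  Rabs (harmonic m + Ein (- INR m)) <= / INR m.
Proof.
  intros Hm. assert (Hp : 0 < INR m) by (apply lt_0_INR; lia).
  assert (Hi : 0 < / INR m) by (apply Rinv_0_lt_compat; lra).
  assert (Hd : forall t, 0 < t < INR m ->
    is_derive (fun t => harmonic_poly (INR m) m t + Ein (- t)) t
       ((1 - (1 - t / INR m) ^ m) / t + - ((1 - exp (- t)) / t))).
  { intros t Ht. apply (is_derive_plus (V := R_NormedModule) (harmonic_poly (INR m) m)).
    - apply is_derive_harmonic_poly; lra.
    - apply is_derive_Ein_opp; lra. }
  assert (Hc : forall t, continuity_pt (fun t => harmonic_poly (INR m) m t + Ein (- t)) t).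
  { intros t. apply continuity_pt_plus; [apply harmonic_poly_continuity|apply Ein_opp_continuity]. }
  rewrite <- (harmonic_poly_full (INR m) m) by lra.
  assert (Z : harmonic_poly (INR m) m 0 + Ein (- 0) = 0)
    by (rewrite harmonic_poly_0, Ropp_0, Ein_0; ring).
  assert (B : forall t, 0 <= t <= INR m ->
     0 <= (1 - (1 - t / INR m) ^ m) / t + - ((1 - exp (- t)) / t) <= t * exp (- t) / INR m).
  { intros t Ht. destruct (Req_dec t 0) as [->|Hne].
    (* At t = 0 the quotients take the default value of division by zero, and the bound reads 0 <= 0
       <= 0. *)
    - unfold Rdiv. rewrite Rinv_0. lra.
    - assert (Hti : 0 < / t) by (apply Rinv_0_lt_compat; lra).
      destruct (pow_exp_bounds m t Hm Ht) as [B1 B2].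
      assert (Eq : (1 - (1 - t / INR m) ^ m) / t + - ((1 - exp (- t)) / t) =
        (exp (- t) - (1 - t / INR m) ^ m) * / t) by (field; lra).
      rewrite Eq.
      split; [apply Rmult_le_pos; lra|].
      replace (t * exp (- t) / INR m) with (exp (- t) * (t ^ 2 / INR m) * / t) by (field; lra).
      apply Rmult_le_compat_r; lra. }
  apply Rabs_le. split.
  - apply Rle_trans with 0; [lra|]. rewrite <- Z.
    apply (nondecreasing_of_derive (fun t => harmonic_poly (INR m) m t + Ein (- t)) _ 0 (INR m)
            ltac:(lra) Hd); [auto|]. intros t Ht. apply B, Ht.
  - (* t e^{-t} / m is the derivative of -(1 + t) e^{-t} / m *)
    set (G := fun t => - (1 + t) * exp (- t) / INR m - (harmonic_poly (INR m) m t + Ein (- t))).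
    assert (HG : G 0 <= G (INR m)).
    { apply (nondecreasing_of_derive G (fun t => t * exp (- t) / INR m -
         ((1 - (1 - t / INR m) ^ m) / t + - ((1 - exp (- t)) / t)))); [lra| | |].
      - intros t Ht. apply (is_derive_minus (V := R_NormedModule) (fun t => - (1 + t) * exp (- t) / INR m)).
        + auto_derive; [trivial|]. field. lra.
        + apply Hd, Ht.
      - intros t Ht. apply continuity_pt_minus; [|apply Hc].
        eapply derive_continuity_pt, Derive_correct. auto_derive. trivial.
      - intros t Ht. pose proof (B t Ht). lra. }
    unfold G in HG. rewrite Z, Ropp_0, exp_0 in HG.
    pose proof (exp_pos (- INR m)).
    assert (0 <= (1 + INR m) * exp (- INR m) / INR m).
    { apply Rmult_le_pos; [|lra]. apply Rmult_le_pos; lra. }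
    unfold Rdiv in *. lra.
Qed.

(** For t > 0 this is gamma + E_1(t), with E_1(t) = - Ei(-t): it decreases to gamma at infinity. *)
Definition Ein_log (t : R) : R := - Ein (- t) - ln t.

(** The derivative is -e^{-t}/t, which for t >= 1 lies between -e^{-t} and 0; hence [Ein_log]
    decreases while its difference with e^{-t} increases. *)
Lemma Ein_log_bounds (a b : R) : 1 <= a <= b ->
  Ein_log b <= Ein_log a <= Ein_log b + exp (- a).
Proof.
  intros Hab.
  assert (Hd : forall t, 0 < t -> is_derive Ein_log t (- (exp (- t) / t))).
  { intros t Ht.
    replace (- (exp (- t) / t)) with (- - ((1 - exp (- t)) / t) - / t) by (field; lra).
    apply (is_derive_minus (V := R_NormedModule) (fun t => - Ein (- t)) ln).
    - apply (is_derive_opp (V := R_NormedModule) (fun t => Ein (- t))). apply is_derive_Ein_opp. lra.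
    - apply is_derive_ln, Ht. }
  assert (Hq : forall t, 1 <= t -> 0 <= exp (- t) / t <= exp (- t)).
  { intros t Ht. pose proof (exp_pos (- t)).
    assert (0 < / t <= 1) by (split; [apply Rinv_0_lt_compat; lra|rewrite <- Rinv_1; apply Rinv_le_contravar; lra]).
    unfold Rdiv. nra. }
  split.
  - assert (- Ein_log a <= - Ein_log b); [|lra].
    apply (nondecreasing_of_derive (fun t => - Ein_log t) (fun t => - - (exp (- t) / t))); [lra| | |].
    + intros t Ht. apply (is_derive_opp (V := R_NormedModule) Ein_log), Hd. lra.
    + intros t Ht. apply continuity_pt_opp. eapply derive_continuity_pt, Hd. lra.
    + intros t Ht. destruct (Hq t ltac:(lra)). lra.
  - assert (Ein_log a - exp (- a) <= Ein_log b - exp (- b)); [|pose proof (exp_pos (- b)); lra].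
    assert (He : forall t, is_derive (fun t => exp (- t)) t (- exp (- t)))
      by (intros; auto_derive; [trivial|ring]).
    apply (nondecreasing_of_derive (fun t => Ein_log t - exp (- t))
       (fun t => - (exp (- t) / t) - - exp (- t))); [lra| | |].
    + intros t Ht. apply (is_derive_minus (V := R_NormedModule) Ein_log); [apply Hd; lra|apply He].
    + intros t Ht. apply continuity_pt_minus; eapply derive_continuity_pt; [apply Hd; lra|apply He].
    + intros t Ht. destruct (Hq t ltac:(lra)). lra.
Qed.

(** A bounded decreasing sequence converges, and by [harmonic_Ein] it differs from H_n - ln n by
    o(1). This also shows that the [Lim_seq] in [euler_gamma] is a genuine finite limit. *)
Lemma euler_gamma_lim : is_lim_seq (fun n => Ein_log (INR (S n))) euler_gamma.
Proof.
  assert (H1 : forall n, 1 <= INR (S n)) by (intro n; rewrite S_INR; pose proof (pos_INR n); lra).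
  destruct (ex_finite_lim_seq_decr (fun n => Ein_log (INR (S n))) (Ein_log 1 - exp (- (1)))) as [l Hl].
  - intro n. apply Ein_log_bounds. split; [apply H1|rewrite (S_INR (S n)); lra].
  - intro n. pose proof (Ein_log_bounds 1 (INR (S n)) ltac:(split; [lra|apply H1])). lra.
  - assert (L : is_lim_seq (fun n => harmonic n - ln (INR n)) l).
    { apply is_lim_seq_incr_1.
      assert (Z : is_lim_seq (fun n => harmonic (S n) + Ein (- INR (S n))) 0).
      { assert (V : is_lim_seq (fun n => / INR (S n)) 0).
        { apply (is_lim_seq_incr_1 (fun n => / INR n)). apply (is_lim_seq_inv INR p_infty).
          - apply is_lim_seq_INR.
          - discriminate. }
        apply (is_lim_seq_le_le (fun n => - / INR (S n)) _ (fun n => / INR (S n))).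
        - intro n. apply Rabs_le_between. apply harmonic_Ein. lia.
        - replace (Finite 0) with (Rbar_opp 0) by (simpl; f_equal; ring).
          apply -> is_lim_seq_opp. exact V.
        - exact V. }
      replace (Finite l) with (Finite (0 + l)) by (f_equal; ring).
      eapply is_lim_seq_ext; [|apply (is_lim_seq_plus' _ _ _ _ Z Hl)].
      intro n. unfold Ein_log. simpl. ring. }
    unfold euler_gamma. rewrite (is_lim_seq_unique _ _ L). exact Hl.
Qed.

Lemma Ein_log_asymptotic (t : R) : 1 <= t -> Rabs (Ein_log t - euler_gamma) <= exp (- t).
Proof.
  intros Ht.
  assert (Ev : eventually (fun n => t <= INR (S n))).
  { destruct (nfloor_ex t ltac:(lra)) as [N [_ HN]]. exists N. intros n Hn.
    apply le_INR in Hn. rewrite S_INR. lra. }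
  assert (L1 : Rbar_le euler_gamma (Ein_log t)).
  { eapply is_lim_seq_le_loc; [|apply euler_gamma_lim|apply is_lim_seq_const].
    destruct Ev as [N HN]. exists N. intros n Hn. apply Ein_log_bounds. split; auto. }
  assert (L2 : Rbar_le (Ein_log t - exp (- t)) euler_gamma).
  { eapply is_lim_seq_le_loc; [|apply is_lim_seq_const|apply euler_gamma_lim].
    destruct Ev as [N HN]. exists N. intros n Hn.
    pose proof (Ein_log_bounds t (INR (S n)) ltac:(split; auto)). lra. }
  simpl in L1, L2. apply Rabs_le. pose proof (exp_pos (- t)). lra.
Qed.

(** The split e^x/x = 1/x + (e^x - 1)/x, valid on both half-lines. The constant is left free: gamma
    fixes the value at minus infinity, 0 serves on a bounded interval. *)
Lemma is_derive_log_Ein (c x : R) : x <> 0 ->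
  is_derive (fun t => c + ln (Rabs t) + Ein t) x (exp x / x).
Proof.
  intros Hx.
  assert (E : exp x / x = 0 + / x + expm1_div x).
  { replace (exp x) with (x * expm1_div x + 1) by (rewrite expm1_div_spec; ring). field. assumption. }
  rewrite E.
  apply (is_derive_plus (V := R_NormedModule) (fun t => c + ln (Rabs t))); [|apply is_derive_Ein].
  apply (is_derive_plus (V := R_NormedModule) (fun _ => c) (fun t => ln (Rabs t))).
  - apply (is_derive_const (V := R_NormedModule)).
  - destruct (Rlt_le_dec x 0) as [Hn|Hp].
    + apply (is_derive_ext_loc (fun t => ln (- t))).
      * exists (mkposreal (- x) ltac:(lra)). intros t Ht.
        apply Rabs_def2 in Ht. simpl in Ht. unfold minus, plus, opp in Ht; simpl in Ht.
        rewrite Rabs_left; [reflexivity|lra].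
      * auto_derive; [lra|]. field. assumption.
    + apply (is_derive_ext_loc ln).
      * exists (mkposreal x ltac:(lra)). intros t Ht.
        apply Rabs_def2 in Ht. simpl in Ht. unfold minus, plus, opp in Ht; simpl in Ht.
        rewrite Rabs_pos_eq; [reflexivity|lra].
      * apply is_derive_ln. lra.
Qed.

Lemma continuous_exp_div (x : R) : x <> 0 -> continuous (fun t => exp t / t) x.
Proof.
  intros Hx. apply (ex_derive_continuous (K := R_AbsRing) (V := R_NormedModule)).
  auto_derive. assumption.
Qed.

(** At t < 0 the function equals gamma - [Ein_log] (-t); this is where Euler's constant is seen to
    be the right normalisation of Ei. *)
Lemma log_Ein_minus_infinity :
  filterlim (fun t => euler_gamma + ln (Rabs t) + Ein t) (Rbar_locally m_infty) (locally 0).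
Proof.
  apply filterlim_locally. intros eps.
  pose proof (proj1 (filterlim_locally _ _) (is_lim_exp_m) eps) as He.
  assert (Hm : Rbar_locally m_infty (fun t => t < -1)) by (exists (-1); auto).
  assert (He' : Rbar_locally m_infty (fun t => exp t < eps)).
  { destruct He as [M HM]. exists M. intros t Ht. specialize (HM t Ht).
    apply Rabs_def2 in HM. unfold minus, plus, opp in HM; simpl in HM. lra. }
  generalize (filter_and _ _ He' Hm). apply filter_imp. intros t [H1 H2].
  pose proof (Ein_log_asymptotic (- t) ltac:(lra)) as B. unfold Ein_log in B.
  rewrite Ropp_involutive in B. rewrite Rabs_left by lra.
  unfold ball; simpl; unfold AbsRing_ball, abs, minus, plus, opp; simpl.
  rewrite <- Rabs_Ropp. eapply Rle_lt_trans; [|exact H1].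
  eapply Rle_trans; [|exact B]. right. f_equal. ring.
Qed.

Lemma Ei_to_neg (y : R) : y < 0 -> Ei_to y = euler_gamma + ln (Rabs y) + Ein y.
Proof.
  intros Hy. set (Phi := fun t => euler_gamma + ln (Rabs t) + Ein t).
  unfold Ei_to. apply (is_RInt_gen_unique (V := R_CompleteNormedModule)).
  replace (euler_gamma + ln (Rabs y) + Ein y) with (Phi y - 0) by (unfold Phi; ring).
  assert (Hneg : filter_prod (Rbar_locally m_infty) (at_point y)
     (fun ab => forall x, Rmin (fst ab) (snd ab) <= x <= Rmax (fst ab) (snd ab) -> x < 0)).
  { apply (Filter_prod _ _ _ (fun a => a < y) (fun b => b = y)).
    - exists y. auto.
    - reflexivity.
    - intros a b Ha -> x. simpl. rewrite Rmin_left, Rmax_right by lra. lra. }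
  assert (HD : forall x, x <> 0 -> Derive Phi x = exp x / x).
  { intros x Hx. apply is_derive_unique. apply is_derive_log_Ein. assumption. }
  apply (is_RInt_gen_ext (V := R_NormedModule) (Derive Phi)).
  - revert Hneg. apply filter_imp. intros ab H x Hx. apply HD.
    apply Rlt_not_eq, H. split; apply Rlt_le, Hx.
  - apply is_RInt_gen_Derive.
    + revert Hneg. apply filter_imp. intros ab H x Hx. specialize (H x Hx).
      eexists. apply is_derive_log_Ein. lra.
    + revert Hneg. apply filter_imp. intros ab H x Hx. specialize (H x Hx).
      apply (continuous_ext_loc _ (fun t => exp t / t)).
      * exists (mkposreal (- x) ltac:(lra)). intros t Ht. symmetry. apply HD.
        apply Rabs_def2 in Ht. simpl in Ht. unfold minus, plus, opp in Ht; simpl in Ht. lra.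
      * apply continuous_exp_div. lra.
    + apply log_Ein_minus_infinity.
    + intros P HP. apply locally_singleton in HP. exact HP.
Qed.

Lemma Ei_series (x : R) : x <> 0 -> Ei x = euler_gamma + ln (Rabs x) + Ein x.
Proof.
  intros Hx. unfold Ei. destruct (Rlt_dec x 0) as [Hn|Hp]; [apply Ei_to_neg, Hn|].
  assert (Hx0 : 0 < x) by lra.
  apply (iota_filterlim_locally (K := R_AbsRing) (V := R_CompleteNormedModule)
     (F := at_right 0)).
  (* In the principal value ln|-eps| and ln eps cancel exactly; what remains depends on eps only
     through [Ein], which is continuous at 0. *)
  apply (filterlim_ext_loc (fun eps => (euler_gamma + ln (Rabs x) + Ein x) + (Ein (- eps) - Ein eps))).
  - exists (mkposreal x Hx0). intros eps Hb Heps.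
    apply Rabs_def2 in Hb. simpl in Hb. unfold minus, plus, opp in Hb; simpl in Hb.
    rewrite Ei_to_neg, Rabs_Ropp by lra.
    replace (RInt (fun t => exp t / t) eps x) with
      ((0 + ln (Rabs x) + Ein x) - (0 + ln (Rabs eps) + Ein eps)); [ring|].
    symmetry. apply (is_RInt_unique (V := R_CompleteNormedModule)).
    apply (is_RInt_derive (V := R_CompleteNormedModule) (fun t => 0 + ln (Rabs t) + Ein t)).
    + intros t Ht. rewrite Rmin_left in Ht by lra. apply is_derive_log_Ein. lra.
    + intros t Ht. rewrite Rmin_left in Ht by lra. apply continuous_exp_div. lra.
  - assert (Hc : continuity_pt (fun eps => (euler_gamma + ln (Rabs x) + Ein x) + (Ein (- eps) - Ein eps)) 0).
    { apply continuity_pt_plus; [apply continuity_pt_const; intros ? ?; reflexivity|].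
      apply continuity_pt_minus; [apply Ein_opp_continuity|apply Ein_continuity]. }
    apply continuity_pt_filterlim in Hc. rewrite Ropp_0 in Hc.
    rewrite Rminus_diag, Rplus_0_r in Hc.
    intros P HP. destruct (Hc P HP) as [d Hd]. exists d. intros e He _. exact (Hd e He).
Qed.

(** * Differentiation in the parameter *)

(** A second-order remainder on the unit disc yields the complex derivative, so no limit has to be
    interchanged with the Kummer series. *)
Lemma is_C_derive_quadratic (f : C -> C) (z0 l : C) (M : R) :
  (forall z, Cmod (z - z0) <= 1 ->
     Cmod (f z - f z0 - (z - z0) * l) <= M * Cmod (z - z0) ^ 2) ->
  @is_derive C_AbsRing C_NormedModule f z0 l.
Proof.
  intros H. split.
  - apply (is_linear_scal_l (K := C_AbsRing) (V := C_NormedModule)).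
  - intros x' Hx.
    assert (Ex : z0 = x').
    { apply (is_filter_lim_locally_unique (K := C_AbsRing) (V := AbsRing_NormedModule C_AbsRing)); assumption. }
    subst x'. intros eps.
    set (d := Rmin 1 (eps / (Rabs M + 1))).
    assert (HM : 0 < Rabs M + 1) by (pose proof (Rabs_pos M); lra).
    assert (Hd : 0 < d).
    { apply Rmin_glb_lt; [lra|]. apply Rdiv_lt_0_compat; [apply cond_pos|assumption]. }
    exists (mkposreal d Hd). intros z Hz.
    change (Cmod (z - z0) < d) in Hz.
    change (Cmod (f z - f z0 - (z - z0) * l) <= eps * Cmod (z - z0)).
    assert (H1 : d <= 1) by apply Rmin_l.
    assert (H2 : d <= eps / (Rabs M + 1)) by apply Rmin_r.
    eapply Rle_trans; [apply H; lra|].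
    pose proof (Cmod_ge_0 (z - z0)) as H0. pose proof (Rle_abs M).
    assert ((Rabs M + 1) * Cmod (z - z0) <= eps).
    { apply Rle_trans with ((Rabs M + 1) * (eps / (Rabs M + 1))).
      - apply Rmult_le_compat_l; lra.
      - right. field. lra. }
    simpl. rewrite Rmult_1_r, <- Rmult_assoc. apply Rmult_le_compat_r; [assumption|]. nra.
Qed.

Fixpoint rising (a : R) (k : nat) : R :=
  match k with
  | O => 1
  | S j => rising a j * (a + INR j)
  end.

Fixpoint rising_deriv (a : R) (k : nat) : R :=
  match k with
  | O => 0
  | S j => rising_deriv a j * (a + INR j) + rising a j
  end.

Lemma rising_pos (a : R) (k : nat) : 0 < a -> 0 < rising a k.
Proof.
  intros Ha. induction k as [|k IH]; cbn [rising]; [lra|].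
  pose proof (pos_INR k). apply Rmult_lt_0_compat; lra.
Qed.

Section Taylor.
Variables (a b : R).
Hypothesis Hab : Rabs a + 1 <= b.

Lemma rising_bound (k : nat) : Rabs (rising a k) <= rising b k.
Proof.
  assert (Hb : 0 < b) by (pose proof (Rabs_pos a); lra).
  induction k as [|k IH]; cbn [rising]; [rewrite Rabs_R1; lra|].
  rewrite Rabs_mult. pose proof (pos_INR k). pose proof (rising_pos b k Hb).
  apply Rmult_le_compat; try apply Rabs_pos; [assumption|].
  pose proof (Rabs_triang a (INR k)) as T. rewrite (Rabs_pos_eq (INR k)) in T; lra.
Qed.

(** The summand 1 in [Hab] pays for the extra term of the product rule: (|a| + k) + 1 <= b + k. *)
Lemma rising_deriv_bound (k : nat) : Rabs (rising_deriv a k) <= rising b k.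
Proof.
  assert (Hb : 0 < b) by (pose proof (Rabs_pos a); lra).
  induction k as [|k IH]; cbn [rising rising_deriv]; [rewrite Rabs_R0; lra|].
  pose proof (pos_INR k). pose proof (rising_pos b k Hb). pose proof (rising_bound k).
  eapply Rle_trans; [apply Rabs_triang|]. rewrite Rabs_mult.
  pose proof (Rabs_triang a (INR k)) as T. rewrite (Rabs_pos_eq (INR k)) in T by assumption.
  assert (Rabs (rising_deriv a k) * Rabs (a + INR k) <= rising b k * (Rabs a + INR k)).
  { apply Rmult_le_compat; try apply Rabs_pos; assumption. }
  nra.
Qed.

Definition rising_rem (h : C) (k : nat) : C :=
  (pochhammer (RtoC a + h) k - RtoC (rising a k) - h * RtoC (rising_deriv a k))%C.

Lemma rising_rem_S (h : C) (k : nat) :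
  rising_rem h (S k) =
  (rising_rem h k * (RtoC (a + INR k) + h) + h ^ 2 * RtoC (rising_deriv a k))%C.
Proof.
  unfold rising_rem. cbn [pochhammer rising rising_deriv].
  rewrite !RtoC_mult, !RtoC_plus, !RtoC_mult, !RtoC_plus. ring.
Qed.

(** In the recurrence of [rising_rem_S], |a + k + h| <= b + k and the new term is at most (b)_k
    |h|^2; both fit in a factor b + 1 + k, whence the rising factorial of b + 1. *)
Lemma rising_rem_bound (h : C) (k : nat) : Cmod h <= 1 ->
  Cmod (rising_rem h k) <= rising (b + 1) k * Cmod h ^ 2.
Proof.
  intros Hh.
  assert (Hb : 0 < b) by (pose proof (Rabs_pos a); lra).
  assert (Hm : forall k, rising b k <= rising (b + 1) k).
  { clear k. induction k as [|k IH]; cbn [rising]; [lra|]. pose proof (rising_pos b k Hb).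
    pose proof (pos_INR k). apply Rmult_le_compat; lra. }
  pose proof (Cmod_ge_0 h).
  induction k as [|k IH].
  - unfold rising_rem. simpl. replace (1 - 1 - h * 0)%C with (RtoC 0) by ring. rewrite Cmod_0. nra.
  - rewrite rising_rem_S. eapply Rle_trans; [apply Cmod_triangle|].
    rewrite !Cmod_mult, Cmod_pow, Cmod_R. cbn [rising].
    pose proof (rising_deriv_bound k). pose proof (Hm k). pose proof (pos_INR k).
    pose proof (Cmod_triangle (RtoC (a + INR k)) h) as T. rewrite Cmod_R in T.
    pose proof (Rabs_triang a (INR k)) as T2. rewrite (Rabs_pos_eq (INR k)) in T2 by assumption.
    assert (Cmod (rising_rem h k) * Cmod (RtoC (a + INR k) + h) <=
       rising (b + 1) k * Cmod h ^ 2 * (b + INR k)).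
    { apply Rmult_le_compat; try apply Cmod_ge_0; [assumption|lra]. }
    assert (0 <= Cmod h ^ 2) by (apply pow_le; assumption).
    nra.
Qed.

End Taylor.

(** * The Kummer series with lower parameter 2 and its dependence on kappa *)

Definition kummer_denom (k : nat) : R := INR (fact (S k)) * INR (fact k).

Lemma kummer_denom_pos (k : nat) : 0 < kummer_denom k.
Proof. apply Rmult_lt_0_compat; apply INR_fact_lt_0. Qed.

Lemma kummer_denom_S (k : nat) :
  kummer_denom (S k) = (INR k + 2) * (INR k + 1) * kummer_denom k.
Proof.
  unfold kummer_denom. rewrite (fact_simpl (S k)), mult_INR, (fact_simpl k), mult_INR, !S_INR. ring.
Qed.

Lemma CV_radius_kummer (b : R) : 0 < b ->
  CV_radius (fun k => rising b k / kummer_denom k) = p_infty.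
Proof.
  intros Hb. apply CV_radius_infinite_DAlembert.
  - intro k. apply Rgt_not_eq, Rdiv_lt_0_compat; [apply rising_pos, Hb|apply kummer_denom_pos].
  - assert (V : is_lim_seq (fun n => (b + 1) * / INR (S n)) 0).
    { replace (Finite 0) with (Rbar_mult (b + 1) 0) by (simpl; f_equal; ring).
      apply is_lim_seq_scal_l.
      apply (is_lim_seq_incr_1 (fun n => / INR n)). apply (is_lim_seq_inv INR p_infty).
      - apply is_lim_seq_INR.
      - discriminate. }
    apply (is_lim_seq_le_le (fun _ => 0) _ (fun n => (b + 1) * / INR (S n))); [|apply is_lim_seq_const|exact V].
    intro n. split; [apply Rabs_pos|].
    cbn [rising]. rewrite kummer_denom_S, S_INR. pose proof (kummer_denom_pos n).
    pose proof (rising_pos b n Hb). pose proof (pos_INR n).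
    assert (P : 0 <= (b + INR n) / (INR n + 2) <= b + 1).
    { split; [apply Rmult_le_pos; [lra|left; apply Rinv_0_lt_compat; lra]|].
      apply Rle_div_l; nra. }
    assert (Q : 0 < / (INR n + 1)) by (apply Rinv_0_lt_compat; lra).
    replace (_ / _ / _) with ((b + INR n) / (INR n + 2) * / (INR n + 1)) by (field; lra).
    rewrite Rabs_pos_eq by nra. apply Rmult_le_compat_r; lra.
Qed.

Lemma is_pseries_real (u : nat -> R) (x l : R) :
  is_pseries u x l <-> is_series (fun k => u k * x ^ k) l.
Proof.
  assert (E : forall k, scal (pow_n x k) (u k) = u k * x ^ k).
  { intro k. rewrite pow_n_pow. apply Rmult_comm. }
  unfold is_pseries. split; apply is_series_ext; intro k; [|symmetry]; apply E.
Qed.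

Lemma CV_radius_infinite (u : nat -> R) :
  (forall x, ex_pseries u x) -> CV_radius u = p_infty.
Proof.
  intros H.
  assert (N : forall x, ~ Rbar_lt (CV_radius u) (Rabs x)).
  { intros x Hx. apply (CV_disk_outside u x Hx). destruct (H x) as [l Hl].
    apply ex_series_lim_0. exists l. exact (proj1 (is_pseries_real _ _ _) Hl). }
  destruct (CV_radius u) as [r| |]; [exfalso|reflexivity|exfalso].
  - apply (N (Rabs r + 1)). simpl. pose proof (Rabs_pos r). pose proof (Rle_abs r).
    rewrite (Rabs_pos_eq (Rabs r + 1)); lra.
  - apply (N 0). exact I.
Qed.

Lemma CV_radius_dominated (u v : nat -> R) :
  (forall k, Rabs (u k) <= v k) -> CV_radius v = p_infty -> CV_radius u = p_infty.
Proof.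
  intros H Hv. apply CV_radius_infinite. intro x.
  destruct (CV_disk_inside v x) as [l Hl]; [rewrite Hv; exact I|].
  destruct (ex_series_le (K := R_AbsRing) (V := R_CompleteNormedModule) (fun k => u k * x ^ k)
     (fun k => Rabs (v k * x ^ k))) as [m Hm].
  - intro k. change (Rabs (u k * x ^ k) <= Rabs (v k * x ^ k)). rewrite !Rabs_mult.
    apply Rmult_le_compat_r; [apply Rabs_pos|]. eapply Rle_trans; [apply H|apply Rle_abs].
  - exists l. exact Hl.
  - exists m. exact (proj2 (is_pseries_real _ _ _) Hm).
Qed.

Lemma is_Cseries_RtoC (u : nat -> R) (l : R) :
  is_series u l -> @is_series C_AbsRing C_NormedModule (fun k => RtoC (u k)) (RtoC l).
Proof.
  intros H. apply is_Cseries_iff. intros eps Heps.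
  destruct (proj1 (filterlim_locally _ _) H (mkposreal eps Heps)) as [N HN].
  exists N. intros n Hn. specialize (HN n Hn).
  replace (Csum (fun k => RtoC (u k)) n) with (RtoC (sum_n u n)).
  - rewrite <- RtoC_minus, Cmod_R. exact HN.
  - clear. induction n as [|n IH]; cbn [Csum]; [now rewrite sum_O|].
    rewrite sum_Sn, <- IH, <- RtoC_plus. reflexivity.
Qed.

Lemma Cmod_series_le (u : nat -> C) (v : nat -> R) (l : C) (S : R) :
  (forall k, Cmod (u k) <= v k) -> @is_series C_AbsRing C_NormedModule u l -> is_series v S ->
  Cmod l <= S.
Proof.
  intros H Hu Hv. apply le_epsilon. intros eps Heps.
  destruct (proj1 (is_Cseries_iff _ _) Hu eps Heps) as [N HN].
  specialize (HN N (le_n N)).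
  assert (B : forall n, Cmod (Csum u n) <= sum_n v n).
  { induction n as [|n IH]; cbn [Csum]; [rewrite sum_O; apply H|].
    rewrite sum_Sn. eapply Rle_trans; [apply Cmod_triangle|].
    apply Rplus_le_compat; [exact IH|apply H]. }
  assert (Hs : sum_n v N <= S).
  { apply (is_lim_seq_incr_compare (sum_n v) S Hv). intro n. rewrite sum_Sn.
    specialize (H (Datatypes.S n)). pose proof (Cmod_ge_0 (u (Datatypes.S n))).
    unfold plus; simpl. lra. }
  specialize (B N). set (s := Csum u N) in *.
  replace l with (s - (s - l))%C by ring. unfold Cminus at 1.
  eapply Rle_trans; [apply Cmod_triangle|]. rewrite Cmod_opp. lra.
Qed.

Lemma pochhammer_two (k : nat) :
  pochhammer (RtoC 1 + RtoC 2 * RtoC (1 / 2)) k = RtoC (INR (fact (S k))).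
Proof.
  replace (RtoC 1 + RtoC 2 * RtoC (1 / 2))%C with (RtoC 2)
    by (rewrite <- RtoC_mult, <- RtoC_plus; f_equal; field).
  induction k as [|k IH]; cbn [pochhammer]; [reflexivity|].
  rewrite IH, (fact_simpl (S k)), mult_INR, !RtoC_mult, (S_INR (S k)), (S_INR k), !RtoC_plus. ring.
Qed.

Definition kummer_coeff (n k : nat) : R := rising (1 - INR n) k / kummer_denom k.

(** The sign comes from the upper parameter 1 - kappa, which decreases as kappa grows. *)
Definition kummer_deriv_coeff (n k : nat) : R := - rising_deriv (1 - INR n) k / kummer_denom k.

Lemma kummer_coeff_dominated (n k : nat) :
  Rabs (kummer_coeff n k) <= rising (INR n + 2) k / kummer_denom k /\
  Rabs (kummer_deriv_coeff n k) <= rising (INR n + 2) k / kummer_denom k.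
Proof.
  assert (Hab : Rabs (1 - INR n) + 1 <= INR n + 2).
  { pose proof (pos_INR n). unfold Rabs. destruct (Rcase_abs _); lra. }
  pose proof (kummer_denom_pos k) as Hp. assert (0 < / kummer_denom k) by (apply Rinv_0_lt_compat; exact Hp).
  unfold kummer_coeff, kummer_deriv_coeff, Rdiv. rewrite !Rabs_mult, Rabs_Ropp.
  rewrite (Rabs_pos_eq (/ kummer_denom k)) by lra.
  split; apply Rmult_le_compat_r; try lra; [apply rising_bound|apply rising_deriv_bound]; exact Hab.
Qed.

Lemma CV_radius_kummer_coeff (n : nat) : CV_radius (kummer_coeff n) = p_infty.
Proof.
  eapply CV_radius_dominated; [intro k; apply (proj1 (kummer_coeff_dominated n k))|].
  apply CV_radius_kummer. pose proof (pos_INR n). lra.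
Qed.

Lemma CV_radius_kummer_deriv_coeff (n : nat) : CV_radius (kummer_deriv_coeff n) = p_infty.
Proof.
  eapply CV_radius_dominated; [intro k; apply (proj2 (kummer_coeff_dominated n k))|].
  apply CV_radius_kummer. pose proof (pos_INR n). lra.
Qed.

Lemma is_pseries_entire (u : nat -> R) (x : R) : CV_radius u = p_infty -> is_pseries u x (PSeries u x).
Proof.
  intros H. apply PSeries_correct, CV_radius_inside. rewrite H. exact I.
Qed.

(** The second-order remainders of the coefficients are majorised by (b+1)_k |h|^2, and the Kummer
    series with those numerators is entire; M is its sum at |x|. With kappa = n - h the upper
    parameter is 1 - n + h. *)
Lemma hyp1F1_taylor (n : nat) (x : R) : exists M, forall h : C, Cmod h <= 1 ->
  Cmod (hyp1F1 (RtoC (1 / 2) + RtoC (1 / 2) - (RtoC (INR n) - h)) (RtoC 1 + RtoC 2 * RtoC (1 / 2)) (RtoC x)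
     - (RtoC (PSeries (kummer_coeff n) x) - h * RtoC (PSeries (kummer_deriv_coeff n) x)))
   <= M * Cmod h ^ 2.
Proof.
  set (b := INR n + 2).
  assert (Hab : Rabs (1 - INR n) + 1 <= b).
  { unfold b. pose proof (pos_INR n). unfold Rabs. destruct (Rcase_abs _); lra. }
  assert (Hb : 0 < b + 1) by (unfold b; pose proof (pos_INR n); lra).
  set (v := fun k => rising (b + 1) k / kummer_denom k).
  set (M := PSeries v (Rabs x)).
  assert (HM : is_series (fun k => v k * Rabs x ^ k) M).
  { apply (proj1 (is_pseries_real _ _ _)), is_pseries_entire, CV_radius_kummer, Hb. }
  exists M. intros h Hh.
  set (a := 1 - INR n).
  set (r := fun k => (rising_rem a h k * RtoC (x ^ k / kummer_denom k))%C).
  assert (Hr : forall k, Cmod (r k) <= v k * Rabs x ^ k * Cmod h ^ 2).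
  { intro k. unfold r, v. pose proof (kummer_denom_pos k) as Hp.
    assert (0 < / kummer_denom k) by (apply Rinv_0_lt_compat; exact Hp).
    rewrite Cmod_mult, Cmod_R. unfold Rdiv. rewrite Rabs_mult, <- RPow_abs, (Rabs_pos_eq (/ _)) by lra.
    replace (rising (b + 1) k * / kummer_denom k * Rabs x ^ k * Cmod h ^ 2) with
      (rising (b + 1) k * Cmod h ^ 2 * (Rabs x ^ k * / kummer_denom k)) by ring.
    apply Rmult_le_compat_r; [|apply rising_rem_bound; assumption].
    apply Rmult_le_pos; [apply pow_le, Rabs_pos|lra]. }
  assert (HM' : is_series (fun k => v k * Rabs x ^ k * Cmod h ^ 2) (M * Cmod h ^ 2)).
  { apply (is_series_scal_r (Cmod h ^ 2) _ _ HM). }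
  assert (Hex : exists rho : C, @is_series C_AbsRing C_NormedModule r rho).
  { apply (ex_series_le (K := C_AbsRing) (V := C_CompleteNormedModule) r
              (fun k => v k * Rabs x ^ k * Cmod h ^ 2)).
    - intro k. exact (Hr k).
    - eexists; exact HM'. }
  destruct Hex as [rho Hrho].
  assert (HS : is_Cpseries
     (hyp1F1_coeff (RtoC (1 / 2) + RtoC (1 / 2) - (RtoC (INR n) - h)) (RtoC 1 + RtoC 2 * RtoC (1 / 2)))
     (RtoC x)
     (RtoC (PSeries (kummer_coeff n) x) - h * RtoC (PSeries (kummer_deriv_coeff n) x) + rho)%C).
  { pose proof (is_Cseries_RtoC _ _ (proj1 (is_pseries_real _ x _) (is_pseries_entire _ x (CV_radius_kummer_coeff n)))) as H1.
    pose proof (is_Cseries_RtoC _ _ (proj1 (is_pseries_real _ x _) (is_pseries_entire _ x (CV_radius_kummer_deriv_coeff n)))) as H2.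
    pose proof (@is_series_scal C_AbsRing C_NormedModule (- h)%C _ _ H2) as H3.
    pose proof (@is_series_plus C_AbsRing C_NormedModule _ _ _ _ (@is_series_plus C_AbsRing C_NormedModule _ _ _ _ H1 H3) Hrho) as H4.
    match type of H4 with is_series _ ?l =>
      replace (_ - _ + rho)%C with l by (simpl; unfold plus, scal; simpl; unfold mult; simpl; ring) end.
    eapply is_series_ext; [|exact H4].
    intro k. unfold plus, scal; simpl; unfold mult; simpl.
    rewrite pow_n_Cpow. unfold r, rising_rem, kummer_coeff, kummer_deriv_coeff, hyp1F1_coeff.
    replace (RtoC (1 / 2) + RtoC (1 / 2) - (RtoC (INR n) - h))%C with (RtoC a + h)%C.
    2:{ unfold a. rewrite RtoC_minus. replace (RtoC 1) with (RtoC (1 / 2) + RtoC (1 / 2))%C; [ring|].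
        rewrite <- RtoC_plus. f_equal. field. }
    rewrite pochhammer_two.
    pose proof (INR_fact_C_neq0 (S k)) as N1. pose proof (INR_fact_C_neq0 k) as N2.
    pose proof (INR_fact_neq_0 (S k)) as N3. pose proof (INR_fact_neq_0 k) as N4.
    unfold kummer_denom. fold a.
    rewrite !RtoC_mult, !RtoC_div, !RtoC_mult, RtoC_opp, RtoC_pow
      by (apply Rmult_integral_contrapositive; split; assumption).
    field. split; assumption. }
  replace (hyp1F1 _ _ _) with (RtoC (PSeries (kummer_coeff n) x) - h * RtoC (PSeries (kummer_deriv_coeff n) x) + rho)%C.
  - replace (_ + rho - _)%C with rho by ring.
    exact (Cmod_series_le _ _ _ _ Hr Hrho HM').
  - symmetry. apply (@iota_unique C_AbsRing C_CompleteNormedModule); [|exact HS].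
    intros y Hy. exact (is_Cpseries_unique _ _ _ _ Hy HS).
Qed.

Lemma whittaker_derive (n : nat) (x : R) :
  x <> 0 ->
  @is_derive C_AbsRing C_NormedModule
    (fun kappa : C => whittakerM kappa (RtoC (1 / 2)) x) (RtoC (INR n))
    (RtoC (x * exp (- x / 2) * PSeries (kummer_deriv_coeff n) x)).
Proof.
  intros Hx. destruct (hyp1F1_taylor n x) as [M HM].
  (* At mu = 1/2 the exponent is 1, and the factor e^{i PI} = -1 restores the sign of a negative
     x. *)
  assert (Hc : Rcpow x (RtoC (1 / 2) + RtoC (1 / 2)) = RtoC x).
  { replace (RtoC (1 / 2) + RtoC (1 / 2))%C with (RtoC 1) by (rewrite <- RtoC_plus; f_equal; field).
    unfold Rcpow, Cexp. rewrite Cmult_1_l. unfold Re, Im; cbn [fst snd].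
    rewrite exp_ln by (apply Rabs_pos_lt, Hx).
    destruct (Rlt_dec x 0) as [Hn|Hp].
    - rewrite cos_PI, sin_PI, Rabs_left by assumption. unfold RtoC. f_equal; ring.
    - rewrite cos_0, sin_0, Rabs_pos_eq by lra. unfold RtoC. f_equal; ring. }
  set (c := (RtoC x * RtoC (exp (- x / 2)))%C).
  set (F := fun kappa => hyp1F1 (RtoC (1 / 2) + RtoC (1 / 2) - kappa) (RtoC 1 + RtoC 2 * RtoC (1 / 2)) (RtoC x)).
  assert (HF : forall h, Cmod h <= 1 -> Cmod (F (INR n - h) - (RtoC (PSeries (kummer_coeff n) x) -
       h * RtoC (PSeries (kummer_deriv_coeff n) x)))%C <= M * Cmod h ^ 2) by exact HM.
  (* The value at n itself is read off the Taylor estimate at h = 0. *)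
  assert (F0 : F (RtoC (INR n)) = RtoC (PSeries (kummer_coeff n) x)).
  { specialize (HF (RtoC 0)). rewrite Cmod_0 in HF. specialize (HF ltac:(lra)).
    replace (INR n - 0)%C with (RtoC (INR n)) in HF by ring.
    apply Ceq_minus, Cmod_eq_0, Rle_antisym; [|apply Cmod_ge_0].
    simpl in HF. rewrite Rmult_0_l, Rmult_0_r in HF.
    match type of HF with Cmod ?u <= _ => match goal with |- Cmod ?w <= _ =>
      replace w with u by ring end end. exact HF. }
  apply (is_C_derive_quadratic _ _ _ (Cmod c * M)).
  intros z Hz. unfold whittakerM. rewrite Hc. fold c. fold (F z). fold (F (RtoC (INR n))).
  rewrite F0. set (h := (RtoC (INR n) - z)%C).
  assert (Eh : Cmod (z - INR n) = Cmod h)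
    by (unfold h; rewrite <- Cmod_opp; f_equal; ring).
  rewrite Eh in *. specialize (HF h Hz).
  replace (INR n - h)%C with z in HF by (unfold h; ring).
  set (P := PSeries (kummer_coeff n) x) in *. set (D := PSeries (kummer_deriv_coeff n) x) in *.
  replace (c * F z - c * P - (z - INR n) * RtoC (x * exp (- x / 2) * D))%C
    with (c * (F z - (P - h * D)))%C.
  - rewrite Cmod_mult, Rmult_assoc. apply Rmult_le_compat_l; [apply Cmod_ge_0|exact HF].
  - unfold c, h. rewrite !RtoC_mult. ring.
Qed.

(** * Laguerre polynomials *)

Fixpoint rsum (f : nat -> R) (N : nat) : R :=
  match N with
  | O => 0
  | S M => rsum f M + f (S M)
  end.

Lemma rsum_sum_n_m (f : nat -> R) (N : nat) : sum_n_m f 1 N = rsum f N.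
Proof.
  induction N as [|N IH]; [rewrite sum_n_m_zero by lia; reflexivity|].
  rewrite sum_n_Sm by lia. rewrite IH. reflexivity.
Qed.

Lemma rsum_ext (f g : nat -> R) (N : nat) :
  (forall l, (1 <= l <= N)%nat -> f l = g l) -> rsum f N = rsum g N.
Proof.
  induction N as [|N IH]; intros H; [reflexivity|]. cbn [rsum].
  rewrite IH, H; [reflexivity|lia|]. intros; apply H; lia.
Qed.

Lemma rsum_plus (f g : nat -> R) (N : nat) : rsum (fun l => f l + g l) N = rsum f N + rsum g N.
Proof. induction N as [|N IH]; cbn [rsum]; [ring|rewrite IH; ring]. Qed.

Lemma rsum_scal (c : R) (f : nat -> R) (N : nat) : rsum (fun l => c * f l) N = c * rsum f N.
Proof. induction N as [|N IH]; cbn [rsum]; [ring|rewrite IH; ring]. Qed.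

Lemma harmonic_rsum (n : nat) : harmonic n = rsum (fun l => / INR l) n.
Proof. apply rsum_sum_n_m. Qed.

Lemma rsum_rev (f : nat -> R) (N : nat) : rsum (fun l => f (S N - l)%nat) N = rsum f N.
Proof.
  induction N as [|N IH] in f |- *; [reflexivity|].
  assert (E : forall g M, rsum g (S M) = g 1%nat + rsum (fun l => g (S l)) M).
  { intros g M. induction M as [|M IHM]; [cbn [rsum]; ring|].
    cbn [rsum] in *. rewrite IHM. ring. }
  rewrite E. cbn [rsum]. rewrite (rsum_ext _ (fun l => f (S N - l)%nat)).
  - rewrite IH. replace (S (S N) - 1)%nat with (S N) by lia. ring.
  - reflexivity.
Qed.

(** Sum of (l + n)(R_l - 1) = 2 l R_{l+1} over l <= N, followed by a shift of index on the right. *)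
Lemma cut_value_abel (n N : nat) : (S N <= n)%nat ->
  rsum (fun l => INR (l + n) * cut_value l (n - l)) N =
  2 * (rsum (fun l => (INR l - 1) * cut_value l (n - l)) N + INR N * cut_value (S N) (n - S N))
  + rsum (fun l => INR (l + n)) N.
Proof.
  induction N as [|N IH]; intros HN; [simpl; ring|].
  cbn [rsum]. rewrite IH by lia.
  pose proof (cut_value_rec (S N) (n - S (S N)) ltac:(lia)) as E.
  replace (S (n - S (S N))) with (n - S N)%nat in E by lia.
  replace (S N + (S N + (n - S N)))%nat with (S N + n)%nat in E by lia.
  rewrite S_INR in *. lra.
Qed.

(** Write m for the current n, A for the sum of R_l and B for that of l R_l. Raising m at fixed l
    expresses the new sum through A and B; [cut_value_abel] eliminates B, and the new sum is (m +
    1)/m A + 1, which is the recurrence of m (H_m - 1). *)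
Lemma cut_value_sum (n : nat) :
  rsum (fun l => cut_value l (S n - l)) n = INR (S n) * (harmonic (S n) - 1).
Proof.
  induction n as [|n IH].
  - unfold harmonic. rewrite sum_n_n. simpl. field.
  - set (g := fun l => cut_value l (S n - l)) in *.
    pose proof (cut_value_abel (S n) n (le_n _)) as HA.
    replace (S n - S n)%nat with O in HA by lia. change (cut_value (S n) 0) with 0 in HA.
    assert (Hn : 0 < INR (S n)) by (apply lt_0_INR; lia).
    rewrite (rsum_ext _ (fun l => / (2 * INR (S n)) * (INR (l + S n) * g l + INR (l + S n)))).
    2:{ intros l Hl. replace (S (S n) - l)%nat with (S (S n - l)) by lia. cbn [cut_value].
        replace (l + (S n - l))%nat with (S n) by lia. unfold g. field. lra. }
    rewrite rsum_scal, rsum_plus. cbn [rsum].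
    assert (Gn : g (S n) = 0) by (unfold g; replace (S n - S n)%nat with O by lia; reflexivity).
    rewrite Gn.
    fold g in HA.
    change (rsum (fun l => INR (l + S n) * g l) n =
      2 * (rsum (fun l => (INR l - 1) * g l) n + INR n * 0) + rsum (fun l => INR (l + S n)) n) in HA.
    set (A := rsum g n) in *.
    set (B := rsum (fun l => INR l * g l) n).
    assert (E1 : rsum (fun l => INR (l + S n) * g l) n = B + INR (S n) * A).
    { unfold B, A. rewrite <- rsum_scal, <- rsum_plus. apply rsum_ext. intros l _.
      rewrite plus_INR. ring. }
    assert (E2 : rsum (fun l => (INR l - 1) * g l) n = B - A).
    { transitivity (B + -1 * A); [|ring]. unfold B, A. rewrite <- rsum_scal, <- rsum_plus.
      apply rsum_ext. intros l _. ring. }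
    rewrite E1, E2 in HA. rewrite E1.
    set (Z := rsum (fun l => INR (l + S n)) n) in *.
    assert (EB : B = (INR (S n) + 2) * A - Z) by lra.
    rewrite EB, (harmonic_S (S n)), IH.
    rewrite plus_INR, (S_INR (S n)). field. lra.
Qed.

(** * The Laguerre polynomials as Kummer series *)

Definition lag_coeff (n k : nat) : R := INR n * kummer_coeff n k.

Lemma CV_radius_lag_coeff (n : nat) : CV_radius (lag_coeff n) = p_infty.
Proof.
  apply CV_radius_infinite. intro x. apply (ex_pseries_scal (V := R_NormedModule)).
  - apply Rmult_comm.
  - eexists. apply is_pseries_entire, CV_radius_kummer_coeff.
Qed.

(** L_{n-1}^{(1)} = n 1F1(1 - n; 2; x), kept as a power series so that its differential and
    contiguity relations become identities between coefficients. The factor n makes [lag 0] vanish,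
    which starts the telescoping sums. *)
Definition lag (n : nat) (x : R) : R := PSeries (lag_coeff n) x.
Definition lag1 (n : nat) (x : R) : R := PSeries (PS_derive (lag_coeff n)) x.
Definition lag2 (n : nat) (x : R) : R := PSeries (PS_derive (PS_derive (lag_coeff n))) x.

Lemma is_derive_entire (u : nat -> R) (x : R) : CV_radius u = p_infty ->
  is_derive (PSeries u) x (PSeries (PS_derive u) x).
Proof. intros H. apply is_derive_PSeries. rewrite H. exact I. Qed.

Lemma is_derive_lag (n : nat) (x : R) : is_derive (lag n) x (lag1 n x).
Proof. apply is_derive_entire, CV_radius_lag_coeff. Qed.

Lemma is_derive_lag1 (n : nat) (x : R) : is_derive (lag1 n) x (lag2 n x).
Proof. apply is_derive_entire. rewrite CV_radius_derive. apply CV_radius_lag_coeff. Qed.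

Lemma rising_shift (a : R) (k : nat) : rising a (S k) = a * rising (a + 1) k.
Proof.
  induction k as [|k IH]; [simpl; ring|].
  cbn [rising] in *. rewrite IH, S_INR. ring.
Qed.

Lemma lag_coeff_S (n k : nat) :
  (INR k + 2) * (INR k + 1) * lag_coeff n (S k) = (INR k + 1 - INR n) * lag_coeff n k.
Proof.
  unfold lag_coeff, kummer_coeff. rewrite kummer_denom_S. cbn [rising].
  pose proof (kummer_denom_pos k). pose proof (pos_INR k). field. lra.
Qed.

(** Two ways of splitting (-n)_{k+1}: by its last factor k - n, or by its first factor -n. *)
Lemma lag_coeff_contiguous (n k : nat) :
  (INR n - INR k) * lag_coeff (S n) k = (INR n + 1) * lag_coeff n k.
Proof.
  unfold lag_coeff, kummer_coeff. pose proof (kummer_denom_pos k).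
  pose proof (rising_shift (1 - INR (S n)) k) as E. cbn [rising] in E.
  rewrite S_INR in *. replace (1 - (INR n + 1) + 1) with (1 - INR n) in E by ring.
  apply Rmult_eq_reg_r with (kummer_denom k); [|lra].
  transitivity (- (INR n + 1) * (rising (1 - (INR n + 1)) k * (1 - (INR n + 1) + INR k))); [field; lra|].
  rewrite E. field. lra.
Qed.

Lemma PSeries_entire_plus (u v : nat -> R) (x : R) :
  CV_radius u = p_infty -> CV_radius v = p_infty ->
  PSeries (fun k => u k + v k) x = PSeries u x + PSeries v x.
Proof.
  intros Hu Hv. apply (PSeries_plus u v); eexists; apply is_pseries_entire; assumption.
Qed.

Lemma PSeries_scal_fun (c : R) (u : nat -> R) (x : R) :
  PSeries (fun k => c * u k) x = c * PSeries u x.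
Proof. apply (PSeries_scal c u x). Qed.

Lemma CV_radius_infinite_scal (c : R) (u : nat -> R) :
  CV_radius u = p_infty -> CV_radius (fun k => c * u k) = p_infty.
Proof.
  intros H. apply CV_radius_infinite. intro x.
  apply (ex_pseries_scal (V := R_NormedModule)); [apply Rmult_comm|].
  eexists; apply is_pseries_entire, H.
Qed.

Lemma CV_radius_infinite_plus (u v : nat -> R) :
  CV_radius u = p_infty -> CV_radius v = p_infty -> CV_radius (fun k => u k + v k) = p_infty.
Proof.
  intros Hu Hv. apply CV_radius_infinite. intro x.
  apply (ex_pseries_plus (V := R_NormedModule)); eexists; apply is_pseries_entire; assumption.
Qed.

Lemma lag1_S (n : nat) (x : R) : lag1 (S n) x = lag1 n x - lag n x.
Proof.
  unfold lag1, lag.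
  transitivity (PSeries (fun k => PS_derive (lag_coeff n) k + (-1) * lag_coeff n k) x).
  - apply PSeries_ext. intro k. unfold PS_derive. rewrite S_INR.
    pose proof (pos_INR k) as Hk. pose proof (pos_INR n) as Hn.
    assert (R1 := lag_coeff_S n k). assert (R2 := lag_coeff_contiguous n k).
    assert (R3 := lag_coeff_S (S n) k).
    rewrite S_INR in R3.
    apply Rmult_eq_reg_l with (INR k + 2); [|lra]. lra.
  - rewrite PSeries_entire_plus, PSeries_scal_fun; [ring| |].
    + rewrite CV_radius_derive. apply CV_radius_lag_coeff.
    + apply CV_radius_infinite_scal, CV_radius_lag_coeff.
Qed.

Lemma PSeries_theta (u : nat -> R) (x : R) :
  x * PSeries (PS_derive u) x = PSeries (fun k => INR k * u k) x.
Proof.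
  rewrite <- PSeries_incr_1. apply PSeries_ext. intros [|k]; simpl PS_incr_1; unfold PS_derive.
  - simpl. unfold zero; simpl. ring.
  - reflexivity.
Qed.

Lemma CV_radius_infinite_theta (u : nat -> R) :
  CV_radius u = p_infty -> CV_radius (fun k => INR k * u k) = p_infty.
Proof.
  intros Hu. apply CV_radius_infinite. intro y.
  apply (ex_pseries_ext (PS_incr_1 (PS_derive u))).
  - intros [|k]; simpl PS_incr_1; unfold PS_derive; [simpl; unfold zero; simpl; ring|reflexivity].
  - apply ex_pseries_incr_1. eexists. apply is_pseries_entire. rewrite CV_radius_derive. exact Hu.
Qed.

(** The operator x d/dx multiplies the k-th coefficient by k, so this is [lag_coeff_contiguous]
    solved for that term. *)
Lemma lag_theta (n : nat) (x : R) :
  x * lag1 (S n) x = INR n * lag (S n) x - (INR n + 1) * lag n x.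
Proof.
  unfold lag1, lag. rewrite PSeries_theta.
  transitivity (PSeries (fun k => INR n * lag_coeff (S n) k + - (INR n + 1) * lag_coeff n k) x).
  - apply PSeries_ext. intro k. pose proof (lag_coeff_contiguous n k). lra.
  - rewrite PSeries_entire_plus, !PSeries_scal_fun; [ring| |];
      apply CV_radius_infinite_scal, CV_radius_lag_coeff.
Qed.

Lemma lag_ode (n : nat) (x : R) :
  x * lag2 n x + (2 - x) * lag1 n x + (INR n - 1) * lag n x = 0.
Proof.
  assert (E : x * lag2 n x + 2 * lag1 n x = x * lag1 n x + (1 - INR n) * lag n x); [|lra].
  unfold lag, lag1, lag2. rewrite !PSeries_theta, <- !PSeries_scal_fun.
  assert (H1 : CV_radius (PS_derive (lag_coeff n)) = p_infty)
    by (rewrite CV_radius_derive; apply CV_radius_lag_coeff).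
  rewrite <- (PSeries_entire_plus (fun k => INR k * PS_derive (lag_coeff n) k)
    (fun k => 2 * PS_derive (lag_coeff n) k) x (CV_radius_infinite_theta _ H1) (CV_radius_infinite_scal _ _ H1)).
  rewrite <- (PSeries_entire_plus (fun k => INR k * lag_coeff n k)
    (fun k => (1 - INR n) * lag_coeff n k) x
    (CV_radius_infinite_theta _ (CV_radius_lag_coeff n)) (CV_radius_infinite_scal _ _ (CV_radius_lag_coeff n))).
  apply PSeries_ext. intro k. unfold PS_derive. rewrite !S_INR.
  pose proof (lag_coeff_S n k). lra.
Qed.

Lemma lag_0 (x : R) : lag 0 x = 0.
Proof.
  unfold lag. rewrite (PSeries_ext _ (fun _ => 0)); [apply PSeries_const_0|].
  intro k. unfold lag_coeff. simpl. ring.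
Qed.

Lemma lag1_0 (x : R) : lag1 0 x = 0.
Proof.
  unfold lag1. rewrite (PSeries_ext _ (fun _ => 0)); [apply PSeries_const_0|].
  intro k. unfold PS_derive, lag_coeff. simpl. ring.
Qed.

Lemma lag_at_0 (n : nat) : lag n 0 = INR n.
Proof. unfold lag. rewrite PSeries_0. unfold lag_coeff, kummer_coeff, kummer_denom. simpl. field. Qed.

Lemma PSeries_finite (u : nat -> R) (N : nat) (x : R) :
  (forall k, (N < k)%nat -> u k = 0) -> PSeries u x = sum_n (fun k => u k * x ^ k) N.
Proof.
  intros H. apply is_pseries_unique, (proj2 (is_pseries_real _ _ _)).
  assert (L : is_lim_seq (sum_n (fun k => u k * x ^ k)) (sum_n (fun k => u k * x ^ k) N)); [|exact L].
  apply (is_lim_seq_ext_loc (fun _ => sum_n (fun k => u k * x ^ k) N)); [|apply is_lim_seq_const].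
  exists N. intros n Hn. induction Hn as [|n Hn IH]; [reflexivity|].
  rewrite sum_Sn, <- IH, H by lia. rewrite Rmult_0_l. symmetry. apply Rplus_0_r.
Qed.

Lemma rising_neg (n k : nat) : (k <= n)%nat ->
  rising (1 - INR (S n)) k * INR (fact (n - k)) = (-1) ^ k * INR (fact n).
Proof.
  induction k as [|k IH]; intros Hk.
  - rewrite Nat.sub_0_r. simpl. ring.
  - cbn [rising pow]. specialize (IH ltac:(lia)).
    replace (n - k)%nat with (S (n - S k)) in IH by lia.
    rewrite fact_simpl, mult_INR in IH.
    replace (INR (S (n - S k))) with (INR n - INR k) in IH.
    + rewrite S_INR in *. lra.
    + rewrite <- minus_INR by lia. f_equal. lia.
Qed.

Lemma rising_neg_zero (n k : nat) : (n < k)%nat -> rising (1 - INR (S n)) k = 0.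
Proof.
  intros Hk. induction Hk as [|k Hk IH]; cbn [rising].
  - rewrite S_INR. ring.
  - rewrite IH. ring.
Qed.

Lemma laguerre_lag (n : nat) (x : R) : (1 <= n)%nat -> laguerre (n - 1) 1 x = lag n x.
Proof.
  intros Hn. destruct n as [|n]; [lia|]. replace (S n - 1)%nat with n by lia.
  unfold lag. rewrite (PSeries_finite _ n).
  - unfold laguerre, sum_n. apply sum_n_m_ext_loc. intros k [_ Hk].
    match goal with |- ?u = ?v => change (@eq R u v) end.
    pose proof (rising_neg n k Hk) as E.
    pose proof (INR_fact_neq_0 k). pose proof (INR_fact_neq_0 (n - k)).
    pose proof (INR_fact_neq_0 (S k)).
    unfold lag_coeff, kummer_coeff, kummer_denom.
    replace (n + 1)%nat with (S n) by lia. replace (k + 1)%nat with (S k) by lia.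
    replace (rising (1 - INR (S n)) k) with ((-1) ^ k * INR (fact n) / INR (fact (n - k)))
      by (rewrite <- E; field; assumption).
    replace (- x) with (-1 * x) by ring. rewrite Rpow_mult_distr.
    rewrite (fact_simpl n), mult_INR. field. repeat split; assumption.
  - intros k Hk. unfold lag_coeff, kummer_coeff. rewrite rising_neg_zero by assumption.
    unfold Rdiv. ring.
Qed.

Lemma lag_sum (N : nat) (x : R) : rsum (fun l => lag l x) N = - lag1 (S N) x.
Proof.
  induction N as [|N IH]; cbn [rsum].
  - rewrite lag1_S, lag_0, lag1_0. ring.
  - rewrite IH, (lag1_S (S N)). ring.
Qed.

(** A telescoping sum: [lag_theta] and [lag1_S] express both derivatives on the right through
    [lag (S N)] and [lag (S (S N))], and the increment reduces to the new summand. *)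
Lemma lag_sum_div (N : nat) (x : R) :
  x * rsum (fun l => lag l x / INR l) N =
  1 - lag (S N) x / INR (S N) - x * lag1 (S N) x / INR (S N).
Proof.
  induction N as [|N IH].
  - rewrite lag1_S, lag_0, lag1_0. simpl.
    assert (E : lag 1 x = 1).
    { unfold lag. rewrite (PSeries_finite _ 0); [|intros k Hk].
      - rewrite sum_O. unfold lag_coeff, kummer_coeff, kummer_denom. simpl. field.
      - unfold lag_coeff, kummer_coeff. change 1%nat with (S 0). rewrite rising_neg_zero by assumption.
        unfold Rdiv; ring. }
    rewrite E. field.
  - cbn [rsum]. rewrite Rmult_plus_distr_l, IH.
    pose proof (lag_theta (S N) x) as E1. pose proof (lag1_S (S N) x) as E2.
    assert (0 < INR (S N)) by (apply lt_0_INR; lia). rewrite (S_INR (S N)).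
    set (m := INR (S N)) in *.
    replace (x * lag1 (S (S N)) x) with (m * lag (S (S N)) x - (m + 1) * lag (S N) x) by lra.
    replace (x * lag1 (S N) x) with (m * lag (S (S N)) x - (m + 1) * lag (S N) x + x * lag (S N) x)
      by (rewrite <- E1, E2; ring).
    field. lra.
Qed.

(** Since (n + l)/l = n/l + 1, the two preceding sums combine. The factor x is inherited from
    [lag_sum_div] and is why the equation below is stated after multiplication by x. *)
Lemma lag_weighted_sum (n : nat) (x : R) : (1 <= n)%nat ->
  x * rsum (fun l => (INR n + INR l) / INR l * lag l x) (n - 1) =
  INR n - lag n x - 2 * x * lag1 n x.
Proof.
  intros Hn. destruct n as [|N]; [lia|]. replace (S N - 1)%nat with N by lia.
  rewrite (rsum_ext _ (fun l => INR (S N) * (lag l x / INR l) + lag l x)).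
  - rewrite rsum_plus, rsum_scal, lag_sum.
    pose proof (lag_sum_div N x) as E. assert (0 < INR (S N)) by (apply lt_0_INR; lia).
    replace (x * (INR (S N) * rsum (fun l => lag l x / INR l) N + - lag1 (S N) x)) with
      (INR (S N) * (x * rsum (fun l => lag l x / INR l) N) - x * lag1 (S N) x) by ring.
    rewrite E. field. lra.
  - intros l Hl. field. apply not_0_INR. lia.
Qed.

(** By [lag_theta] the bracket is (n + l) L_{l-1}^{(1)} - 2 l L_{l-2}^{(1)}; replacing (n + l) R_l
    by n + l + 2 l R_{l+1} leaves (n + l)/l L_{l-1}^{(1)} plus the increment of 2 R_l
    L_{l-2}^{(1)}. *)
Lemma cut_value_telescope (n N : nat) (x : R) : (S N <= n)%nat ->
  rsum (fun l => cut_value l (n - l) / INR l *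
          (2 * x * lag1 l x + (INR n - INR l + 2) * lag l x)) N =
  rsum (fun l => (INR n + INR l) / INR l * lag l x) N
  + 2 * cut_value (S N) (n - S N) * lag N x.
Proof.
  induction N as [|N IH]; intros HN.
  - cbn [rsum]. rewrite lag_0. ring.
  - cbn [rsum]. rewrite IH by lia.
    pose proof (cut_value_rec (S N) (n - S (S N)) ltac:(lia)) as E.
    replace (S (n - S (S N))) with (n - S N)%nat in E by lia.
    replace (S N + (S N + (n - S N)))%nat with (S N + n)%nat in E by lia.
    rewrite plus_INR in E.
    pose proof (lag_theta N x) as E2. assert (0 < INR (S N)) by (apply lt_0_INR; lia).
    set (r := cut_value (S N) (n - S N)) in *. set (r' := cut_value (S (S N)) (n - S (S N))) in *.
    assert (Er : r' = (INR (S N) + INR n) * (r - 1) / (2 * INR (S N))) by (rewrite E; field; lra).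
    rewrite Er.
    replace (2 * x * lag1 (S N) x) with (2 * (x * lag1 (S N) x)) by ring.
    rewrite E2. replace (INR N) with (INR (S N) - 1) by (rewrite S_INR; ring).
    field. lra.
Qed.

(** * The inhomogeneous Kummer equation *)

Definition entire (f : R -> R) : Prop :=
  exists u : nat -> R, CV_radius u = p_infty /\ forall x, f x = PSeries u x.

Lemma entire_PSeries (u : nat -> R) : CV_radius u = p_infty -> entire (PSeries u).
Proof. intros H. exists u. auto. Qed.

Lemma entire_plus (f g : R -> R) : entire f -> entire g -> entire (fun x => f x + g x).
Proof.
  intros [u [Hu Eu]] [v [Hv Ev]]. exists (fun k => u k + v k). split.
  - apply CV_radius_infinite_plus; assumption.
  - intro x. rewrite PSeries_entire_plus, Eu, Ev by assumption. reflexivity.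
Qed.

Lemma entire_scal (c : R) (f : R -> R) : entire f -> entire (fun x => c * f x).
Proof.
  intros [u [Hu Eu]]. exists (fun k => c * u k). split.
  - apply CV_radius_infinite_scal; assumption.
  - intro x. rewrite PSeries_scal_fun, Eu. reflexivity.
Qed.

Lemma entire_mult (f g : R -> R) : entire f -> entire g -> entire (fun x => f x * g x).
Proof.
  intros [u [Hu Eu]] [v [Hv Ev]]. exists (PS_mult u v). split.
  - apply CV_radius_infinite. intro x. apply ex_pseries_mult; [rewrite Hu|rewrite Hv]; exact I.
  - intro x. rewrite PSeries_mult, Eu, Ev; [reflexivity|rewrite Hu; exact I|rewrite Hv; exact I].
Qed.

Lemma entire_exp : entire exp.
Proof.
  exists (fun k => / INR (fact k)). split; [apply CV_radius_exp|].
  intro x. symmetry. apply is_pseries_unique, is_exp_Reals.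
Qed.

Lemma entire_lag (n : nat) : entire (lag n).
Proof. apply entire_PSeries, CV_radius_lag_coeff. Qed.

Lemma entire_expm1_div : entire expm1_div.
Proof. apply entire_PSeries, CV_radius_expm1. Qed.

Lemma entire_Ein : entire Ein.
Proof. apply entire_PSeries. rewrite CV_radius_Int. apply CV_radius_expm1. Qed.

Lemma entire_const (c : R) : entire (fun _ => c).
Proof.
  exists (fun k => c * match k with O => 1 | S _ => 0 end).
  assert (H : forall x, is_pseries (fun k => match k with O => 1 | S _ => 0 end) x 1).
  { intro x. apply is_pseries_real.
    assert (L : is_lim_seq (sum_n (fun k => match k with O => 1 | S _ => 0 end * x ^ k)) 1); [|exact L].
    apply (is_lim_seq_ext (fun _ => 1)); [|apply is_lim_seq_const].
    induction n as [|n IH]; [rewrite sum_O; simpl; ring|].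
    rewrite sum_Sn, <- IH, Rmult_0_l. symmetry. apply Rplus_0_r. }
  split.
  - apply CV_radius_infinite_scal, CV_radius_infinite. intro x. eexists. apply H.
  - intro x. rewrite PSeries_scal_fun. symmetry. transitivity (c * 1); [|ring].
    f_equal. exact (is_pseries_unique _ _ _ (H x)).
Qed.

Lemma entire_rsum (c : nat -> R) (f : nat -> R -> R) (N : nat) :
  (forall l, entire (f l)) -> entire (fun x => rsum (fun l => c l * f l x) N).
Proof.
  intros H. induction N as [|N IH]; cbn [rsum].
  - apply entire_const.
  - apply (entire_plus (fun x => rsum (fun l => c l * f l x) N)); [exact IH|].
    apply entire_scal, H.
Qed.

Lemma is_derive_rsum (c : nat -> R) (f f' : nat -> R -> R) (N : nat) (x : R) :
  (forall l, is_derive (f l) x (f' l x)) ->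
  is_derive (fun y => rsum (fun l => c l * f l y) N) x (rsum (fun l => c l * f' l x) N).
Proof.
  intros H. induction N as [|N IH]; cbn [rsum].
  - apply (is_derive_const (V := R_NormedModule)).
  - apply (is_derive_plus (V := R_NormedModule) (fun y => rsum (fun l => c l * f l y) N)); [exact IH|].
    apply (is_derive_scal (f (S N))), H.
Qed.

(** The equation reads (k + 2)(k + 1) v_{k+1} = (k + 1 - n) v_k - [lag_coeff n k]: the factor on the
    left never vanishes, so v_0 = 0 determines every coefficient. *)
Lemma kummer_ode_unique (n : nat) (V V1 V2 : R -> R) :
  entire V -> (forall x, is_derive V x (V1 x)) -> (forall x, is_derive V1 x (V2 x)) ->
  (forall x, x * (x * V2 x + (2 - x) * V1 x + (INR n - 1) * V x) = - (x * lag n x)) ->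
  V 0 = 0 ->
  forall x, V x = INR n * PSeries (kummer_deriv_coeff n) x.
Proof.
  intros [v [Hv Ev]] H1 H2 Hode H0.
  assert (Hv1 : CV_radius (PS_derive v) = p_infty) by (rewrite CV_radius_derive; assumption).
  assert (E1 : forall x, V1 x = PSeries (PS_derive v) x).
  { intro x. rewrite <- (is_derive_unique _ _ _ (H1 x)). apply is_derive_unique.
    apply (is_derive_ext (PSeries v)); [intro t; symmetry; apply Ev|].
    apply is_derive_entire, Hv. }
  assert (E2 : forall x, V2 x = PSeries (PS_derive (PS_derive v)) x).
  { intro x. rewrite <- (is_derive_unique _ _ _ (H2 x)). apply is_derive_unique.
    apply (is_derive_ext (PSeries (PS_derive v))); [intro t; symmetry; apply E1|].
    apply is_derive_entire, Hv1. }
  set (t := fun k => (INR k * PS_derive v k + 2 * PS_derive v k) +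
      (((- (1)) * (INR k * v k) + (INR n - 1) * v k) + lag_coeff n k)).
  assert (R1 : CV_radius (fun k => INR k * PS_derive v k + 2 * PS_derive v k) = p_infty).
  { apply CV_radius_infinite_plus; [apply CV_radius_infinite_theta|apply CV_radius_infinite_scal]; exact Hv1. }
  assert (R2 : CV_radius (fun k => (- (1)) * (INR k * v k) + (INR n - 1) * v k) = p_infty).
  { apply CV_radius_infinite_plus; apply CV_radius_infinite_scal; [apply CV_radius_infinite_theta|]; exact Hv. }
  assert (R3 : CV_radius (fun k => ((- (1)) * (INR k * v k) + (INR n - 1) * v k) + lag_coeff n k) = p_infty).
  { apply CV_radius_infinite_plus; [exact R2|apply CV_radius_lag_coeff]. }
  assert (R4 : CV_radius t = p_infty) by (apply CV_radius_infinite_plus; assumption).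
  assert (Et : forall x, x * PSeries t x = 0).
  { intro x. unfold t.
    rewrite (PSeries_entire_plus (fun k => INR k * PS_derive v k + 2 * PS_derive v k) _ x R1 R3).
    rewrite (PSeries_entire_plus (fun k => INR k * PS_derive v k) (fun k => 2 * PS_derive v k) x
      (CV_radius_infinite_theta _ Hv1) (CV_radius_infinite_scal 2 _ Hv1)).
    rewrite (PSeries_entire_plus (fun k => (- (1)) * (INR k * v k) + (INR n - 1) * v k) _ x R2
      (CV_radius_lag_coeff n)).
    rewrite (PSeries_entire_plus (fun k => (- (1)) * (INR k * v k)) (fun k => (INR n - 1) * v k) x
      (CV_radius_infinite_scal _ _ (CV_radius_infinite_theta v Hv)) (CV_radius_infinite_scal _ _ Hv)).
    rewrite !PSeries_scal_fun, <- !PSeries_theta.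
    specialize (Hode x). rewrite Ev, E1, E2 in Hode. unfold lag in Hode. lra. }
  (* The factor x is absorbed in a shift of the series, so the point x = 0 needs no separate
     limit. *)
  assert (Tz : forall k, t k = 0).
  { intro k.
    apply (PSeries_ext_recip (PS_incr_1 t) (fun _ => 0) (S k)).
    - rewrite CV_radius_incr_1, R4. exact I.
    - rewrite CV_radius_const_0. exact I.
    - exists (mkposreal 1 Rlt_0_1). intros y _.
      rewrite PSeries_incr_1, PSeries_const_0. apply Et. }
  assert (Ekv : forall k, v k = INR n * kummer_deriv_coeff n k).
  { induction k as [|k IH].
    - rewrite <- (PSeries_0 v), <- Ev, H0. unfold kummer_deriv_coeff. simpl. unfold Rdiv. ring.
    - specialize (Tz k). unfold t, PS_derive in Tz. rewrite IH in Tz.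
      rewrite S_INR in Tz. pose proof (pos_INR k). pose proof (kummer_denom_pos k).
      apply Rmult_eq_reg_l with ((INR k + 2) * (INR k + 1)); [|nra].
      (* The product rule defining [rising_deriv] gives the same recurrence for n times
         [kummer_deriv_coeff]; its inhomogeneous part is [lag_coeff]. *)
      transitivity ((INR k + 1 - INR n) * (INR n * kummer_deriv_coeff n k) - lag_coeff n k); [lra|].
      unfold lag_coeff, kummer_coeff, kummer_deriv_coeff. rewrite kummer_denom_S. cbn [rising_deriv].
      field. lra. }
  intro x. rewrite Ev, <- PSeries_scal_fun. apply PSeries_ext, Ekv.
Qed.

(** * The closed form and its differential equation *)

Section ClosedForm.
Variable n : nat.
Hypothesis Hn : (1 <= n)%nat.

Let c (l : nat) : R := (INR n + INR l) / (INR n - INR l) / INR l.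
Let d (l : nat) : R := cut_value l (n - l) / INR l.
Let h : R := harmonic n.
Let N : nat := (n - 1)%nat.

Let C0 (x : R) := rsum (fun l => c l * lag l x) N.
Let C1 (x : R) := rsum (fun l => c l * lag1 l x) N.
Let C2 (x : R) := rsum (fun l => c l * lag2 l x) N.
Let D0 (x : R) := rsum (fun l => d l * lag l x) N.
Let D1 (x : R) := rsum (fun l => d l * lag1 l x) N.
Let D2 (x : R) := rsum (fun l => d l * lag2 l x) N.

(** The right-hand side of the theorem multiplied by n and divided by x e^{-x/2}: the hyperbolic
    sine becomes (e^x - 1)/x, and the logarithm, gamma and Ei merge into -[Ein]. *)
Definition closed_form (x : R) : R :=
  expm1_div x - (Ein x + h) * lag n x + C0 x - exp x * D0 x.

Let f1 (x : R) := PSeries (PS_derive expm1_coeff) x.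
Let f2 (x : R) := PSeries (PS_derive (PS_derive expm1_coeff)) x.

Let V1 (x : R) : R :=
  f1 x - (expm1_div x * lag n x + (Ein x + h) * lag1 n x) + C1 x - (exp x * D0 x + exp x * D1 x).

Let V2 (x : R) : R :=
  f2 x - ((f1 x * lag n x + expm1_div x * lag1 n x) +
          (expm1_div x * lag1 n x + (Ein x + h) * lag2 n x)) + C2 x
  - ((exp x * D0 x + exp x * D1 x) + (exp x * D1 x + exp x * D2 x)).

Lemma is_derive_expm1_div (x : R) : is_derive expm1_div x (f1 x).
Proof. apply is_derive_entire, CV_radius_expm1. Qed.

Lemma is_derive_f1 (x : R) : is_derive f1 x (f2 x).
Proof. apply is_derive_entire. rewrite CV_radius_derive. apply CV_radius_expm1. Qed.

(** Differentiating x f = e^x - 1, rather than the quotient, gives a relation valid at x = 0 too. *)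
Lemma f1_spec (x : R) : x * f1 x + expm1_div x = exp x.
Proof.
  assert (D : is_derive (fun y => y * expm1_div y) x (1 * expm1_div x + x * f1 x)).
  { apply (is_derive_mult (fun y => y) expm1_div); [apply (is_derive_id (K := R_AbsRing))|apply is_derive_expm1_div|].
    intros; apply Rmult_comm. }
  apply is_derive_unique in D.
  rewrite (Derive_ext _ (fun y => exp y - 1)) in D by (intro; apply expm1_div_spec).
  assert (E : Derive (fun y => exp y - 1) x = exp x)
    by (apply is_derive_unique; auto_derive; [trivial|ring]).
  lra.
Qed.

Lemma f2_spec (x : R) : x * f2 x + 2 * f1 x = exp x.
Proof.
  assert (D : is_derive (fun y => y * f1 y + expm1_div y) x ((1 * f1 x + x * f2 x) + f1 x)).
  { apply (is_derive_plus (V := R_NormedModule) (fun y => y * f1 y)); [|apply is_derive_expm1_div].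
    apply (is_derive_mult (fun y => y) f1); [apply (is_derive_id (K := R_AbsRing))|apply is_derive_f1|].
    intros; apply Rmult_comm. }
  apply is_derive_unique in D. rewrite (Derive_ext _ exp) in D by (intro; apply f1_spec).
  assert (E : Derive exp x = exp x) by (apply is_derive_unique, is_derive_exp).
  lra.
Qed.

Lemma is_derive_Rmult (f g : R -> R) (x f' g' : R) :
  is_derive f x f' -> is_derive g x g' -> is_derive (fun y => f y * g y) x (f' * g x + f x * g').
Proof. intros Hf Hg. apply (is_derive_mult f g); [exact Hf|exact Hg|]. intros; apply Rmult_comm. Qed.

Lemma is_derive_Rplus (f g : R -> R) (x f' g' : R) :
  is_derive f x f' -> is_derive g x g' -> is_derive (fun y => f y + g y) x (f' + g').
Proof. apply (is_derive_plus (V := R_NormedModule)). Qed.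

Lemma is_derive_Rminus (f g : R -> R) (x f' g' : R) :
  is_derive f x f' -> is_derive g x g' -> is_derive (fun y => f y - g y) x (f' - g').
Proof. apply (is_derive_minus (V := R_NormedModule)). Qed.

Lemma is_derive_Ein_shift (x : R) : is_derive (fun y => Ein y + h) x (expm1_div x).
Proof.
  replace (expm1_div x) with (expm1_div x + 0) by ring.
  apply is_derive_Rplus; [apply is_derive_Ein|apply (is_derive_const (V := R_NormedModule))].
Qed.

Lemma is_derive_C0 x : is_derive C0 x (C1 x).
Proof. apply (is_derive_rsum c lag lag1). intro; apply is_derive_lag. Qed.
Lemma is_derive_C1 x : is_derive C1 x (C2 x).
Proof. apply (is_derive_rsum c lag1 lag2). intro; apply is_derive_lag1. Qed.
Lemma is_derive_D0 x : is_derive D0 x (D1 x).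
Proof. apply (is_derive_rsum d lag lag1). intro; apply is_derive_lag. Qed.
Lemma is_derive_D1 x : is_derive D1 x (D2 x).
Proof. apply (is_derive_rsum d lag1 lag2). intro; apply is_derive_lag1. Qed.

Lemma closed_form_derive x : is_derive closed_form x (V1 x).
Proof.
  apply is_derive_Rminus; [apply is_derive_Rplus; [apply is_derive_Rminus|]|].
  - apply is_derive_expm1_div.
  - apply (is_derive_Rmult (fun y => Ein y + h) (lag n)); [apply is_derive_Ein_shift|apply is_derive_lag].
  - apply is_derive_C0.
  - apply (is_derive_Rmult exp D0); [apply is_derive_exp|apply is_derive_D0].
Qed.

Lemma closed_form_derive2 x : is_derive V1 x (V2 x).
Proof.
  apply is_derive_Rminus; [apply is_derive_Rplus; [apply is_derive_Rminus|]|].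
  - apply is_derive_f1.
  - apply is_derive_Rplus.
    + apply (is_derive_Rmult expm1_div (lag n)); [apply is_derive_expm1_div|apply is_derive_lag].
    + apply (is_derive_Rmult (fun y => Ein y + h) (lag1 n)); [apply is_derive_Ein_shift|apply is_derive_lag1].
  - apply is_derive_C1.
  - apply is_derive_Rplus.
    + apply (is_derive_Rmult exp D0); [apply is_derive_exp|apply is_derive_D0].
    + apply (is_derive_Rmult exp D1); [apply is_derive_exp|apply is_derive_D1].
Qed.

Lemma closed_form_entire : entire closed_form.
Proof.
  assert (Em : forall f g, entire f -> entire g -> entire (fun x => f x - g x)).
  { intros f g Hf Hg. destruct (entire_plus _ _ Hf (entire_scal (-1) _ Hg)) as [u [Hu Eu]].
    exists u. split; [exact Hu|]. intro x. rewrite <- Eu. ring. }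
  apply Em; [apply entire_plus; [apply Em|]|].
  - apply entire_expm1_div.
  - apply entire_mult; [|apply entire_lag]. apply entire_plus; [apply entire_Ein|apply entire_const].
  - apply (entire_rsum c lag). apply entire_lag.
  - apply entire_mult; [apply entire_exp|]. apply (entire_rsum d lag). apply entire_lag.
Qed.

Let Z (x : R) : R := rsum (fun l => (INR n + INR l) / INR l * lag l x) N.

(** L_{l-1}^{(1)} solves the Kummer equation of index l; the defect (n - l) L_{l-1}^{(1)} cancels
    the denominator n - l of the weight. *)
Lemma C_ode x : x * C2 x + (2 - x) * C1 x + (INR n - 1) * C0 x = Z x.
Proof.
  unfold C0, C1, C2, Z. rewrite <- !rsum_scal, <- !rsum_plus. apply rsum_ext. intros l Hl.
  pose proof (lag_ode l x) as E. unfold N in Hl.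
  assert (0 < INR l) by (apply lt_0_INR; lia).
  assert (INR l < INR n) by (apply lt_INR; lia).
  transitivity (c l * (x * lag2 l x + (2 - x) * lag1 l x + (INR l - 1) * lag l x)
     + c l * (INR n - INR l) * lag l x); [ring|].
  rewrite E. unfold c. field. lra.
Qed.

(** The operator on the left is the Kummer operator conjugated by e^x. The weights R_l / l are those
    for which the defects telescope to the same Z as in [C_ode]. *)
Lemma D_ode x : x * D2 x + (2 + x) * D1 x + (INR n + 1) * D0 x = Z x.
Proof.
  unfold Z.
  assert (E := cut_value_telescope n N x ltac:(unfold N; lia)).
  (* The upper boundary term carries R_n = [cut_value n 0] = 0. *)
  replace (S N) with n in E by (unfold N; lia). rewrite Nat.sub_diag in E. cbn [cut_value] in E.
  rewrite Rmult_0_r, Rmult_0_l, Rplus_0_r in E. rewrite <- E.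
  unfold D0, D1, D2. rewrite <- !rsum_scal, <- !rsum_plus. apply rsum_ext. intros l Hl.
  pose proof (lag_ode l x) as E1.
  transitivity (d l * (x * lag2 l x + (2 - x) * lag1 l x + (INR l - 1) * lag l x)
     + d l * (2 * x * lag1 l x + (INR n - INR l + 2) * lag l x)); [ring|].
  rewrite E1. unfold d. ring.
Qed.

Lemma closed_form_ode x :
  x * (x * V2 x + (2 - x) * V1 x + (INR n - 1) * closed_form x) = - (x * lag n x).
Proof.
  pose proof (expm1_div_spec x) as Ef. pose proof (f1_spec x) as Ef1. pose proof (f2_spec x) as Ef2.
  pose proof (lag_ode n x) as EA. pose proof (C_ode x) as EC. pose proof (D_ode x) as ED.
  pose proof (lag_weighted_sum n x Hn) as EZ. fold N in EZ. fold (Z x) in EZ.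
  unfold V2, V1, closed_form.
  set (e := exp x) in *. set (f := expm1_div x) in *. set (g := f1 x) in *. set (k := f2 x) in *.
  set (A := lag n x) in *. set (A1 := lag1 n x) in *. set (A2 := lag2 n x) in *.
  set (z := Z x) in *. set (E := Ein x + h) in *.
  assert (T : x * (k - ((g * A + f * A1) + (f * A1 + E * A2)) + C2 x
       - ((e * D0 x + e * D1 x) + (e * D1 x + e * D2 x)))
     + (2 - x) * (g - (f * A + E * A1) + C1 x - (e * D0 x + e * D1 x))
     + (INR n - 1) * (f - E * A + C0 x - e * D0 x)
     = INR n * f - A - A * f - 2 * (e - 1) * A1 + (1 - e) * z).
  { transitivity ((x * k + 2 * g) - (x * g + f) + INR n * f
       - E * (x * A2 + (2 - x) * A1 + (INR n - 1) * A)
       - A * (x * g + f) - A * f + (x * f) * A - 2 * (x * f) * A1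
       + (x * C2 x + (2 - x) * C1 x + (INR n - 1) * C0 x)
       - e * (x * D2 x + (2 + x) * D1 x + (INR n + 1) * D0 x)); [ring|].
    rewrite Ef2, Ef1, EA, EC, ED, Ef. ring. }
  rewrite T.
  (* Multiplying by x turns x f into e^x - 1 and x z into its closed value; everything but -x A then
     cancels. *)
  transitivity (INR n * (x * f) - x * A - A * (x * f) - 2 * (e - 1) * x * A1 + (1 - e) * (x * z)); [ring|].
  rewrite EZ, Ef. ring.
Qed.

(** By (n + l)/(n - l) = 2 n/(n - l) - 1 the first sum is 2 n H_{n-1} - (n - 1); the second is n
    (H_n - 1) by [cut_value_sum]. Together with 1 - n H_n they add up to 0. *)
Lemma closed_form_0 : closed_form 0 = 0.
Proof.
  unfold closed_form. rewrite expm1_div_0, Ein_0, exp_0, lag_at_0. unfold C0, D0.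
  rewrite (rsum_ext (fun l => c l * lag l 0) (fun l => 2 * INR n * / INR (n - l) + -1)).
  2:{ intros l Hl. unfold N in Hl. rewrite lag_at_0, minus_INR by lia.
      assert (0 < INR l) by (apply lt_0_INR; lia). assert (INR l < INR n) by (apply lt_INR; lia).
      unfold c. field. lra. }
  rewrite (rsum_ext (fun l => d l * lag l 0) (fun l => cut_value l (n - l))).
  2:{ intros l Hl. rewrite lag_at_0. unfold d. field. apply not_0_INR. lia. }
  rewrite rsum_plus, rsum_scal.
  pose proof (cut_value_sum N) as E1. pose proof (rsum_rev (fun l => / INR l) N) as E2.
  cbv beta in E2. rewrite <- harmonic_rsum in E2.
  pose proof (harmonic_S N) as E3.
  assert (E4 : forall M, rsum (fun _ => -1) M = - INR M).
  { induction M as [|M IH]; cbn [rsum]; [simpl; ring|]. rewrite IH, S_INR. ring. }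
  rewrite E4. pose proof (S_INR N) as E5.
  replace (S N) with n in * by (unfold N; lia).
  rewrite E1, E2. unfold h. rewrite E3.
  assert (INR n <> 0) by (apply not_0_INR; lia).
  replace (INR N) with (INR n - 1) by lra. field. assumption.
Qed.

Lemma closed_form_series (x : R) : closed_form x = INR n * PSeries (kummer_deriv_coeff n) x.
Proof.
  apply (kummer_ode_unique n closed_form V1 V2).
  - apply closed_form_entire.
  - apply closed_form_derive.
  - apply closed_form_derive2.
  - apply closed_form_ode.
  - apply closed_form_0.
Qed.

End ClosedForm.

Theorem theorem6 (s : cut_side) (n : nat) (x : R) (hn : (1 <= n)%nat) (hx : x <> 0) :
  @is_derive C_AbsRing C_NormedModule
    (fun kappa : C => whittakerM kappa (RtoC (1 / 2)) x)
    (RtoC (INR n))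
    (RtoC
       (2 / INR n * sinh (x / 2) +
        x * exp (- x / 2) / INR n *
        ((ln (Rabs x) + euler_gamma - harmonic n - Ei x) * laguerre (n - 1) 1 x +
         sum_n_m (fun l : nat =>
           ((INR n + INR l) / (INR n - INR l) -
            exp x * Re (hyp2F1_cut s (RtoC 1) (RtoC (INR l)) (RtoC (INR (l + n))) 2)) *
           (laguerre (l - 1) 1 x / INR l)) 1 (n - 1)))).
Proof.
  match goal with |- is_derive _ _ (RtoC ?r) =>
    replace r with (x * exp (- x / 2) * PSeries (kummer_deriv_coeff n) x);
    [exact (whittaker_derive n x hx)|] end.
  assert (Hn : INR n <> 0) by (apply not_0_INR; lia).
  pose proof (closed_form_series n hn x) as E.
  rewrite rsum_sum_n_m, laguerre_lag, Ei_series by assumption.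
  rewrite (rsum_ext _ (fun l => (INR n + INR l) / (INR n - INR l) / INR l * lag l x +
      - exp x * (cut_value l (n - l) / INR l * lag l x))).
  2:{ intros l Hl. rewrite hyp2F1_cut_re, laguerre_lag by lia.
      assert (0 < INR l) by (apply lt_0_INR; lia). assert (INR l < INR n) by (apply lt_INR; lia).
      field. lra. }
  rewrite rsum_plus, rsum_scal.
  replace (PSeries (kummer_deriv_coeff n) x) with (closed_form n x / INR n)
    by (rewrite E; field; assumption).
  unfold closed_form, sinh.
  assert (E1 : exp (x / 2) = exp (- x / 2) * exp x) by (rewrite <- exp_plus; f_equal; field).
  rewrite E1. replace (- (x / 2)) with (- x / 2) by field.
  (* The second occurrence of e^x is the one coming from the hyperbolic sine; the one multiplying
     the sum of the R_l must stay. *)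
  replace (exp x) with (x * expm1_div x + 1) at 2 by (rewrite expm1_div_spec; ring).
  field. assumption.
Qed.
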